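(* Work in the setting of the context. Assume: (i) $G(\theta,\cdot)$ is $\mathbb P^Z$-integrable for every $\theta\in\Theta$, and $G(\theta_k,\cdot)\to G(\theta,\cdot)$ in $\mathbb P^Z$-probability whenever $\theta_k\to\theta$ in $\Theta$. (ii) There is a strictly positive square $\mathbb P^Z$-integrable $\xi^G:\mathbb R^d\to\mathbb R$ with $\sup_{\theta\in\Theta}|G(\theta,z)|\le\xi^G(z)$ for all $z\in\mathbb R^d$. (iii) $H(\theta,t,\cdot)$ is Borel measurable for all $(\theta,t)\in\Theta\times\mathbb R$, and $H(\theta,\overline\psi(\theta),\cdot)$ is $\mathbb P^Z$-integrable for all $\theta\in\Theta$. (iv) There are nonnegative square $\mathbb P^Z$-integrable $L_1,L_2$ with $|H(\theta,t,z)-H(\vartheta,s,z)|^2\le L_1(z)^2|G(\theta,z)-G(\vartheta,z)|^2+L_2(z)^2|t-s|^2$ for all $\theta,\vartheta\in\Theta$, $t,s\in\mathbb R$, $z\in\mathbb R^d$. (v) $\psi_{H,\Theta}$ has a unique minimizer $\theta^*$ over $\Theta$, and there is $M_1>0$ with $\psi_{H,\Theta}(\theta)-\psi_{H,\Theta}(\theta^* )\ge M_1\|\theta-\theta^*\|_m^2$ for all $\theta\in\Theta$. (vi) For every $\delta>0$ there exist an at most countable $\mathcal C(\mathcal U_\delta)\subseteq\mathcal U_\delta$ and $(\mathbb P^Z)^n$-null sets $N_n^\delta$ ($n\in\mathbb N$) such that $\inf_{\vartheta\in\mathcal C(\mathcal U_\delta)}\{\mathbb E[|G(\theta,Z_1)-G(\vartheta,Z_1)|]+\max_{1\le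 j\le n}|G(\theta,z_j)-G(\vartheta,z_j)|\}=0$ for all $\theta\in\mathcal U_\delta$, $n\in\mathbb N$, $(z_1,\dots,z_n)\in\mathbb R^{dn}\setminus N_n^\delta$. (vii) There exist $\beta\in\,]0,1]$, $\overline M_1,\overline M^1>0$ and square $\mathbb P^Z$-integrable positive envelopes $\xi^G_\delta$ of $\mathbb F^\Theta_\delta$ ($\delta\in\,]0,\Delta(\Theta)]$) such that $\|(L_1\vee1)\xi^G_\delta\|_{\mathbb P^Z,2}\le\overline M_1\delta^\beta$ and $J(\mathbb F^\Theta_\delta,\xi^G_\delta,1/8)\vee J(\mathbb F^\Theta,\xi^G,1/8)\le\overline M^1$ for all $\delta\in\,]0,\Delta(\Theta)]$. (viii) There exist $\delta_1>0$, $K_{\delta_1}\ge0$ and a Borel measurable $m_{\Theta\times\mathbb R}:\Theta\times\mathbb R\to\mathbb R$ such that $|m_{\Theta\times\mathbb R}(\theta,\overline\psi(\theta)+x)-m_{\Theta\times\mathbb R}(\theta^*,\overline\psi(\theta^* )+x)|\le K_{\delta_1}\|(\theta-\theta^*,\overline\psi(\theta)-\overline\psi(\theta^* ))\|_{m+1}$ for all $(\theta,x)\in\Theta\times[-\delta_1,\delta_1]$, and $\mathbb E[H(\theta,t,Z_1)]-\mathbb E[H(\theta,s,Z_1)]=\int_s^t m_{\Theta\times\mathbb R}(\theta,u)\,du$ for all $\theta\in\Theta$ and $t>s$. Let $a,b,\varepsilon>0$ with $a\,2^{\beta+1/2}\le b\,\varepsilon^{\beta+1/2}$, and put $\delta_{nk}:=2^kn^{-1/(4-2\beta)}$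 for $k\in\mathbb Z$, $n\in\mathbb N$. Then for every $n\in\mathbb N$ with $n\ge n(a,b,\beta)$, $$\mathbb P\big(\{n^{1/(4-2\beta)}\|\widehat\theta_n-\theta^*\|_m>\varepsilon\}\big)\le P_1^\varepsilon+P_{n2}^\varepsilon+\mathbb P(\Omega\setminus\Omega_{n,a}),$$ where $$P_1^\varepsilon:=\frac{10\,[\overline M_b\,\widehat\eta+\mathbf 1_{]0,\infty[}(\mathbb E[L_2(Z_1)])\,M_{a,b}]}{M_1}\Big(\frac2\varepsilon\Big)^{3/2-\beta}\sqrt{\frac{2}{\varepsilon\wedge2}},\qquad P_{n2}^\varepsilon:=\sum_{\substack{k\ge K_\varepsilon+1\\ \delta_{n(k-1)}\le\Delta(\Theta)}}\mathbb P\big(\Omega\setminus\Omega^n_{\delta_{nk}\wedge\Delta(\Theta),\,\sqrt2^{\,k}b}\big).$$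
   Context: Setting. $(\Omega,\mathcal F,\mathbb P)$ is a complete atomless probability space and $(Z_j)_{j\in\mathbb N}$ are i.i.d. $d$-dimensional random vectors on it with common distribution $\mathbb P^Z$. $\Theta\subset\mathbb R^m$ is compact with Euclidean diameter $\Delta(\Theta)>0$; $\|\cdot\|_k$ is the Euclidean norm on $\mathbb R^k$. $x\wedge y$, $x\vee y$ denote min and max. $\|f\|_{\mathbb Q,2}=(\int f^2\,d\mathbb Q)^{1/2}$. $G:\Theta\times\mathbb R^d\to\mathbb R$ and $H:\Theta\times\mathbb R\times\mathbb R^d\to\mathbb R$ are mappings, $\overline\psi(\theta):=\mathbb E[G(\theta,Z_1)]$, $\psi_{H,\Theta}(\theta):=\mathbb E[H(\theta,\overline\psi(\theta),Z_1)]$. $(\widehat\theta_n)_{n\in\mathbb N}$ is a sequence of $\Theta$-valued random vectors such that $\widehat\theta_n$ minimizes (for each realization) $\theta\mapsto\frac1n\sum_{j=1}^nH\big(\theta,\frac1n\sum_{k=1}^nG(\theta,Z_k),Z_j\big)$ over $\Theta$. Notation. $\mathcal U_\delta:=\{\theta\in\Theta:\|\theta-\theta^*\|_m\le\delta\}$; $\mathbb F^\Theta:=\{G(\theta,\cdot):\theta\in\Theta\}$; $\mathbb F^\Theta_\delta:=\{G(\theta,\cdot)-G(\theta^*,\cdot):\theta\in\mathcal U_\delta\}$. For $\varepsilon>0$, $K_\varepsilon$ is the largest integer not exceeding $\ln(\varepsilon)/\ln(2)$. $(\mathbb P_n-\mathbb P)(f):=\frac1n\sum_{j=1}^n(f(Z_j)-\mathbb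 E[f(Z_j)])$. Entropy. A positive envelope of a class $\mathbb F$ of Borel functions on $\mathbb R^d$ is a strictly positive Borel function $C_{\mathbb F}$ with $\sup_{h\in\mathbb F}|h|\le C_{\mathbb F}$. $N(\eta,\mathbb F,L^2(\mathbb Q))$ is the minimal number of closed $L^2(\mathbb Q)$-balls of radius $\eta$ with centers in $\mathbb F$ needed to cover $\mathbb F$ ($\infty$ if no finite cover exists). $\mathcal M_{\rm fin}$ is the set of probability measures on $\mathcal B(\mathbb R^d)$ with finite support. $J(\mathbb F,C_{\mathbb F},\delta):=\int_0^\delta\sup_{\mathbb Q\in\mathcal M_{\rm fin}}\sqrt{\ln\big(2N(\varepsilon\|C_{\mathbb F}\|_{\mathbb Q,2},\mathbb F,L^2(\mathbb Q))\big)}\,d\varepsilon$. Events (with $\beta$ from (vii)). $\Omega_{n,a}:=\{\sup_{\theta\in\Theta}|(\mathbb P_n-\mathbb P)(G(\theta,\cdot))|\le a/\sqrt n\}$; $\Omega^n_{\delta,b}:=\{\sup_{\theta\in\mathcal U_\delta}|(\mathbb P_n-\mathbb P)(G(\theta,\cdot)-G(\theta^*,\cdot))|\le b\delta^\beta/\sqrt n\}$. Constants. $M_{a,b}:=K_{\delta_1}a[\Delta(\Theta)^{1-\beta}+\overline M_1]+b\,\mathbb E[L_2(Z_1)]$; $\overline M_b:=\overline M_1(1+\|L_2\|_{\mathbb P^Z,2})+b\|L_2\|_{\mathbb P^Z,2}$; $\widehat\eta:=64\sqrt2\,(\overline M^1+0.7)$; $n(a,b,\beta):=\frac{\overline M_b^2\Delta(\Theta)^{2\beta}}2\vee\frac{\mathbf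 1_{]0,\infty[}(\mathbb E[L_2(Z_1)])\,a^2}{\delta_1^2}\vee\big[\overline M_b^2\Delta(\Theta)^{2\beta+1}\big]^{\frac{4-2\beta}{3-2\beta}}$. *)

(* Defs.v *)
From HB Require Import structures.
From mathcomp Require Import all_boot all_order all_algebra finmap.
From mathcomp Require Import all_classical all_reals all_analysis.

Set Implicit Arguments.
Unset Strict Implicit.
Unset Printing Implicit Defensive.
Import Order.TTheory GRing.Theory Num.Theory.
Import numFieldNormedType.Exports.

Local Open Scope classical_set_scope.
Local Open Scope ring_scope.

(* R^k with its Borel sigma-algebra; convertible to 'rV[R]_k. *)
Definition brV (R : realType) (k : nat) :=
  g_sigma_algebraType (@open 'rV[R]_k).

(* Euclidean norm: the library norm on 'rV[R]_k is the sup norm. *)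
Definition enorm (R : realType) (k : nat) (x : 'rV[R]_k) : R :=
  Num.sqrt (\sum_(i < k) x 0 i ^+ 2).

Definition ediam (R : realType) (k : nat) (A : set 'rV[R]_k) : R :=
  sup [set enorm (x - y) | x in A & y in A].

Section probability_notions.
Context d (T : measurableType d) (R : realType).
Local Open Scope ereal_scope.

Definition atomless (mu : {measure set T -> \bar R}) :=
  forall A, measurable A -> 0 < mu A ->
    exists B, [/\ measurable B, B `<=` A & 0 < mu B < mu A].

Definition cvg_in_probability (P : probability T R) (f : nat -> T -> R)
    (g : T -> R) :=
  forall e : R, (0 < e)%R ->
    P [set x | e < `|f k x - g x|]%R @[k --> \oo] --> 0.

Definition mutually_independent d' (T' : measurableType d')
    (P : probability T R) (X : nat -> {RV P >-> T'}) :=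
  forall (J : {fset nat}) (A : nat -> set T'), (forall j, measurable (A j)) ->
    P (\bigcap_(j in [set` J]) (X j @^-1` A j)) =
    \prod_(j <- J) P (X j @^-1` A j).

(* [mu] is the common distribution of the [X j]. *)
Definition iid d' (T' : measurableType d') (P : probability T R)
    (X : nat -> {RV P >-> T'}) (mu : probability T' R) :=
  mutually_independent X /\
  (forall j A, measurable A -> distribution P (X j) A = mu A).

End probability_notions.

Section product_power.
Context d (T : measurableType d) (R : realType).

Definition cons_pair (n : nat) (p : T * n.-tuple T) : n.+1.-tuple T :=
  [tuple of p.1 :: p.2].

Lemma measurable_cons_pair n : measurable_fun [set: T * n.-tuple T] (@cons_pair n).
Proof. exact: measurable_cons. Qed.

HB.instance Definition _ n := isMeasurableFun.Build _ _ _ _ (@cons_pair n)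
  (@measurable_cons_pair n).

(* n-fold product of [mu], on the product sigma-algebra of [n.-tuple T]. *)
Fixpoint prod_power (mu : probability T R) (n : nat) :
    probability (n.-tuple T) R :=
  match n return probability (n.-tuple T) R with
  | 0%N => dirac [tuple]
  | n'.+1 => distribution (mu \x prod_power mu n')%E (@cons_pair n')
  end.

End product_power.

Section entropy.
Context d (T : measurableType d) (R : realType).
Implicit Types (F : set (T -> R)) (C : T -> R) (Q : probability T R).
Local Open Scope ereal_scope.

Definition positive_envelope F C :=
  [/\ measurable_fun [set: T] C, (forall z, 0 < C z)%R &
      forall h z, F h -> (`|h z| <= C z)%R].

(* The infimum of the empty set is +oo. *)
Definition covering_number Q (eta : \bar R) F : \bar R :=
  ereal_inf [set (N%:R)%:E | N in [set N : nat |
    exists c : 'I_N -> T -> R, (forall i, F (c i)) /\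
      forall f, F f -> exists i, 'N[Q]_2%:E [EFin \o (f \- c i)%R] <= eta]].

Definition finitely_supported Q := exists S : set T, finite_set S /\ Q S = 1.

Definition entropy_integral F C (delta : R) : \bar R :=
  \int[lebesgue_measure]_(e in `]0%R, delta])
    ereal_sup [set sqrte
        (lne (2%:E * covering_number Q (e%:E * 'N[Q]_2%:E [EFin \o C]) F))
      | Q in finitely_supported].

End entropy.

Section setting.
Context d (Omega : measurableType d) (R : realType) (P : probability Omega R).
Variables m k : nat.
Variable Z : nat -> {RV P >-> brV R k}.
Variable Theta : set 'rV[R]_m.
Variable G : 'rV[R]_m -> brV R k -> R.
Variable H : 'rV[R]_m -> R -> brV R k -> R.

(* Z_1, Z_2, ... are [Z 0], [Z 1], ... *)
Definition mean (f : brV R k -> R) : R := fine 'E_P[fun w => f (Z 0%N w)].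

Definition psibar theta := mean (G theta).

Definition psiH theta := mean (H theta (psibar theta)).

Definition empirical_objective (n : nat) (w : Omega) theta : R :=
  n%:R^-1 * \sum_(j < n)
    H theta (n%:R^-1 * \sum_(i < n) G theta (Z i w)) (Z j w).

Definition empirical_dev (n : nat) (f : brV R k -> R) (w : Omega) : R :=
  n%:R^-1 * \sum_(j < n) (f (Z j w) - fine 'E_P[fun w' => f (Z j w')]).

Definition Unbhd (thetas : 'rV[R]_m) (delta : R) : set 'rV[R]_m :=
  [set theta | Theta theta /\ enorm (theta - thetas) <= delta].

Definition Gclass : set (brV R k -> R) := [set G theta | theta in Theta].

Definition Gclass_loc thetas delta : set (brV R k -> R) :=
  [set (fun z => G theta z - G thetas z) | theta in Unbhd thetas delta].

Definition event_global (n : nat) (a : R) : set Omega :=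
  [set w | (ereal_sup [set `|empirical_dev n (G theta) w|%:E
                      | theta in Theta] <= (a / Num.sqrt n%:R)%:E)%E].

Definition event_local thetas (beta : R) (n : nat) (delta b : R) : set Omega :=
  [set w | (ereal_sup
      [set `|empirical_dev n (fun z => G theta z - G thetas z)%R w|%:E
      | theta in Unbhd thetas delta]
    <= (b * delta `^ beta / Num.sqrt n%:R)%:E)%E].

End setting.

Section constants.
Context (R : realType).

Definition pos_ind (x : R) : R := \1_(`]0, +oo[%classic : set R) x.

(* Below, [Delta] is the diameter of Theta, [EL2] and [nL2] are the expectation of
   L_2(Z_1) and the L^2-norm of L_2; [M1lo] and [M1up] are the constants M_1 and
   M^1 (both overlined). *)
Definition Mab (K a b beta Delta M1lo EL2 : R) : R :=
  K * a * (Delta `^ (1 - beta) + M1lo) + b * EL2.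

Definition Mbar (M1lo nL2 b : R) : R := M1lo * (1 + nL2) + b * nL2.

Definition etahat (M1up : R) : R := 64 * Num.sqrt 2 * (M1up + 7 / 10).

Definition nmin (a b beta Delta delta1 M1lo nL2 EL2 : R) : R :=
  Num.max (Num.max
    (Mbar M1lo nL2 b ^+ 2 * Delta `^ (2 * beta) / 2)
    (pos_ind EL2 * a ^+ 2 / delta1 ^+ 2))
    ((Mbar M1lo nL2 b ^+ 2 * Delta `^ (2 * beta + 1))
       `^ ((4 - 2 * beta) / (3 - 2 * beta))).

Definition Keps (eps : R) : int := Num.floor (ln eps / ln 2).

Definition deltank (beta : R) (n : nat) (j : int) : R :=
  2 ^ j * n%:R `^ (- (1 / (4 - 2 * beta))).

Definition P1eps (M1 K a b beta eps Delta M1lo M1up nL2 EL2 : R) : R :=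
  10 * (Mbar M1lo nL2 b * etahat M1up
        + pos_ind EL2 * Mab K a b beta Delta M1lo EL2) / M1
  * (2 / eps) `^ (3 / 2 - beta) * Num.sqrt (2 / Num.min eps 2).

End constants.

Definition Pn2eps d (Omega : measurableType d) (R : realType)
    (P : probability Omega R) (m k : nat) (Z : nat -> {RV P >-> brV R k})
    (Theta : set 'rV[R]_m) (G : 'rV[R]_m -> brV R k -> R) (thetas : 'rV[R]_m)
    (beta b eps : R) (n : nat) : \bar R :=
  (\esum_(j in [set j : int | (Keps eps + 1 <= j)%R /\
                              (deltank beta n (j - 1) <= ediam Theta)%R])
     P (~` event_local Z Theta G thetas beta n
            (Num.min (deltank beta n j) (ediam Theta))
            (Num.sqrt 2 ^ j * b)))%E.

(* Main.v *)
From HB Require Import structures.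
Require Import Defs.
From mathcomp Require Import all_boot all_order all_algebra finmap.
From mathcomp Require Import all_classical all_reals all_analysis measurable_realfun.
From mathcomp Require Import ring lra.
Set Implicit Arguments.
Unset Strict Implicit.
Unset Printing Implicit Defensive.
Import Order.TTheory GRing.Theory Num.Theory.
Import numFieldNormedType.Exports.
Local Open Scope classical_set_scope.
Local Open Scope ring_scope.

(** Peeling: a large deviation of the estimator puts it in some dyadic shell
    [deltank beta n (j - 1) < enorm (theta - thetas) <= deltank beta n j]. On that shell the
    quadratic growth of [psiH] forces either a failure of [event_global] or [event_local], or a
    large value of the empirical process of [H theta t - H thetas (psibar thetas)] indexed by
    [theta] and by [t] in an interval of radius of order [delta `^ beta] around
    [psibar thetas]; the drift caused by replacing [psibar theta] by the sample mean is small
    because translating the integral of [mTR] leaves only the Lipschitz difference of (viii).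
    The expected supremum of that process is bounded by symmetrization and chaining for
    Rademacher sums, with a product of covering nets for [G] and dyadic grids in [t], and
    Markov's inequality gives a geometric series over the shells. *)

(** The second argument of [H] in the objective is a mean over the whole sample, so the summands are
    not independent. On [event_global] that mean lies in a deterministic interval, and a supremum
    over all [t] in it restores a sum of independent terms. The relation between [a], [b] and [eps]
    keeps the radius of [event_global] below the one of [event_local] on every shell. The minimizer
    and [t] are random, so the bounds have to be uniform over uncountable families. Condition (vi)
    gives a dense sequence off a null set, and expectations are taken only of finite maxima. The
    exponent 1/(4 - 2 beta) balances the growth delta^2 against the fluctuation delta^beta / sqrt n.
    With the inflation sqrt(2)^j of [b], the shell of index j contributes a multiple of 2^(-j (3/2 -
    beta)), which is summable since beta <= 1. *)

(** * Rademacher sums: sub-Gaussian bounds and finite maxima *)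

Section Rademacher.
Variable R : realType.
Implicit Types (s : seq bool) (v : seq R).

(** Odd powers cancel, and the even ones compare through 2^k k! <= (2k)!. There are [uphalf n] even
    indices below [n]. *)
Lemma series_exp_coeffDN_le (x : R) n :
  series (exp_coeff x) n + series (exp_coeff (- x)) n
  <= 2 * series (exp_coeff (x ^+ 2 / 2)) (uphalf n).
Proof.
elim: n => [|n IHn]; first by rewrite !seriesEnat /= !big_geq//; lra.
have exprNn2 : (- x) ^+ n = (-1) ^+ odd n * x ^+ n by rewrite signr_odd -exprNn.
have -> : uphalf n.+1 = n./2.+1 by [].
rewrite !seriesSr {2 4 6}/exp_coeff /= exprNn2.
have [on|en] := boolP (odd n).
  have e : uphalf n = n./2.+1 by rewrite uphalf_half on.
  rewrite expr1 mulN1r mulNr; move: IHn; rewrite e seriesSr /exp_coeff /=; lra.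
have e : uphalf n = n./2 by rewrite uphalf_half (negbTE en).
rewrite expr0 mul1r.
suff : x ^+ n / n`!%:R <= (x ^+ 2 / 2) ^+ n./2 / n./2`!%:R.
  by move: IHn; rewrite e /exp_coeff /=; lra.
have {1 2}-> : n = (n./2 * 2)%N by rewrite muln2 even_halfK.
rewrite expr_div_n -exprM [(2 * _)%N]mulnC -mulrA.
rewrite ler_wpM2l// ?exprM ?sqr_ge0//.
rewrite -invfM lef_pV2 ?posrE ?mulr_gt0 ?ltr0n ?fact_gt0 ?exprn_gt0//.
rewrite -natrX -natrM ler_nat; move: (n./2) => {}k.
elim: k => // k IHk; rewrite mulSn add2n !factS expnS.
by rewrite mulnACA [leqRHS]mulnA leq_mul// muln2 -doubleS -mul2n leq_pmulr.
Qed.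

(** This is cosh x <= exp(x^2 / 2), the sub-Gaussian bound for a single sign. *)
Lemma expRDN_le (x : R) : expR x + expR (- x) <= 2 * expR (x ^+ 2 / 2).
Proof.
have cvgN (y : R) := is_cvg_series_exp_coeff y.
rewrite /expR -limD//; apply: limr_le; first exact: is_cvgD.
near=> n; rewrite (le_trans (series_exp_coeffDN_le x n))// ler_pM2l//.
apply: nondecreasing_cvgn_le => //; apply: nondecreasing_series => k _ _.
by rewrite exp_coeff_ge0// divr_ge0// sqr_ge0.
Unshelve. all: by end_near. Qed.

(* Expectation over [n] independent uniform signs. *)
Fixpoint rad (n : nat) (phi : seq bool -> R) : R :=
  if n is n'.+1 then
    (rad n' (fun s => phi (true :: s)) + rad n' (fun s => phi (false :: s))) / 2
  else phi [::].

Fixpoint sgsum (s : seq bool) (v : seq R) : R :=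
  match s, v with
  | b :: s', x :: v' => (-1) ^+ b * x + sgsum s' v'
  | _, _ => 0
  end.

Lemma rad_le n phi psi : (forall s, size s = n -> phi s <= psi s) ->
  rad n phi <= rad n psi.
Proof.
elim: n phi psi => [|n IHn] phi psi le /=; first exact: le.
by rewrite ler_pM2r// lerD// IHn// => s sn; apply: le; rewrite /= sn.
Qed.

Lemma eq_rad n phi psi : (forall s, size s = n -> phi s = psi s) ->
  rad n phi = rad n psi.
Proof.
by move=> e; apply/eqP; rewrite eq_le !rad_le// => s sn; rewrite e.
Qed.

Lemma rad_cst n c : rad n (fun=> c) = c.
Proof. by elim: n => //= n ->; lra. Qed.

Lemma rad_ge0 n phi : (forall s, 0 <= phi s) -> 0 <= rad n phi.
Proof. by move=> ?; rewrite -[leLHS](rad_cst n); exact: rad_le. Qed.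

Lemma radD n phi psi :
  rad n (fun s => phi s + psi s) = rad n phi + rad n psi.
Proof. by elim: n phi psi => //= n IHn phi psi; rewrite !IHn; lra. Qed.

Lemma radZ n c phi : rad n (fun s => c * phi s) = c * rad n phi.
Proof. by elim: n phi => //= n IHn phi; rewrite !IHn; lra. Qed.

Lemma rad_sum n (I : Type) (r : seq I) (phi : I -> seq bool -> R) :
  rad n (fun s => \sum_(i <- r) phi i s) = \sum_(i <- r) rad n (phi i).
Proof.
elim: r => [|i r IHr].
  by rewrite big_nil -[RHS](rad_cst n); apply: eq_rad => s _; rewrite big_nil.
rewrite big_cons -IHr -radD; apply: eq_rad => s _.
by rewrite big_cons.
Qed.

(** The signs are peeled off one at a time: by independence each contributes a factor cosh(l x),
    bounded by [expRDN_le]. *)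
Lemma rad_expR_le (l : R) v :
  rad (size v) (fun s => expR (l * sgsum s v))
  <= expR (l ^+ 2 / 2 * \sum_(x <- v) x ^+ 2).
Proof.
elim: v => [|x v IHv] /=; first by rewrite big_nil !mulr0.
have e (b : bool) : rad (size v) (fun s => expR (l * ((-1) ^+ b * x + sgsum s v)))
    = expR ((-1) ^+ b * (l * x)) * rad (size v) (fun s => expR (l * sgsum s v)).
  by rewrite -radZ; apply: eq_rad => s _; rewrite mulrDr mulrCA expRD.
rewrite (e true) (e false) big_cons mulrDr expRD -mulrDl mulrAC ler_pM//.
  by rewrite rad_ge0// => s; rewrite expR_ge0.
rewrite ler_pdivrMr// [leRHS]mulrC expr1 expr0 mulN1r mul1r addrC.
by rewrite (_ : l ^+ 2 / 2 * x ^+ 2 = (l * x) ^+ 2 / 2) ?expRDN_le//; field.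
Qed.

Lemma sgsumN s v : sgsum s (map -%R v) = - sgsum s v.
Proof.
elim: s v => [|b s IHs] [|x v] //=; rewrite ?oppr0// IHs.
by rewrite mulrN opprD.
Qed.

(** As [r] is nonempty and [F] nonnegative, the maximum is one of the values [F i]; hence [g] need
    not be monotone. *)
Lemma le_bigmax_sum (I : eqType) (r : seq I) (F : I -> R) (g : R -> R) :
  r != [::] -> (forall i, 0 <= F i) -> (forall x, 0 <= g x) ->
  g (\big[Num.max/0]_(i <- r) F i) <= \sum_(i <- r) g (F i).
Proof.
move=> r0 F0 g0; have [i ir ->] : exists2 i, i \in r &
    \big[Num.max/0]_(i <- r) F i = F i.
  elim: r r0 => // j r IHr _; rewrite big_cons.
  have [->|r0] := eqVneq r [::].
    by exists j; rewrite ?mem_seq1// big_nil; apply/max_idPl.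
  have [i ir ->] := IHr r0; have [ji|ij] := leP (F j) (F i).
    by exists i => //; rewrite in_cons ir orbT.
  by exists j => //; rewrite mem_head.
rewrite (big_rem i)//= lerDl.
by elim/big_rec: _ => // j x _ x0; rewrite addr_ge0.
Qed.

(** Massart's bound for a finite class. The tangent inequality exp(y) >= 1 + y stands in for
    Jensen's inequality with a logarithm. Absolute values require both [V i] and its opposite, hence
    the 2 before [size r]. *)
Lemma rad_bigmax_le (I : eqType) (r : seq I) n (V : I -> seq R) (S l : R) :
  r != [::] -> (forall i, i \in r -> size (V i) = n) -> 0 < S -> 0 < l ->
  (forall i, i \in r -> \sum_(x <- V i) x ^+ 2 <= S ^+ 2) ->
  2 * (size r)%:R <= expR (l ^+ 2) ->
  rad n (fun s => \big[Num.max/0]_(i <- r) `|sgsum s (V i)|)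
  <= Num.sqrt 2 * S * l.
Proof.
move=> r0 szV S0 l0 VS rl.
have s2 : 0 < Num.sqrt 2 :> R by rewrite sqrtr_gt0.
(* With this [la] the variance exponent [la ^+ 2 / 2 * S ^+ 2] equals [l ^+ 2]. The size of the
   class costs another [l ^+ 2], so the tangent is taken at [L = 2 * l ^+ 2], where the two
   exponentials cancel. *)
pose la : R := Num.sqrt 2 * l / S; pose L := 2 * l ^+ 2.
have la0 : 0 < la by rewrite !mulr_gt0// invr_gt0.
have laS : la * (Num.sqrt 2 * S * l) = L.
  have -> : la * (Num.sqrt 2 * S * l) = Num.sqrt 2 ^+ 2 * l ^+ 2.
    by rewrite /la; field; rewrite gt_eqF.
  by rewrite sqr_sqrtr.
have la2 : la ^+ 2 / 2 * S ^+ 2 = l ^+ 2.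
  rewrite /la !exprMn sqr_sqrtr// exprVn; field; by rewrite gt_eqF.
rewrite -(ler_pM2l la0) laS -radZ.
have pw s : la * (\big[Num.max/0]_(i <- r) `|sgsum s (V i)|)
    <= L - 1 + expR (- L) * (\sum_(i <- r) (expR (la * sgsum s (V i))
                       + expR (la * sgsum s (map -%R (V i))))).
  set m := \big[_/_]_(_ <- _) _.
  have h := expR_ge1Dx (la * m - L).
  rewrite (_ : la * m = L - 1 + (1 + (la * m - L))); last by ring.
  rewrite lerD2l (le_trans h)// addrC expRD ler_wpM2l ?expR_ge0//.
  apply: (le_trans (@le_bigmax_sum _ r (fun i => `|sgsum s (V i)|)
    (fun x => expR (la * x)) r0 _ _)) => //.
  apply: ler_sum => i _; rewrite sgsumN.
  by case: ger0P => _; rewrite ?lerDl ?lerDr expR_ge0.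
apply: (le_trans (rad_le (fun s _ => pw s))).
rewrite radD rad_cst radZ rad_sum.
rewrite -[leRHS](subrK 1) lerD2l.
have le2 i : i \in r -> rad n (fun s => expR (la * sgsum s (V i))
    + expR (la * sgsum s [seq - x | x <- V i])) <= 2 * expR (l ^+ 2).
  move=> ir; rewrite radD -[n](szV _ ir).
  rewrite (_ : 2 * _ = expR (l ^+ 2) + expR (l ^+ 2)); last by ring.
  have le1 v : \sum_(x <- v) x ^+ 2 <= S ^+ 2 ->
     rad (size v) (fun s => expR (la * sgsum s v)) <= expR (l ^+ 2).
    move=> vS; apply: (le_trans (rad_expR_le _ _)).
    by rewrite ler_expR -la2 ler_wpM2l// divr_ge0// sqr_ge0.
  rewrite lerD//; first exact/le1/VS.
  rewrite -(size_map -%R) le1// big_map.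
  by under eq_bigr do rewrite sqrrN; exact: VS.
set B := \sum_(i <- r) _; have le_B : B <= (size r)%:R * (2 * expR (l ^+ 2)).
  rewrite mulr_natl -iter_addr_0 -count_predT -big_const_seq /B.
  by rewrite !big_seq ler_sum.
rewrite (le_trans (ler_wpM2l (expR_ge0 _) le_B))//.
rewrite (_ : expR (- L) * _ = expR (- L) * expR (l ^+ 2) * (2 * (size r)%:R)); last by ring.
rewrite (le_trans (ler_wpM2l _ rl))// ?mulr_ge0 ?expR_ge0//.
by rewrite -!expRD /L (_ : _ + _ = 0) ?expR0//; ring.
Qed.

Lemma sgsumB T s (f g : T -> R) (z : seq T) :
  sgsum s [seq f x - g x | x <- z] = sgsum s (map f z) - sgsum s (map g z).
Proof. by elim: s z => [|b s IHs] [|x z] //=; rewrite ?subr0// IHs; ring. Qed.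

Lemma normr_sgsum_le s v (M : R) : 0 <= M ->
  \sum_(x <- v) x ^+ 2 <= M ^+ 2 -> `|sgsum s v| <= (size v)%:R * M.
Proof.
move=> M0; elim: s v => [|b s IHs] [|x v] vM /=; rewrite ?normr0 ?mulr_ge0//.
move: vM; rewrite big_cons => vM.
rewrite -natr1 mulrDl mul1r addrC (le_trans (ler_normD _ _))// lerD ?IHs//.
  by rewrite (le_trans _ vM)// lerDr sqr_ge0.
rewrite normrM normr_sign mul1r -ler_sqr ?nnegrE// real_normK ?num_real//.
by rewrite (le_trans _ vM)// lerDl sumr_ge0// => i _; rewrite sqr_ge0.
Qed.

Lemma bigmax_leD (I J : eqType) (r : seq I) (q : seq J) (p : I -> J)
    (F : I -> R) (G : J -> R) (H : I -> R) :
  (forall i, i \in r -> p i \in q) ->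
  (forall i, i \in r -> F i <= G (p i) + H i) -> (forall i, 0 <= H i) ->
  \big[Num.max/0]_(i <- r) F i
  <= \big[Num.max/0]_(j <- q) G j + \big[Num.max/0]_(i <- r) H i.
Proof.
move=> pq FGH H0; rewrite big_seq; apply: bigmax_le => [|i ir].
  by rewrite addr_ge0// bigmax_ge_id.
rewrite (le_trans (FGH _ ir))// lerD//; first by apply: le_bigmax_seq => //; exact: pq.
exact: le_bigmax_seq ir _.
Qed.

(** * Chaining along finite nets *)

Section chaining.
Context (T : Type) (I : eqType) (A : I -> Prop) (f : I -> T -> R) (z : seq T).
Variables (D : R) (net : nat -> seq I) (l : nat -> R) (j0 : nat).
Let S (r : seq I) := rad (size z)
  (fun s => \big[Num.max/0]_(i <- r) `|sgsum s (map (f i) z)|).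

Hypothesis D_gt0 : 0 < D.
Hypothesis f_le : forall i, A i -> \sum_(x <- z) f i x ^+ 2 <= D ^+ 2.
Hypothesis netA : forall j i, (j0 <= j)%N -> i \in net j -> A i.
Hypothesis net_neq0 : forall j, (j0 <= j)%N -> net j != [::].
Hypothesis l_gt0 : forall j, (j0 <= j)%N -> 0 < l j.
Hypothesis net_size : forall j, (j0 <= j)%N ->
  2 * (size (net j))%:R <= expR (l j ^+ 2).
Hypothesis net_cover : forall j i, (j0 <= j)%N -> A i ->
  exists2 i', i' \in net j & \sum_(x <- z) (f i x - f i' x) ^+ 2 <= (2 ^- j * D) ^+ 2.

Let pr_ j i : exists i', (j0 <= j)%N -> A i -> i' \in net j /\
  \sum_(x <- z) (f i x - f i' x) ^+ 2 <= (2 ^- j * D) ^+ 2.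
Proof.
have [jj|jj] := boolP (j0 <= j)%N; last by exists i.
have [Ai|Ai] := pselect (A i); last by exists i.
by have [i' ? ?] := net_cover jj Ai; exists i'.
Qed.
Let pr j i := projT1 (cid (pr_ j i)).
Let prP j i : (j0 <= j)%N -> A i -> pr j i \in net j /\
  \sum_(x <- z) (f i x - f (pr j i) x) ^+ 2 <= (2 ^- j * D) ^+ 2.
Proof. exact: (projT2 (cid (pr_ j i))). Qed.

Let S_le r j : (j0 <= j)%N -> (forall i, i \in r -> A i) ->
  S r <= S (net j) + rad (size z) (fun s =>
    \big[Num.max/0]_(i <- r) `|sgsum s [seq f i x - f (pr j i) x | x <- z]|).
Proof.
move=> jj rA; rewrite /S -radD; apply: rad_le => s _.
apply: (@bigmax_leD _ _ _ _ (pr j)) => //.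
  by move=> i /rA /(prP jj)[].
by move=> i _; rewrite sgsumB addrC -lerBlDr lerB_dist.
Qed.

(** Each point of the finer net has one projection on the coarser net, so there are no more links
    than points in the finer net. This is why the length at level [j0 + i] is multiplied by [l] at
    the next level. *)
Lemma rad_net_le k : S (net (j0 + k)) <=
  Num.sqrt 2 * D * (l j0 + \sum_(i < k) 2 ^- (j0 + i) * l (j0 + i).+1).
Proof.
elim: k => [|k IHk].
  rewrite addn0 big_ord0 addr0; apply: rad_bigmax_le => //.
  - exact: net_neq0.
  - by move=> i _; rewrite size_map.
  - exact: l_gt0.
  - by move=> i /(netA (leqnn _)) Ai; rewrite big_map f_le.
  - exact: net_size.
have j0k : (j0 <= j0 + k)%N by rewrite leq_addr.
have j0k1 : (j0 <= (j0 + k).+1)%N by rewrite ltnW.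
rewrite addnS big_ord_recr/= addrA mulrDr.
rewrite (le_trans (S_le j0k _))//; first by move=> i; exact: netA.
rewrite lerD// mulrA -[X in X * l _]mulrA [D * _]mulrC.
apply: rad_bigmax_le => //.
- exact: net_neq0.
- by move=> i _; rewrite size_map.
- by rewrite mulr_gt0// invr_gt0 exprn_gt0.
- exact: l_gt0.
- by move=> i /(netA j0k1) Ai; rewrite big_map; have [_] := prP j0k Ai.
- exact: net_size.
Qed.

(** The size of [r] is not controlled, so the last link, from [r] to a net, is bounded for every
    choice of signs. The price is a remainder that vanishes as [k] grows. *)
Lemma rad_chaining_le k r : (forall i, i \in r -> A i) -> S r <=
  Num.sqrt 2 * D * (l j0 + \sum_(i < k) 2 ^- (j0 + i) * l (j0 + i).+1)
  + (size z)%:R * (2 ^- (j0 + k) * D).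
Proof.
move=> rA; have j0k : (j0 <= j0 + k)%N by rewrite leq_addr.
rewrite (le_trans (S_le j0k rA))// lerD ?rad_net_le//.
rewrite -[leRHS](rad_cst (size z)); apply: rad_le => s _.
have D2 : 0 <= 2 ^- (j0 + k) * D.
  by rewrite mulr_ge0 ?invr_ge0 ?exprn_ge0// ltW.
rewrite big_seq; apply: bigmax_le => [|i /rA Ai]; first by rewrite mulr_ge0.
set v := map _ z; have -> : size z = size v by rewrite size_map.
by apply: normr_sgsum_le => //; rewrite big_map; have [_] := prP j0k Ai.
Qed.

End chaining.
End Rademacher.

(** * Symmetrization for finite maxima *)

Section symmetrization.
Context d (T : measurableType d) (R : realType) (mu : probability T R).
Context (I : eqType) (r : seq I) (f : I -> T -> R) (e : I -> R).
Hypothesis f_int : forall i, mu.-integrable setT (EFin \o f i).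
Hypothesis f_mean : forall i, (\int[mu]_x (f i x)%:E)%E = (e i)%:E.

Let mf i : measurable_fun setT (f i).
Proof. exact/measurable_EFinP/measurable_int/f_int. Qed.

Lemma measurable_bigmax d' (U : measurableType d') (F : I -> U -> R) :
  (forall i, measurable_fun setT (F i)) ->
  measurable_fun setT (fun u => \big[Num.max/0]_(i <- r) F i u).
Proof.
move=> mF; elim: r => [|i q IHq].
  by under eq_fun do rewrite big_nil; exact: measurable_cst.
by under eq_fun do rewrite big_cons; exact: measurable_maxr.
Qed.

Lemma measurable_rad d' (U : measurableType d') n (F : seq bool -> U -> R) :
  (forall s, measurable_fun setT (F s)) ->
  measurable_fun setT (fun u => rad n (F^~ u)).
Proof.
elim: n F => [|n IHn] F mF /=; first exact: mF.
apply: measurable_funM => //; apply: measurable_funD;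
  by apply: (IHn (fun s => F (_ :: s))) => s; exact: mF.
Qed.

Lemma measurable_sgsum d' (U : measurableType d') n s (g : U -> n.-tuple T)
    (h : T -> R) : measurable_fun setT g -> measurable_fun setT h ->
  measurable_fun setT (fun u => sgsum s (map h (g u))).
Proof.
move=> mg mh.
have gE u : map h (g u) = [seq h (tnth (g u) j) | j <- enum 'I_n].
  by rewrite -[in LHS](map_tnth_enum (g u)) -map_comp.
under eq_fun do rewrite gE.
elim: (enum 'I_n) s => [|j js IHj] [|b s] /=; do ?exact: measurable_cst.
apply: measurable_funD; last exact: IHj.
apply: measurable_funM; first exact: measurable_cst.
apply: measurableT_comp => //.
exact: (measurableT_comp (measurable_tnth j) mg).
Qed.

Local Notation mx c := (\big[Num.max/0]_(i <- r) `|c i|).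

Let mx_ge0 (c : I -> R) : 0 <= mx c.
Proof. exact: bigmax_ge_id. Qed.

(* Convexity splits [c + f - e] into halves [c + 2 f] and [c - 2 e], and Jensen moves the mean
   [e] outside; no independent copy of the sample is needed. *)
Lemma symmetrize1 (c : I -> R) :
  (\int[mu]_x (mx (fun i => c i + (f i x - e i))%R)%:E <=
   \int[mu]_x ((mx (fun i => c i + 2 * f i x) +
                mx (fun i => c i - 2 * f i x)) / 2)%R%:E)%E.
Proof.
have mM (g : I -> T -> R) : (forall i, measurable_fun setT (g i)) ->
    measurable_fun setT (fun x => mx (fun i => g i x)).
  by move=> mg; apply: measurable_bigmax => i; exact: measurableT_comp.
have m1 : measurable_fun setT (fun x => mx (fun i => c i + 2 * f i x)).
  by apply: mM => i; apply: measurable_funD => //; apply: measurable_funM.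
have m2 : measurable_fun setT (fun x => mx (fun i => c i - 2 * f i x)).
  by apply: mM => i; apply: measurable_funB => //; apply: measurable_funM.
have jensen : ((mx (fun i => c i - 2 * e i))%:E <=
    \int[mu]_x (mx (fun i => c i - 2 * f i x))%R%:E)%E.
  rewrite big_seq; elim/big_ind: _ => [|x y|i ir].
  - by apply: integral_ge0 => x _; rewrite lee_fin mx_ge0.
  - by rewrite /Num.max; case: ifP.
  - rewrite -[leLHS]/(abse (c i - 2 * e i)%:E).
    have -> : (c i - 2 * e i)%:E = (\int[mu]_x (c i - 2 * f i x)%:E)%E.
      under eq_integral do rewrite EFinB EFinM.
      rewrite integralB//; first last.
      + exact: (integrableZl measurableT 2 (f_int i)).
      + exact: finite_measure_integrable_cst.
      rewrite integralZl ?f_mean; [|exact: measurableT|exact: f_int].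
      by rewrite (integral_cst mu measurableT (c i)%:E) [X in (_ * X)%E]probability_setT mule1.
    apply: (le_trans (le_abse_integral _ _ _)) => //.
      by apply/measurable_EFinP; apply: measurable_funB => //; exact: measurable_funM.
    apply: ge0_le_integral => //.
    + apply: measurableT_comp => //; apply/measurable_EFinP.
      by apply: measurable_funB => //; exact: measurable_funM.
    + exact/measurable_EFinP.
    + by move=> x _; rewrite lee_fin; exact: le_bigmax_seq ir _.
apply: (@le_trans _ _ (\int[mu]_x ((mx (fun i => c i + 2 * f i x) / 2)%:E +
   ((mx (fun i => c i - 2 * e i)) / 2)%:E))%E).
  apply: ge0_le_integral => //.
  - by move=> x _; rewrite lee_fin.
  - by apply/measurable_EFinP/mM => i; apply: measurable_funD => //; exact: measurable_funB.
  - by apply/measurable_EFinP; apply: measurable_funD => //; exact: measurable_funM.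
  move=> x _; rewrite -EFinD lee_fin big_seq; apply: bigmax_le => [|i ir].
    by rewrite addr_ge0// divr_ge0.
  rewrite (_ : c i + _ = ((c i + 2 * f i x) + (c i - 2 * e i)) / 2); last by field.
  rewrite normf_div normr_nat -mulrDl ler_wpM2r// (le_trans (ler_normD _ _))//.
  by rewrite lerD//; exact: le_bigmax_seq ir _.
rewrite ge0_integralD//; first last.
- by move=> x _; rewrite lee_fin divr_ge0.
- by apply/measurable_EFinP; exact: measurable_funM.
- by move=> x _; rewrite lee_fin divr_ge0.
under [leRHS]eq_integral do rewrite mulrDl EFinD.
rewrite ge0_integralD//; first last.
- by apply/measurable_EFinP; exact: measurable_funM.
- by move=> x _; rewrite lee_fin divr_ge0.
- by apply/measurable_EFinP; exact: measurable_funM.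
- by move=> x _; rewrite lee_fin divr_ge0.
rewrite leeD2l// integral_cst// [X in (_ * X)%E]probability_setT mule1.
under eq_integral do rewrite mulrC EFinM.
rewrite ge0_integralZl//; last 2 first.
- exact/measurable_EFinP.
- by move=> x _; rewrite lee_fin.
by rewrite mulrC EFinM lee_pmul2l.
Qed.

Let phi n (c : I -> R) (z : n.-tuple T) : \bar R :=
  (mx (fun i => c i + \sum_(x <- z) (f i x - e i)))%:E.
Let psi n (c : I -> R) (z : n.-tuple T) : \bar R :=
  (rad n (fun s => mx (fun i => c i + 2 * sgsum s (map (f i) z))))%:E.

Let mphi d' (U : measurableType d') n (c : I -> U -> R) (g : U -> n.-tuple T) :
  measurable_fun setT g -> (forall i, measurable_fun setT (c i)) ->
  measurable_fun setT (fun u => phi (c^~ u) (g u)).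
Proof.
move=> mg mc; apply/measurable_EFinP; apply: measurable_bigmax => i.
apply: measurableT_comp => //; apply: measurable_funD => //.
under eq_fun do rewrite big_tuple.
apply: measurable_sum => j; apply: measurable_funB => //.
by apply: measurableT_comp => //; exact: (measurableT_comp (measurable_tnth j) mg).
Qed.

Let mpsi d' (U : measurableType d') n (c : I -> U -> R) (g : U -> n.-tuple T) :
  measurable_fun setT g -> (forall i, measurable_fun setT (c i)) ->
  measurable_fun setT (fun u => psi (c^~ u) (g u)).
Proof.
move=> mg mc; apply/measurable_EFinP.
apply: (@measurable_rad _ U n (fun s u => mx (fun i => c i u + 2 * sgsum s (map (f i) (g u))))) => s.
apply: measurable_bigmax => i; apply: measurableT_comp => //.
apply: measurable_funD => //; apply: measurable_funM => //.
exact: measurable_sgsum.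
Qed.

(** The free offset [c] carries the induction: it stores the coordinates that are frozen while the
    others are integrated. *)
Let phi_le_psi n (c : I -> R) :
  (\int[prod_power mu n]_z phi c z <= \int[prod_power mu n]_z psi c z)%E.
Proof.
elim: n c => [|n IHn] c.
  rewrite (eq_integral (psi c))// => z _; rewrite (tuple0 z) /phi /psi/=.
  by under eq_bigr do rewrite big_nil; under [in RHS]eq_bigr do rewrite mulr0.
have phi0 k c' (z : k.-tuple T) : (0 <= phi c' z)%E by rewrite lee_fin.
have psi0 k c' (z : k.-tuple T) : (0 <= psi c' z)%E.
  by rewrite lee_fin rad_ge0.
rewrite /= !ge0_integral_distribution//; last 2 first.
- by apply: mpsi => //; exact: measurable_cst.
- by apply: mphi => //; exact: measurable_cst.
have mphi' : measurable_fun setT (@phi n.+1 c \o @cons_pair _ T n).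
  by apply: measurableT_comp; [apply: mphi|exact: measurable_cons_pair].
have mpsi' : measurable_fun setT (@psi n.+1 c \o @cons_pair _ T n).
  by apply: measurableT_comp; [apply: mpsi|exact: measurable_cons_pair].
pose c1 b (x : T) i := c i + (-1) ^+ b * (2 * f i x).
(* The intermediate process: the first coordinate already has a sign, the other [n] are still
   centered. Integrating the first coordinate innermost, [symmetrize1] bounds [phi] by [K]; after
   exchanging the integrals the induction hypothesis applies with that coordinate fixed. *)
pose K (u : T * n.-tuple T) :=
  (2^-1%:E * (phi (c1 true u.1) u.2 + phi (c1 false u.1) u.2))%E.
have K0 u : (0 <= K u)%E by rewrite mule_ge0 ?adde_ge0 ?lee_fin.
have mc1 b i : measurable_fun setT (fun x => c1 b x i).
  by apply: measurable_funD => //; do 2 apply: measurable_funM => //.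
have mK : measurable_fun setT K.
  have mc b : measurable_fun setT (fun u : T * n.-tuple T => phi (c1 b u.1) u.2).
    apply: (@mphi _ _ n (fun i u => c1 b u.1 i) snd) => [|i].
      exact: measurable_snd.
    exact: measurableT_comp (mc1 b i) measurable_fst.
  by apply: measurable_funeM => //; exact: emeasurable_funD.
have psi_cons x z : (psi c (cons_pair (x, z)) =
    2^-1%:E * (psi (c1 true x) z + psi (c1 false x) z))%E.
  rewrite /psi/= -EFinD -EFinM mulrC; congr (_ * (_ + _))%:E;
  apply: eq_rad => s _; apply: eq_bigr => i _; rewrite /c1; congr `|_|; ring.
have := @fubini_tonelli2 _ _ _ _ _ mu (prod_power mu n) _ mphi'.
have := @fubini_tonelli1 _ _ _ _ _ mu (prod_power mu n) _ mpsi'.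
move=> /(_ (fun=> psi0 _ _ _)) e1 /(_ (fun=> phi0 _ _ _)) e2.
rewrite [leRHS](_ : _ = \int[mu]_x fubini_F (prod_power mu n) (psi c \o cons_pair (n:=n)) x)%E; last exact: e1.
rewrite [leLHS](_ : _ = \int[prod_power mu n]_x fubini_G mu (phi c \o cons_pair (n:=n)) x)%E; last exact: e2.
apply: (@le_trans _ _ (\int[prod_power mu n]_z \int[mu]_x K (x, z))%E).
  apply: ge0_le_integral => //.
  - by move=> z _; apply: integral_ge0 => x _; exact: phi0.
  - by apply: measurable_fun_fubini_tonelli_G => // u; exact: phi0.
  - exact: (@measurable_fun_fubini_tonelli_G _ _ _ _ _ mu K mK K0).
  move=> z _; pose c' i := c i + \sum_(x <- z) (f i x - e i).
  have := symmetrize1 c'; rewrite /fubini_G; congr (_ <= _)%E;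
    apply: eq_integral => x _.
    rewrite /phi/=; congr _%:E; apply: eq_bigr => i _.
    by rewrite big_cons /c'; congr `|_|; ring.
  rewrite /K /phi -EFinD -EFinM mulrC addrC; congr (_ * (_ + _))%:E;
  apply: eq_bigr => i _; rewrite /c1 /c'; congr `|_|; ring.
rewrite -(@fubini_tonelli _ _ _ _ _ _ _ _ mK K0); apply: ge0_le_integral => //.
- by move=> x _; exact: integral_ge0.
- exact: (@measurable_fun_fubini_tonelli_F _ _ _ _ _ (prod_power mu n) K mK K0).
- by apply: measurable_fun_fubini_tonelli_F => // u; exact: psi0.
move=> x _; rewrite /fubini_F; under [leRHS]eq_integral do rewrite /= psi_cons.
have m1 b : measurable_fun setT (phi (c1 b x) (n := n)).
  by apply: mphi => //; exact: measurable_cst.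
have m2 b : measurable_fun setT (psi (c1 b x) (n := n)).
  by apply: mpsi => //; exact: measurable_cst.
rewrite !ge0_integralZl//; first last.
- by move=> z _; rewrite adde_ge0.
- exact: emeasurable_funD.
- by move=> z _; rewrite adde_ge0.
- exact: emeasurable_funD.
rewrite lee_pmul2l ?lte_fin//=.
rewrite (ge0_integralD _ _ _ (m1 _) _ (m1 _))//.
by rewrite (ge0_integralD _ _ _ (m2 _) _ (m2 _))// leeD.
Qed.

Lemma symmetrization n :
  (\int[prod_power mu n]_z
     (\big[Num.max/0]_(i <- r) `|\sum_(x <- z) (f i x - e i)|)%:E <=
   \int[prod_power mu n]_z (2 *
     rad n (fun s => \big[Num.max/0]_(i <- r) `|sgsum s (map (f i) z)|))%:E)%E.
Proof.
have := phi_le_psi n (fun=> 0); congr (_ <= _)%E; apply: eq_integral => z _.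
  by rewrite /phi; under eq_bigr do rewrite add0r.
rewrite /psi -radZ; congr _%:E; apply: eq_rad => s _.
under eq_bigr do rewrite add0r normrM normr_nat.
apply/esym/(big_morph ( *%R 2)); last exact: mulr0.
by move=> x y; rewrite maxr_pMr.
Qed.

End symmetrization.

(** * Finitely supported measures adapted to a weight *)

Section weighted_empirical_measure.
Context d (T : measurableType d) (R : realType).

(* With weights [W ^+ 2], an [L^2(Q)]-net of a class [g] is a net of [W * g] for the
   empirical [l^2]-distance at [z]. *)
Lemma exists_weighted_empirical (z : seq T) (w : T -> R) :
  z != [::] -> (forall x, 0 < w x) ->
  exists2 Q : probability T R, finitely_supported Q &
  forall g : T -> R, measurable_fun setT g -> (forall x, 0 <= g x) ->
    (\int[Q]_x (g x)%:E)%E =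
    ((\sum_(x <- z) w x)^-1 * \sum_(x <- z) w x * g x)%:E.
Proof.
case: z => // x0 z' _; set z := x0 :: z' => w0.
pose wn i : {nonneg R} := NngNum (ltW (w0 (nth x0 z i))).
pose m i := mscale (wn i) (\d_(nth x0 z i) : {measure set T -> \bar R}).
pose mu := msum (m : {measure set T -> \bar R}^nat) (size z).
have muE A : mu A = (\sum_(x <- z) w x * \1_A x)%:E.
  rewrite /mu /msum (big_nth x0) big_mkord -sumEFin; apply: eq_bigr => i _.
  by rewrite /m /mscale /dirac/= EFinM.
have W0 : 0 < \sum_(x <- z) w x.
  by rewrite big_cons ltr_pwDl// sumr_ge0// => i _; exact: ltW.
have muT : mu setT = (\sum_(x <- z) w x)%:E.
  by rewrite muE; under eq_bigr do rewrite indicT mulr1.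
pose Q := mnormalize mu \d_x0.
have QE A : Q A = ((\sum_(x <- z) w x)^-1%:E * mu A)%E.
  rewrite /Q /mnormalize.
  have -> : [the {measure set T -> \bar R} of mu] setT = (\sum_(x <- z) w x)%:E by [].
  by rewrite eqe gt_eqF//= muleC.
exists Q.
  exists [set` z]; split; first exact: finite_seq.
  rewrite [LHS]QE muE -EFinM; congr _%:E; rewrite -[RHS](mulVf (lt0r_neq0 W0)).
  congr (_ * _); rewrite !big_seq; apply: eq_bigr => x xz.
  by rewrite indicE mem_set ?mulr1.
move=> g mg g0.
have k0 : 0 <= (\sum_(x <- z) w x)^-1 by rewrite invr_ge0 ltW.
have mg' : measurable_fun setT (EFin \o g) by exact/measurable_EFinP.
have g0' x : (0 <= (g x)%:E)%E by rewrite lee_fin.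
rewrite (eq_measure_integral (mscale (NngNum k0) mu)) => [|A mA _]; last exact: QE.
rewrite ge0_integral_mscale// EFinM; congr (_ * _)%E.
rewrite ge0_integral_measure_sum// (big_nth x0) big_mkord -sumEFin.
apply: eq_bigr => i _; rewrite ge0_integral_mscale// integral_dirac//.
by rewrite diracT mul1e -EFinM.
Qed.

End weighted_empirical_measure.

(** * L2 norms and integrals of squares *)

Section L2norm.
Context d (T : measurableType d) (R : realType) (mu : {measure set T -> \bar R}).

Lemma Lnorm2E (f : T -> R) :
  'N[mu]_2%:E[EFin \o f]%E = sqrte (\int[mu]_x (f x ^+ 2)%:E).
Proof.
rewrite unlock poweR12_sqrt; last by apply: integral_ge0 => x _; exact: poweR_ge0.
congr sqrte; apply: eq_integral => x _.
by rewrite /= powR_mulrn// real_normK// num_real.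
Qed.

Lemma Lnorm2_le (f : T -> R) (c : R) : 0 <= c ->
  ('N[mu]_2%:E[EFin \o f] <= c%:E)%E =
  (\int[mu]_x (f x ^+ 2)%:E <= (c ^+ 2)%:E)%E.
Proof.
move=> c0; rewrite Lnorm2E -[in RHS]lee_sqrt ?lee_fin ?sqr_ge0//=.
by rewrite sqrtr_sqr ger0_norm.
Qed.

Lemma finite_Lnorm2_sqr (f : T -> R) : 'N[mu]_2%:E[EFin \o f]%E \is a fin_num ->
  (\int[mu]_x (f x ^+ 2)%:E)%E = (fine 'N[mu]_2%:E[EFin \o f]%E ^+ 2)%:E.
Proof.
move=> ffin; rewrite EFin_expe fineK// Lnorm2E sqr_sqrte//.
by apply: integral_ge0 => x _; rewrite lee_fin sqr_ge0.
Qed.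

End L2norm.

(** * From the entropy integral to dyadic covering numbers *)

Section entropy_levels.
Context d (T : measurableType d) (R : realType).
Implicit Types (F : set (T -> R)) (C : T -> R).
Local Open Scope ereal_scope.

(** The integral of a nonnegative function is a supremum over simple functions below it, so
    monotonicity needs no measurability. It is applied to the entropy integrand, a supremum over an
    uncountable set of measures. *)
Lemma le_integral_ge0 d' (U : measurableType d') (mu : {measure set U -> \bar R})
    (D : set U) (f g : U -> \bar R) :
  (forall x, D x -> 0 <= f x) -> (forall x, D x -> f x <= g x) ->
  \int[mu]_(x in D) f x <= \int[mu]_(x in D) g x.
Proof.
move=> f0 fg; have g0 x : D x -> 0 <= g x.
  by move=> Dx; rewrite (le_trans (f0 _ Dx))// fg.
rewrite !ge0_integralE//; apply: ereal_sup_le => _ [h hf <-].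
exists h => // x; rewrite (le_trans (hf x))// !patchE; case: ifPn => // /set_mem.
exact: fg.
Qed.

Definition entropy_sup F C (e : R) : \bar R :=
  ereal_sup [set sqrte
    (lne (2%:E * covering_number Q (e%:E * 'N[Q]_2%:E [EFin \o C]) F))
    | Q in @finitely_supported _ T R].

Lemma covering_number_ge1 (Q : probability T R) eta F : F !=set0 ->
  1 <= covering_number Q eta F.
Proof.
move=> [f Ff]; apply: le_ereal_inf_tmp => _ [N /= [c [_ cov]] <-].
rewrite lee_fin ler1n; case: N c cov => // c cov.
by have [[]] := cov f Ff.
Qed.

Lemma covering_number_attained (Q : probability T R) eta F :
  covering_number Q eta F < +oo -> exists2 N : nat,
    N%:R%:E = covering_number Q eta F &
    exists c : 'I_N -> T -> R, (forall i, F (c i)) /\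
      forall f, F f -> exists i, 'N[Q]_2%:E [EFin \o (f \- c i)%R] <= eta.
Proof.
rewrite /covering_number; set S := [set N : nat | _] => ltoo.
have [N SN] : S !=set0.
  apply/set0P/negP => /eqP S0; move: ltoo.
  by rewrite S0 image_set0 ereal_inf0 ltxx.
pose p k := `[< S k >]; have exp : exists k, p k by exists N; exact/asboolP.
case: (ex_minnP exp) => k /asboolP Sk kmin; exists k => //.
apply/eqP; rewrite eq_le; apply/andP; split.
  apply: le_ereal_inf_tmp => _ [l Sl <-]; rewrite lee_fin ler_nat kmin//.
  exact/asboolP.
by apply: ereal_inf_lbound; exists k.
Qed.

(** A finite bound on the supremum over all measures excludes an infinite covering number for this
    [Q], so a minimal cover exists. Its cardinality is put in the form that [rad_bigmax_le]
    requires. *)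
Lemma covering_number_entropy (Q : probability T R) F C (e l : R) :
  F !=set0 -> finitely_supported Q -> (0 <= l)%R ->
  entropy_sup F C e <= l%:E -> exists N : nat,
    (2 * N%:R <= expR (l ^+ 2))%R /\
    exists c : 'I_N -> T -> R, (forall i, F (c i)) /\
      forall f, F f -> exists i,
        'N[Q]_2%:E [EFin \o (f \- c i)%R] <= e%:E * 'N[Q]_2%:E [EFin \o C].
Proof.
move=> F0 Qfin l0 le_l; set eta := e%:E * _.
have : sqrte (lne (2%:E * covering_number Q eta F)) <= l%:E.
  by rewrite (le_trans _ le_l)//; apply: ereal_sup_ubound; exists Q.
have := covering_number_ge1 Q eta F0.
have : covering_number Q eta F < +oo -> _ := @covering_number_attained Q eta F.
case: (covering_number Q eta F) => [v|_ _|//]; last first.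
  by rewrite gt0_muley ?lte_fin.
move=> /(_ (ltry _)) [N <- [c [Fc cov]]]; rewrite lee_fin => N1.
have N2 : (0 < 2 * N%:R :> R)%R by rewrite mulr_gt0// (lt_le_trans _ N1).
rewrite -EFinM lne_EFin// => le_sqrt; exists N; split; last by exists c.
rewrite -(@lnK _ (2 * N%:R)%R) ?posrE// ler_expR.
rewrite -(@sqr_sqrtr _ (ln _)); last by rewrite ln_ge0//; move: N1; lra.
by move: le_sqrt; rewrite /= lee_fin => ?; rewrite lerXn2r ?nnegrE ?sqrtr_ge0.
Qed.

Lemma entropy_sup_anti F C (e e' : R) : F !=set0 -> (e <= e')%R ->
  entropy_sup F C e' <= entropy_sup F C e.
Proof.
move=> F0 ee'; apply: ge_ereal_sup => _ [Q Qfin <-].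
apply: (@le_trans _ _ (sqrte (lne (2%:E * covering_number Q (e%:E * 'N[Q]_2%:E [EFin \o C]) F)))); last first.
  by apply: ereal_sup_ubound; exists Q.
have c1 eta := covering_number_ge1 Q eta F0.
have c2 eta : 1 <= 2%:E * covering_number Q eta F.
  by rewrite (le_trans (c1 eta))// lee_pemull ?lee_fin ?ler1n // (le_trans _ (c1 eta)).
have c0 eta : 0 <= 2%:E * covering_number Q eta F by rewrite (le_trans _ (c2 eta)).
rewrite lee_sqrt ?lne_ge0// lee_lne ?in_itv/= ?leey ?c0//.
rewrite lee_pmul2l//; apply: ereal_inf_le_tmp => _ [N [c [Fc cov]] <-].
exists N => //; exists c; split => // f Ff; have [i le_i] := cov f Ff.
exists i; apply: (le_trans le_i).
by apply: lee_wpmul2r; [exact: Lnorm_ge0|rewrite lee_fin].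
Qed.

Lemma entropy_sup_ge0 (x0 : T) F C e : 0 <= entropy_sup F C e.
Proof.
apply: le_trans (sqrte_ge0 _) (ereal_sup_ubound _).
exists (\d_x0 : probability T R) => //; exists [set x0].
by split; [exact: finite_set1|rewrite /= diracE mem_set].
Qed.

(** A lower Riemann sum: the integrand decreases in the radius, so on the interval from 2^-(4+i) to
    2^-(3+i), of length 2^-(4+i), its least value is at the right end. The minorant [c] replaces the
    values themselves because their finiteness is not yet known. *)
Lemma sum_le_entropy_integral (x0 : T) F C (M : R) (c : nat -> R) k : F !=set0 ->
  entropy_integral F C (1 / 8) <= M%:E -> (forall i, 0 <= c i)%R ->
  (forall i, (i < k)%N -> (c i)%:E <= entropy_sup F C (2 ^- (3 + i))) ->
  (\sum_(i < k) c i * 2 ^- (4 + i) <= M)%R.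
Proof.
move=> F0 intM c0 cg.
pose A i : set R := `]2 ^- (4 + i), 2 ^- (3 + i)]%classic.
have pow_le i j : (i <= j)%N -> (2 ^- j <= 2 ^- i :> R)%R.
  by move=> ij; rewrite lef_pV2 ?posrE ?exprn_gt0// ler_eXn2l// ltr1n.
have mA i : measurable (A i) by exact: measurable_itv.
have AD i : A i `&` `]0%R, (1 / 8)%R] = A i.
  apply/setIidl => x; rewrite /A /= !in_itv/= => /andP[x1 x2].
  rewrite (lt_trans _ x1) ?invr_gt0 ?exprn_gt0//= (le_trans x2)//.
  by rewrite (le_trans (pow_le 3%N _ _)) ?leq_addr//; lra.
rewrite -lee_fin (le_trans _ intM)//.
have -> : (\sum_(i < k) c i * 2 ^- (4 + i))%:E =
    \int[lebesgue_measure]_(x in `]0%R, (1 / 8)%R])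
      \sum_(i < k) (c i)%:E * (\1_(A i) x)%:E.
  rewrite ge0_integral_sum//; last 2 first.
  - move=> i; apply: measurable_funeM; apply/measurable_EFinP.
    exact: measurable_indic (mA _).
  - by move=> i x _; rewrite mule_ge0 ?lee_fin.
  rewrite -sumEFin; apply: eq_bigr => i _.
  rewrite ge0_integralZl//; last 2 first.
  - by apply/measurable_EFinP; exact: measurable_indic (mA _).
  - by rewrite lee_fin.
  rewrite integral_indic//; last exact: mA.
  rewrite [X in (_ * X)%E](_ : _ = lebesgue_measure (A i)); last first.
    exact: congr1 (AD i).
  rewrite lebesgue_measure_itv/= lte_fin.
  rewrite ltf_pV2 ?posrE ?exprn_gt0// ltr_eXn2l ?ltr1n// leqnn -EFinD -EFinM.
  by congr (_ * _)%:E; rewrite addSn exprS invfM; lra.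
apply: le_integral_ge0 => x.
  by move=> _; apply: sume_ge0 => i _; rewrite mule_ge0 ?lee_fin.
rewrite /= in_itv/= => _.
have g0 := entropy_sup_ge0 x0 F C x.
have [[i Ai]|nA] := pselect (exists i : 'I_k, A i x); last first.
  rewrite big1 // => i _; rewrite indicE memNset ?mule0// => Ai; apply: nA.
  by exists i.
rewrite (bigD1 i)//= big1 ?adde0.
  rewrite indicE mem_set// mule1 (le_trans (cg i _))// entropy_sup_anti//.
  by move: Ai; rewrite /A /= in_itv/= => /andP[].
move=> j /eqP ji; rewrite indicE memNset ?mule0// => Aj; apply: ji.
move: Ai Aj; rewrite /A /= !in_itv/= => /andP[i1 i2] /andP[j1 j2].
apply/val_inj/eqP; rewrite eqn_leq; apply/andP; split; rewrite leqNgt; apply/negP => ij.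
  by have := lt_le_trans i1 (le_trans j2 (pow_le (4 + i)%N (3 + j)%N ij)); rewrite ltxx.
by have := lt_le_trans j1 (le_trans i2 (pow_le (4 + j)%N (3 + i)%N ij)); rewrite ltxx.
Qed.

(** An infinite value at one level would admit minorants of any size there, against the bound [M] on
    the lower sums. All levels are thus finite and can serve as their own minorants. *)
Lemma entropy_levels (x0 : T) F C (M : R) : F !=set0 ->
  entropy_integral F C (1 / 8) <= M%:E -> exists l : nat -> R,
  [/\ forall i, (0 <= l i)%R,
      forall i, entropy_sup F C (2 ^- (3 + i)) <= (l i)%:E &
      forall k, (\sum_(i < k) l i * 2 ^- (4 + i) <= M)%R].
Proof.
move=> F0 intM; pose g i := entropy_sup F C (2 ^- (3 + i)).
have g0 i : 0 <= g i by exact: entropy_sup_ge0.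
have gfin i : g i \is a fin_num.
  rewrite ge0_fin_numE// ltNge; apply/negP => goo.
  (* Times the interval length 2^-(4+i), this [r] already exceeds [M]. *)
  pose r := (`|M| * 2 ^+ (4 + i) + 1)%R.
  pose c j : R := if j == i then r else 0%R.
  have r0 : (0 <= r)%R by rewrite addr_ge0// mulr_ge0// exprn_ge0.
  have := @sum_le_entropy_integral x0 F C M c i.+1 F0 intM.
  move=> /(_ _ _)/wrap[j|j _|].
  - by rewrite /c; case: ifP.
  - rewrite /c; case: eqP => [->|_]; last exact: entropy_sup_ge0.
    by rewrite (le_trans _ goo)// leey.
  rewrite (bigD1 ord_max)//= big1 ?addr0 => [|j /eqP ji]; last first.
    rewrite /c; case: eqP => [ji'|_]; last by rewrite mul0r.
    by exfalso; apply: ji; exact: val_inj.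
  rewrite /c eqxx ler_pdivrMr ?exprn_gt0// /r => h.
  have := ler_wpM2r (exprn_ge0 (4 + i) (ler0n R 2)) (ler_norm M).
  by lra.
exists (fun i => fine (g i)); split => [i|i|k].
- exact: fine_ge0.
- by rewrite fineK.
apply: (@sum_le_entropy_integral x0 F C M (fun i => fine (g i)) k F0 intM) => [i|i _].
  exact: fine_ge0.
by rewrite fineK.
Qed.

End entropy_levels.

(** * Chaining for a class indexed by a parameter and a real number *)

Section localized_class.
Context d (T : measurableType d) (R : realType).
Context (I0 : choiceType) (A0 : set I0) (g : I0 -> T -> R) (xi W L2 : T -> R).
Context (h : I0 * R -> T -> R) (th0 : I0) (t0 rho M : R) (z : seq T).
Hypothesis z_neq0 : z != [::].
Hypothesis A0th0 : A0 th0.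
Hypothesis g_meas : forall th, A0 th -> measurable_fun setT (g th).
Hypothesis xi_meas : measurable_fun setT xi.
Hypothesis xi_gt0 : forall x, 0 < xi x.
Hypothesis g_le : forall th x, A0 th -> `|g th x - g th0 x| <= xi x.
Hypothesis W_gt0 : forall x, 0 < W x.
Hypothesis rho_gt0 : 0 < rho.
Hypothesis h0 : forall x, h (th0, t0) x = 0.
Hypothesis h_lip : forall th th' t t' x, A0 th -> A0 th' ->
  (h (th, t) x - h (th', t') x) ^+ 2 <=
  (W x * (g th x - g th' x)) ^+ 2 + (L2 x * (t - t')) ^+ 2.
Hypothesis entropy_le :
  (entropy_integral [set g th | th in A0] xi (1 / 8) <= M%:E)%E.

Let A (i : I0 * R) := A0 i.1 /\ `|i.2 - t0| <= rho.
Let D2 := \sum_(x <- z) ((W x * xi x) ^+ 2 + (L2 x * rho) ^+ 2).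
Let D := Num.sqrt D2.

Let D2_gt0 : 0 < D2.
Proof.
case: z z_neq0 @D2 => // x z' _; rewrite /= big_cons ltr_pwDl//.
  by rewrite ltr_pwDl ?sqr_ge0// exprn_gt0// mulr_gt0.
by rewrite sumr_ge0// => y _; rewrite addr_ge0// sqr_ge0.
Qed.

Let D_gt0 : 0 < D. Proof. by rewrite sqrtr_gt0. Qed.

Let D_sqr : D ^+ 2 = D2. Proof. by rewrite sqr_sqrtr// ltW. Qed.

Let h_le i : A i -> \sum_(x <- z) h i x ^+ 2 <= D ^+ 2.
Proof.
case: i => th t [/= Ath tt0]; rewrite D_sqr; apply: ler_sum => x _.
rewrite -[h _ x]subr0 -(h0 x) (le_trans (h_lip _ _ _ Ath A0th0))//.
rewrite lerD// !exprMn ler_wpM2l ?sqr_ge0// -[leLHS]real_normK ?num_real//;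
  by rewrite lerXn2r ?nnegrE ?normr_ge0// ?g_le// ltW.
Qed.

(** The net is the product of a cover in the first index, for the measure weighted by [W ^+ 2], and
    a grid in [t]. The two squared errors in [h_lip] match the two summands of [D2]. The grid has at
    most exp(i + 5) points, and l^2 + i + 5 <= (l + (i + 6)/2)^2 turns this into an additive
    correction of [l i]. *)
Let net_exists (l : nat -> R) i : (0 <= l i) ->
  (entropy_sup [set g th | th in A0] xi (2 ^- (3 + i)) <= (l i)%:E)%E ->
  exists r : seq (I0 * R),
  [/\ forall a, a \in r -> A a,
      2 * (size r)%:R <= expR ((l i + (i + 6)%:R / 2) ^+ 2) &
      forall a, A a -> exists2 a', a' \in r &
        \sum_(x <- z) (h a x - h a' x) ^+ 2 <= (2 ^- (3 + i) * D) ^+ 2].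
Proof.
move=> l0 le_l; set e : R := 2 ^- (3 + i).
have e0 : 0 < e by rewrite invr_gt0 exprn_gt0.
have W2 x : 0 < W x ^+ 2 by rewrite exprn_gt0.
have [Q Qfin QE] := exists_weighted_empirical z_neq0 W2.
have F0 : [set g th | th in A0] !=set0 by exists (g th0), th0.
have [N [N_le [c [Fc cov]]]] := covering_number_entropy F0 Qfin l0 le_l.
have /choice[th thP] : forall k, exists th, A0 th /\ g th = c k.
  by move=> k; have [th] := Fc k; exists th.
(* The grid has step [rho * e], and [e * m = 2] lets [m] steps span the whole interval of length
   [2 * rho]; with both ends there are [m.+1] points. *)
pose m := (2 ^ (4 + i))%N.
have em : e * m%:R = 2.
  by rewrite /e /m natrX addSn exprS mulrCA mulVf ?mulr1// expf_neq0.
pose tk k := t0 - rho + rho * e * k%:R.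
exists [seq (th k, tk q) | k <- enum 'I_N, q <- iota 0 m.+1]; split.
- move=> a /allpairsP[[k q] [_ + ->]].
  rewrite mem_iota [(_, _).2]/= add0n ltnS => /= qm.
  split; first by have [] := thP k.
  rewrite /= /tk (_ : _ - t0 = rho * (e * q%:R - 1)); last by ring.
  rewrite normrM gtr0_norm// ler_piMr ?(ltW rho_gt0)//.
  have : e * q%:R <= e * m%:R by rewrite ler_pM2l// ler_nat.
  have : 0 <= e * q%:R by rewrite mulr_ge0 ?(ltW e0).
  by rewrite em ler_norml; lra.
- rewrite size_allpairs size_enum_ord size_iota natrM mulrA.
  have m_le : m.+1%:R <= expR (i + 5)%:R :> R.
    rewrite -[(i + 5)%:R]mulr1 expRM_natl.
    apply: (@le_trans _ _ (2 ^+ (i + 5))); last first.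
      by rewrite lerXn2r ?nnegrE ?expR_ge0//; have := expR_ge1Dx (1 : R); lra.
    rewrite -natrX ler_nat /m addnC [(i + 5)%N]addnS expnS mul2n -addnn -addn1.
    by rewrite leq_add2l expn_gt0.
  rewrite (le_trans (ler_pM _ _ N_le m_le)) ?mulr_ge0//.
  rewrite -expRD ler_expR !natrD.
  have := mulr_ge0 l0 (ler0n R i); have := sqr_ge0 (i%:R : R).
  by have := ler0n R i; nra.
- move=> [th' t'] [Ath' /ler_normlP[t1 t2]]; rewrite /= in Ath' t1 t2.
  have [k le_k] := cov (g th') (ex_intro2 _ _ th' Ath' erefl).
  have [Ak gk] := thP k.
  have re0 : 0 < rho * e by rewrite mulr_gt0.
  (* The index of the grid point just below [t']. *)
  pose q := Num.truncn ((t' - t0 + rho) / (rho * e)).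
  have u0 : 0 <= (t' - t0 + rho) / (rho * e).
    by rewrite divr_ge0 ?(ltW re0)//; lra.
  have [q1 q2] : q%:R * (rho * e) <= t' - t0 + rho
       /\ t' - t0 + rho <= (q%:R + 1) * (rho * e).
    have /andP[u1 /ltW u2] := truncn_itv u0.
    by split; [rewrite -ler_pdivlMr|rewrite natr1 -ler_pdivrMr].
  have qm : (q < m.+1)%N.
    rewrite ltnS -(ler_nat R) -(ler_pM2r re0) (le_trans q1)//.
    by rewrite mulrC -mulrA em; lra.
  exists (th k, tk q).
    by apply/allpairsP; exists (k, q); split; rewrite ?mem_enum// mem_iota.
  apply: (@le_trans _ _ (\sum_(x <- z) W x ^+ 2 * (g th' x - g (th k) x) ^+ 2
        + \sum_(x <- z) (L2 x * (t' - tk q)) ^+ 2)).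
    rewrite -big_split; apply: ler_sum => x _ /=.
    by rewrite -(exprMn _ (W x)) h_lip.
  rewrite exprMn D_sqr /D2 big_split/= mulrDr lerD//; last first.
    rewrite mulr_sumr; apply: ler_sum => x _.
    rewrite (_ : e ^+ 2 * _ = L2 x ^+ 2 * (rho * e) ^+ 2); last by ring.
    rewrite exprMn ler_wpM2l ?sqr_ge0//.
    rewrite -[leLHS]real_normK ?num_real// lerXn2r ?nnegrE ?normr_ge0 ?(ltW re0)//.
    by rewrite /tk ler_norml; apply/andP; split; nra.
  under [X in _ * X]eq_bigr do rewrite exprMn.
  move: le_k; rewrite !Lnorm2E gk.
  rewrite (QE (fun x => (g th' x - c k x) ^+ 2)); last 2 first.
  - apply: measurable_funX; apply: measurable_funB; first exact: g_meas.
    by rewrite -gk; exact: g_meas.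
  - by move=> x; exact: sqr_ge0.
  rewrite (QE (fun x => xi x ^+ 2)); last 2 first.
  - exact: measurable_funX.
  - by move=> x; exact: sqr_ge0.
  rewrite /= -EFinM lee_fin; set S := (\sum_(x <- z) W x ^+ 2)^-1.
  have S0 : 0 < S.
    rewrite invr_gt0; case: z z_neq0 => // x z' _; rewrite big_cons ltr_pwDl//.
    by rewrite sumr_ge0// => y _; exact: sqr_ge0.
  rewrite -[X in _ <= X * _ -> _](ger0_norm (ltW e0)) -sqrtr_sqr -sqrtrM ?sqr_ge0//.
  rewrite ler_sqrt; last first.
    rewrite mulr_ge0 ?sqr_ge0// mulr_ge0 ?(ltW S0)// sumr_ge0// => x _.
    by rewrite mulr_ge0// sqr_ge0.
  by rewrite mulrCA ler_pM2l.
Qed.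

Let half_expn n : 2 ^- n.+1 = 2 ^- n / 2 :> R.
Proof. by rewrite exprSr invfM. Qed.

(** The contribution of the grids to the chaining sum. The remainder 2^-(3+k) (k + 8) equals 1 at k
    = 0, and its successive differences are the summands. *)
Lemma sum_geometric_affine k :
  \sum_(i < k) 2 ^- (4 + i) * (i + 7)%:R <= 1 :> R.
Proof.
suff -> : \sum_(i < k) 2 ^- (4 + i) * (i + 7)%:R
    = 1 - 2 ^- (3 + k) * (k + 8)%:R :> R.
  by rewrite gerBl mulr_ge0// invr_ge0 exprn_ge0.
elim: k => [|k IHk]; first by rewrite big_ord0; lra.
rewrite big_ord_recr IHk [LHS]/= (_ : 2 ^- (3 + k) = 2 * 2 ^- (4 + k)); last first.
  by rewrite [(4 + k)%N]addSn half_expn; lra.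
rewrite [(3 + k.+1)%N]addnS -addSn !natrD -natr1.
by move: (2 ^- (4 + k)) => a; ring.
Qed.

(** The 16 is forced by the coarsest level, where [l 0] has coefficient 1 in the chaining sum
    against 2^-4 in the entropy sum. The 5 is 3 + 1 + 1: the grid correction 6/2 at the coarsest
    level, the grid corrections of all finer levels, and the last link. *)
Lemma rad_localized_class_le (r : seq (I0 * R)) :
  (forall i, i \in r -> A0 i.1 /\ `|i.2 - t0| <= rho) ->
  rad (size z) (fun s => \big[Num.max/0]_(i <- r) `|sgsum s (map (h i) z)|)
  <= Num.sqrt 2 * Num.sqrt (\sum_(x <- z) ((W x * xi x) ^+ 2 + (L2 x * rho) ^+ 2))
     * (16 * M + 5).
Proof.
move=> rA; rewrite -[\sum_(x <- z) _]/D2 -/D.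
have x0 : T by case: z z_neq0.
have F0 : [set g th | th in A0] !=set0 by exists (g th0), th0.
have [l [l0 le_l l_sum]] := entropy_levels x0 F0 entropy_le.
have /choice[net netP] : forall i, _ := fun i => net_exists (l0 i) (le_l i).
(* Chaining starts at level 3 because the entropy integral stops at 1/8 = 2^-3. *)
pose net' j := net (j - 3)%N; pose l' j := l (j - 3)%N + (j + 3)%:R / 2.
have eq3 j : (3 <= j)%N -> (3 + (j - 3) = j)%N by exact: subnKC.
have l'E i : l' (3 + i)%N = l i + (i + 6)%:R / 2.
  by rewrite /l' addKn addnAC addnC.
have := @rad_chaining_le _ _ _ A h z D net' l' 3 D_gt0 h_le.
move=> /(_ _ _ _ _ _ (size z) r rA)/wrap[j i j3|j j3|j j3|j j3|j i j3 Ai|].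
- by have [+ _ _] := netP (j - 3)%N; apply.
- have [_ _ cov] := netP (j - 3)%N.
  have [|a] := cov (th0, t0).
    by split => //=; rewrite subrr normr0 ltW.
  by rewrite /net'; case: (net _).
- by rewrite /l' ltr_wpDl// divr_gt0// ltr0n addn_gt0 orbT.
- by have [_ + _] := netP (j - 3)%N; rewrite -l'E eq3.
- by have [_ _ cov] := netP (j - 3)%N; have := cov i Ai; rewrite eq3.
move=> /le_trans; apply.
set n := size z.
(* The number of chaining steps is taken equal to the sample size [n], since n 2^-(3+n) <= 1. *)
have n_le : n%:R * (2 ^- (3 + n) * D) <= Num.sqrt 2 * D * 1.
  rewrite mulr1 mulrA ler_pM2r// (@le_trans _ _ 1)//; last first.
    by rewrite -[leLHS]sqrtr1 ler_sqrt// ler1n.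
  rewrite ler_pdivrMr ?exprn_gt0// mul1r -natrX ler_nat.
  by rewrite ltnW// (leq_ltn_trans (leq_addl 3 n))// ltn_expl.
rewrite (le_trans (lerD (lexx _) n_le))// -mulrDr ler_pM2l; last first.
  by rewrite mulr_gt0// sqrtr_gt0.
rewrite (l'E 0%N); under eq_bigr do rewrite -addnS l'E mulrDr.
rewrite big_split/=.
have s1 := sum_geometric_affine n.
have -> : \sum_(i < n) 2 ^- (3 + i) * ((i.+1 + 6)%:R / 2)
    = \sum_(i < n) 2 ^- (4 + i) * (i + 7)%:R :> R.
  apply: eq_bigr => i _; rewrite addSnnS [(4 + i)%N]addSn half_expn; lra.
have := l_sum n.+1; rewrite big_ord_recl/=.
have : \sum_(i < n) 2 ^- (3 + i) * l i.+1
    <= 16 * \sum_(i < n) l (lift ord0 i) / 2 ^+ (4 + lift ord0 i).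
  rewrite mulr_sumr; apply: ler_sum => i _; rewrite lift0 addnS.
  rewrite (_ : 2 ^- (4 + i).+1 = 2 ^- (3 + i) / 4); last first.
    by rewrite half_expn [(4 + i)%N]addSn half_expn; lra.
  have := mulr_ge0 (l0 i.+1) (_ : 0 <= 2 ^- (3 + i)).
  by move=> /(_ _)/wrap[|]; [rewrite invr_ge0 exprn_ge0|lra].
move: s1; lra.
Qed.

End localized_class.

(** * The law of the sample *)

Section sample.
Context d (Omega : measurableType d) (R : realType) (P : probability Omega R).
Context d' (T : measurableType d') (X : nat -> {RV P >-> T}).

Definition sample (n : nat) (w : Omega) : n.-tuple T := [tuple X i w | i < n].

Lemma measurable_sample n : measurable_fun setT (sample n).
Proof.
apply/measurable_fun_tnthP => i.
rewrite (_ : _ \o _ = X i); first exact: measurable_funPT.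
by apply/funext => w; rewrite /= tnth_mktuple.
Qed.

HB.instance Definition _ n :=
  isMeasurableFun.Build _ _ _ _ (sample n) (@measurable_sample n).

Let rect n (B : nat -> set T) : set (n.-tuple T) :=
  [set z | forall i : 'I_n, B i (tnth z i)].

Let measurable_rect n B : (forall i, measurable (B i)) -> measurable (@rect n B).
Proof.
move=> mB; rewrite (_ : rect B = \bigcap_(i in [set: 'I_n]) ((@tnth n T)^~ i @^-1` B i)).
  apply: fin_bigcap_measurable => [|i _]; first exact: finite_finset.
  by rewrite -[X in measurable X]setTI; apply: measurable_tnth.
by apply/seteqP; split => z h i //=; apply: h.
Qed.

(** A cylinder over one coordinate is a rectangle with full sides elsewhere, so the rectangles,
    which are stable under intersection, generate the product sigma-algebra. *)
Let measurable_tupleE n :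
  @measurable _ (n.-tuple T) = <<s [set A | exists2 B, (forall i, measurable (B i)) & A = @rect n B] >>.
Proof.
apply/seteqP; split; last first.
  apply: smallest_sub; first exact: sigma_algebra_measurable.
  by move=> _ [B mB ->]; exact: measurable_rect.
apply: smallest_sub; first exact: smallest_sigma_algebra.
move=> A; elim/big_ind: _ => [//|U V hU hV [/hU|/hV]//|i _ [B mB <-]].
apply: sub_sigma_algebra; exists (fun j => if j == i :> nat then B else setT).
  by move=> j; case: ifP.
apply/seteqP; split => z.
  by move=> [_ Bz] j; case: eqP => // /val_inj ->.
by move=> /(_ i); rewrite eqxx; split.
Qed.

Variable mu : probability T R.

Lemma prod_power_rect n B : (forall i, measurable (B i)) ->
  prod_power mu n (@rect n B) = (\prod_(i < n) mu (B i))%E.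
Proof.
elim: n B => [|n IHn] B mB.
  rewrite big_ord0 /= diracE mem_set// => i; by case: i.
rewrite big_ord_recl -(IHn (fun i => B i.+1))//.
rewrite -(@product_measure1E _ _ _ _ _ mu (prod_power mu n))//; last exact: measurable_rect.
rewrite /= /distribution /pushforward/=; congr product_measure1.
apply/seteqP; split => [[x z] /= h|[x z] /= [h0 h] i].
  split; first exact: (h ord0).
  by move=> i; have := h (lift ord0 i); rewrite lift0 (tnth_nth x)/= (tnth_nth x).
case: (unliftP ord0 i) => [j|] ->//; rewrite lift0 (tnth_nth x)/= -tnth_nth.
exact: h.
Qed.

(** Uniqueness of measures on the rectangles; there, independence over the index set [iota 0 n]
    gives the product of the marginals. *)
Lemma distribution_sample n : iid X mu ->
  forall A, measurable A -> distribution P (sample n) A = prod_power mu n A.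
Proof.
move=> [indep ident]; apply: (measure_unique _ (fun=> setT)).
- exact: measurable_tupleE.
- move=> _ _ [B mB ->] [C mC ->]; exists (fun i => B i `&` C i).
    by move=> i; exact: measurableI.
  apply/seteqP; split => [z [hB hC] i|z h]; first by split.
  by split=> i; have [] := h i.
- by move=> _; exists (fun=> setT) => //; apply/seteqP; split.
- by rewrite bigcup_const//; exists 0%N.
- move=> _ [B mB ->]; apply: etrans (esym (prod_power_rect n mB)).
  pose J := [fset j in iota 0 n]%fset.
  have := indep J B mB; rewrite (_ : \bigcap_(j in _) _ = sample n @^-1` rect B); last first.
    apply/seteqP; split => [w h i|w h j /=].
      by rewrite tnth_mktuple; apply: h; rewrite /= !inE/= mem_iota/=.
    rewrite !inE/= mem_iota/= add0n => jn.
    by have := h (Ordinal jn); rewrite tnth_mktuple.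
  move=> indepB; apply: (etrans indepB); rewrite (perm_big (iota 0 n))/=; last first.
    apply: uniq_perm; [exact: fset_uniq|exact: iota_uniq|move=> j].
    by rewrite !inE.
  rewrite -[n in iota _ n]subn0 -/(index_iota 0 n) big_mkord.
  by apply: eq_bigr => i _; exact: ident.
- by move=> _; rewrite (le_lt_trans (probability_le1 _ _))// ltry.
Qed.

End sample.

(** * Translation of Lebesgue integrals *)

Section translation.
Context (R : realType).
Local Notation mu := (@lebesgue_measure R).

Let sh (c u : R) : R := u + c.

Let measurable_sh c : measurable_fun (setT : set (measurableTypeR R)) (sh c : _ -> measurableTypeR R).
Proof. exact: measurable_funD. Qed.

Lemma lebesgue_measure_shift c (A : set (measurableTypeR R)) : measurable A ->
  pushforward mu (sh c) A = mu A.
Proof.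
move=> mA; apply/esym/(lebesgue_measure_unique
  (mu := [the measure _ _ of pushforward mu (sh c : _ -> measurableTypeR R)])) => //= _ [[a b]] _ <-.
rewrite /pushforward (_ : _ @^-1` _ = `]a - c, b - c]%classic); last first.
  by apply/seteqP; split => x /=; rewrite !in_itv/= /sh ltrBlDr lerBrDr.
rewrite !lebesgue_measure_itv/= !lte_fin ltrD2r; case: ifP => // _.
by rewrite -!EFinD; congr _%:E; ring.
Qed.

Lemma integral_shift c (D : set (measurableTypeR R)) (f : R -> \bar R) :
  measurable D -> measurable_fun D f ->
  (\int[mu]_(x in D) f x = \int[mu]_(x in (sh c) @^-1` D) f (x + c)%R)%E.
Proof.
move=> mD mf.
have ge0 (g : R -> \bar R) : measurable_fun D g -> (forall x, (0 <= g x)%E) ->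
    (\int[mu]_(x in D) g x = \int[mu]_(x in (sh c) @^-1` D) g (x + c)%R)%E.
  move=> mg g0.
  rewrite -(ge0_integral_pushforward (measurable_sh c) mu mD mg)//.
  by apply: eq_measure_integral => A mA _; exact/esym/lebesgue_measure_shift.
rewrite integralE [RHS]integralE; congr (_ - _)%E.
  have e := ge0 _ (measurable_funepos mf) (funepos_ge0 f).
  apply: (etrans e). apply: eq_integral => x _. by rewrite !funeposE.
have e := ge0 _ (measurable_funeneg mf) (funeneg_ge0 f).
apply: (etrans e). apply: eq_integral => x _. by rewrite !funenegE.
Qed.
Lemma integrable_shift c (D : set (measurableTypeR R)) (f : R -> R) :
  measurable D -> mu.-integrable D (EFin \o f) ->
  mu.-integrable ((sh c) @^-1` D) (EFin \o (fun x => f (x + c))).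
Proof.
move=> mD intf; have mf := measurable_int _ intf.
have mD' : measurable ((sh c : _ -> measurableTypeR R) @^-1` D).
  by rewrite -[X in measurable X]setTI; exact: measurable_sh.
apply/integrableP; split.
  apply: (measurable_comp mD _ mf); first by move=> _ [x Dx <-].
  exact: (measurable_funS measurableT (@subsetT _ _) (measurable_sh c)).
have /integrableP[_] := intf; congr (_ < _)%E.
by rewrite (integral_shift c mD)//; exact: measurableT_comp.
Qed.

(** The intervals have the same length, so a shift by [a - b] brings both functions under one
    integral and only a bound at corresponding points is needed. *)
Lemma Rintegral_shiftB_le (f g : R -> R) (a b l k : R) : 0 <= l ->
  mu.-integrable `[a, a + l] (EFin \o f) ->
  mu.-integrable `[b, b + l] (EFin \o g) ->
  (forall x, 0 <= x <= l -> `|f (a + x) - g (b + x)| <= k) ->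
  `|\int[mu]_(x in `[a, a + l]) f x - \int[mu]_(x in `[b, b + l]) g x| <= k * l.
Proof.
move=> l0 fint gint fg; set c := a - b.
have ma : measurable (`[a, a + l]%classic : set (measurableTypeR R)).
  exact: measurable_itv.
have mb : measurable (`[b, b + l]%classic : set (measurableTypeR R)).
  exact: measurable_itv.
have shE : sh c @^-1` `[a, a + l] = `[b, b + l]%classic.
  apply/seteqP; split => x /=; rewrite !in_itv/= /sh /c => /andP[x1 x2];
  by apply/andP; split; lra.
have fint' : mu.-integrable `[b, b + l] (EFin \o (fun x => f (x + c))).
  by rewrite -shE; exact: integrable_shift.
rewrite (_ : \int[mu]_(x in `[a, a + l]) f x
    = \int[mu]_(x in `[b, b + l]) f (x + c)); last first.
  rewrite /Rintegral (integral_shift c) ?shE//.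
  exact: measurable_int fint.
have dint : mu.-integrable `[b, b + l] (EFin \o (fun x => f (x + c) - g x)).
  exact: (integrableB mb fint' gint).
rewrite -RintegralB// (le_trans (le_normr_Rintegral _ _))//.
have muE : mu `[b, b + l]%classic = l%:E.
  rewrite lebesgue_measure_itv/= lte_fin ltrDl.
  case: ifP => [_|/negbT]; first by rewrite -EFinD addrC addKr.
  by rewrite -leNgt => l0'; congr _%:E; apply/eqP; rewrite eq_le l0 l0'.
apply: (@le_trans _ _ (\int[mu]_(x in `[b, b + l]) k)).
  apply: le_Rintegral => //.
  - exact: (integrable_abse dint).
  - apply: measurable_bounded_integrable => //; first by rewrite [X in (X < _)%E]muE ltry.
    by exists `|k|; split; rewrite ?num_real// => M kM x _; exact: ltW.
  move=> x /=; rewrite in_itv/= => /andP[x1 x2].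
  rewrite (_ : x + c = a + (x - b)); last by rewrite /c; ring.
  by rewrite -[in g _](subrKC b x) fg// subr_ge0 x1 lerBlDl.
by rewrite Rintegral_cst// [X in fine X]muE.
Qed.

End translation.

(** * Integrals with respect to the common law *)

Section iid_transfer.
Context d (Omega : measurableType d) (R : realType) (P : probability Omega R).
Context d' (T : measurableType d') (X : nat -> {RV P >-> T}) (mu : probability T R).
Hypothesis Xiid : iid X mu.
Local Open Scope ereal_scope.

Lemma ge0_integral_iid j (g : T -> \bar R) : measurable_fun setT g ->
  (forall x, 0 <= g x) -> \int[P]_w g (X j w) = \int[mu]_x g x.
Proof.
move=> mg g0; rewrite -(ge0_integral_distribution (X j))//.
by apply: eq_measure_integral => A mA _; exact: Xiid.2.
Qed.

Lemma integrable_iid j (g : T -> \bar R) : mu.-integrable setT g ->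
  P.-integrable setT (g \o X j).
Proof.
move=> /integrableP[mg gint]; apply/integrableP; split.
  by apply: measurableT_comp => //; exact: measurable_funPT.
have -> // : \int[P]_w `|(g \o X j) w| = \int[mu]_x `|g x|.
by apply: (ge0_integral_iid j (g := fun x => `|g x|)) => //; exact: measurableT_comp.
Qed.

Lemma integral_iid j (g : T -> \bar R) : mu.-integrable setT g ->
  \int[P]_w g (X j w) = \int[mu]_x g x.
Proof.
move=> gint; rewrite -(integral_distribution (X := X j)).
- by apply: eq_measure_integral => A mA _; exact: Xiid.2.
- exact: measurable_int gint.
- exact: integrable_iid.
Qed.

Lemma ge0_integral_sample n (g : n.-tuple T -> \bar R) : measurable_fun setT g ->
  (forall x, 0 <= g x) ->
  \int[P]_w g (sample X n w) = \int[prod_power mu n]_z g z.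
Proof.
move=> mg g0; rewrite -(ge0_integral_distribution (sample X n))//.
by apply: eq_measure_integral => A mA _; exact: distribution_sample.
Qed.

End iid_transfer.

(** * Expected maximum of finitely many empirical deviations *)

Section maximal_inequality.
Context d (Omega : measurableType d) (R : realType) (P : probability Omega R).
Context d' (T : measurableType d') (X : nat -> {RV P >-> T}) (mu : probability T R).
Hypothesis Xiid : iid X mu.
Context (I : eqType) (f : I -> T -> R) (e : I -> R) (n : nat) (C2 : T -> R) (c k : R).
Hypothesis f_int : forall i, mu.-integrable setT (EFin \o f i).
Hypothesis f_mean : forall i, (\int[mu]_x (f i x)%:E)%E = (e i)%:E.
Hypothesis n_gt0 : (0 < n)%N.
Hypothesis C2_meas : measurable_fun setT C2.
Hypothesis C2_ge0 : forall x, 0 <= C2 x.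
Hypothesis C2_int : (\int[mu]_x (C2 x)%:E <= (k ^+ 2)%:E)%E.
Hypothesis c_ge0 : 0 <= c.
Hypothesis k_gt0 : 0 < k.

Let mf i : measurable_fun setT (f i).
Proof. exact/measurable_EFinP/measurable_int/f_int. Qed.

(** Given the sample, chaining bounds the signed sums by the square root of a random quantity whose
    mean is at most [n * k ^+ 2]. The factor 2 comes from symmetrization. *)
Lemma integral_bigmax_empirical_le (r : seq I) :
  (forall z : n.-tuple T,
    rad n (fun s => \big[Num.max/0]_(i <- r) `|sgsum s (map (f i) z)|)
    <= c * Num.sqrt (\sum_(x <- z) C2 x)) ->
  (\int[P]_w (\big[Num.max/0]_(i <- r)
     `|n%:R^-1 * \sum_(j < n) (f i (X j w) - e i)|)%:E
   <= (2 * c * k / Num.sqrt n%:R)%:E)%E.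
Proof.
move=> rad_le_c.
have n0 : 0 < n%:R :> R by rewrite ltr0n.
have sn0 : 0 < Num.sqrt n%:R :> R by rewrite sqrtr_gt0.
pose Phi (z : n.-tuple T) : R := \big[Num.max/0]_(i <- r) `|\sum_(x <- z) (f i x - e i)|.
pose Psi (z : n.-tuple T) : R := rad n (fun s => \big[Num.max/0]_(i <- r) `|sgsum s (map (f i) z)|).
have Phi0 z : 0 <= Phi z by exact: bigmax_ge_id.
have Psi0 z : 0 <= Psi z by apply: rad_ge0 => s; exact: bigmax_ge_id.
have mPhi : measurable_fun setT Phi.
  apply: measurable_bigmax => i; apply: measurableT_comp => //.
  under eq_fun do rewrite big_tuple.
  apply: measurable_sum => j; apply: measurable_funB => //.
  by apply: measurableT_comp => //; exact: measurable_tnth.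
have mPsi : measurable_fun setT Psi.
  apply: (@measurable_rad _ _ _ n (fun s (z : n.-tuple T) =>
    \big[Num.max/0]_(i <- r) `|sgsum s (map (f i) z)|)) => s.
  apply: measurable_bigmax => i; apply: measurableT_comp => //.
  exact: measurable_sgsum.
have mS : measurable_fun setT (fun w => \sum_(x <- sample X n w) C2 x).
  under eq_fun do rewrite big_tuple; apply: measurable_sum => j.
  rewrite (_ : (fun _ => _) = C2 \o X j).
    by apply: measurableT_comp => //; exact: measurable_funPT.
  by apply/funext => w /=; rewrite tnth_mktuple.
have S0 w : 0 <= \sum_(x <- sample X n w) C2 x by exact: sumr_ge0.
have -> : (\int[P]_w (\big[Num.max/0]_(i <- r)
     `|n%:R^-1 * \sum_(j < n) (f i (X j w) - e i)|)%:E =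
    n%:R^-1%:E * \int[P]_w (Phi (sample X n w))%:E)%E.
  rewrite -ge0_integralZl//; last 2 first.
  - by apply/measurable_EFinP; apply: measurableT_comp.
  - by move=> w _; rewrite lee_fin.
  apply: eq_integral => w _; rewrite -EFinM; congr _%:E.
  rewrite /Phi (big_morph ( *%R n%:R^-1) (op1 := Num.max) (id1 := 0)); last 2 first.
  - by move=> x y; rewrite maxr_pMr// invr_ge0.
  - exact: mulr0.
  apply: eq_bigr => i _; rewrite normrM ger0_norm ?invr_ge0//; congr (_ * `|_|).
  by rewrite big_tuple; apply: eq_bigr => j _; rewrite tnth_mktuple.
rewrite (_ : 2 * c * k / Num.sqrt n%:R = n%:R^-1 * (2 * c * (k * Num.sqrt n%:R))); last first.
  have : Num.sqrt n%:R ^+ 2 = n%:R :> R by rewrite sqr_sqrtr.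
  by move: (Num.sqrt _) sn0 => s s0 <-; field; rewrite gt_eqF.
rewrite EFinM lee_pmul2l ?lte_fin ?invr_gt0//.
rewrite (ge0_integral_sample Xiid (g := EFin \o Phi))//; last exact/measurable_EFinP.
apply: le_trans (symmetrization r f_int f_mean n) _.
rewrite -(ge0_integral_sample Xiid (g := fun z => (2 * Psi z)%:E)); last 2 first.
- by apply/measurable_EFinP; exact: measurable_funM.
- by move=> z; rewrite lee_fin mulr_ge0.
(* AM-GM in place of Jensen: [sqrt S <= (S / q + q) / 2] with [q = k sqrt n] *)
set q := k * Num.sqrt n%:R; have q0 : 0 < q by rewrite mulr_gt0.
apply: (@le_trans _ _ (\int[P]_w ((c / q)%:E * (\sum_(x <- sample X n w) C2 x)%:E
    + (c * q)%:E))%E).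
  apply: ge0_le_integral => //.
  - by move=> w _; rewrite lee_fin mulr_ge0.
  - apply/measurable_EFinP; apply: measurable_funM => //.
    by apply: measurableT_comp => //; exact: measurable_funPT.
  - apply/measurable_EFinP; apply: measurable_funD => //.
    exact: measurable_funM.
  move=> w _; rewrite -EFinM -EFinD lee_fin.
  have := rad_le_c (sample X n w); rewrite -/(Psi _) => Psi_le.
  set S := \sum_(x <- _) _ in Psi_le *.
  rewrite (le_trans (ler_wpM2l _ Psi_le))// (_ : c / q * S + c * q = c * (S / q + q)); last by ring.
  rewrite mulrCA ler_wpM2l//.
  have := sqr_ge0 (Num.sqrt S - q); rewrite sqrrB sqr_sqrtr ?S0// => h.
  rewrite -(ler_pM2r q0) [leRHS]mulrDl divfK ?gt_eqF//.
  by move: h; rewrite mulr2n; lra.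
rewrite ge0_integralD//; last 3 first.
- by move=> w _; rewrite -EFinM lee_fin mulr_ge0 ?divr_ge0// ltW.
- by apply/measurable_EFinP; exact: measurable_funM.
- by move=> w _; rewrite lee_fin mulr_ge0// ltW.
rewrite integral_cst// [X in (_ * X)%E]probability_setT mule1.
rewrite ge0_integralZl//; last 3 first.
- exact/measurable_EFinP.
- by move=> w _; rewrite lee_fin.
- by rewrite lee_fin divr_ge0// ltW.
have -> : (\int[P]_w (\sum_(x <- sample X n w) C2 x)%:E
    = n%:R%:E * \int[mu]_x (C2 x)%:E)%E.
  under eq_integral do rewrite big_tuple -sumEFin.
  rewrite ge0_integral_sum//; last 2 first.
  - move=> j; apply/measurable_EFinP; rewrite (_ : (fun _ => _) = C2 \o X j).
      by apply: measurableT_comp => //; exact: measurable_funPT.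
    by apply/funext => w /=; rewrite tnth_mktuple.
  - by move=> j w _; rewrite lee_fin.
  under eq_bigr => j _.
    under eq_integral do rewrite tnth_mktuple.
    rewrite (ge0_integral_iid Xiid j (g := EFin \o C2))//; last exact/measurable_EFinP.
    over.
  by rewrite sumr_const card_ord mule_natl.
apply: (@le_trans _ _ ((c / q)%:E * (n%:R%:E * (k ^+ 2)%:E) + (c * q)%:E)%E).
  by rewrite leeD2r// !lee_wpmul2l// lee_fin ?divr_ge0 ?(ltW q0).
rewrite -!EFinM -EFinD lee_fin /q.
have : Num.sqrt n%:R ^+ 2 = n%:R :> R by rewrite sqr_sqrtr.
move: (Num.sqrt _) sn0 => s s0 <-.
by rewrite (_ : _ + _ = 2 * c * (k * s))//; field; rewrite !gt_eqF.
Qed.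

End maximal_inequality.

(** * Markov's inequality for a countable family *)

Section markov_sup.
Context d (Omega : measurableType d) (R : realType) (P : probability Omega R).

(** Markov's inequality holds for each finite maximum with the same constant, and continuity from
    below carries it to the increasing union of the events. Two indices occur because the process is
    evaluated both at the estimator and at the true parameter; this doubles [B]. *)
Lemma markov_sup (Y : nat -> Omega -> R) (B c tau : R) :
  (forall i, measurable_fun setT (Y i)) -> 0 <= c -> 0 < tau ->
  (forall N, (\int[P]_w (\big[Num.max/0]_(i <- iota 0 N) `|Y i w|)%:E <= B%:E)%E) ->
  exists E, [/\ measurable E, (P E <= ((2 * B + c) / tau)%:E)%E &
    forall w i i', tau < `|Y i w| + `|Y i' w| + c -> E w].
Proof.
move=> mY c0 tau0 intB.
pose m N w := \big[Num.max/0]_(i <- iota 0 N) `|Y i w|.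
have m0 N w : 0 <= m N w by exact: bigmax_ge_id.
have mm N : measurable_fun setT (m N).
  by apply: measurable_bigmax => i; exact: measurableT_comp.
have le_m N i w : (i < N)%N -> `|Y i w| <= m N w.
  by move=> iN; apply: (@le_bigmax_seq _ _ _ _ _ i); rewrite ?mem_iota.
pose g N w := (2 * m N w + c) / tau.
have g0 N w : 0 <= g N w.
  by rewrite divr_ge0 ?(ltW tau0)// addr_ge0// mulr_ge0.
have mg N : measurable_fun setT (g N).
  by apply: measurable_funM => //; apply: measurable_funD => //; exact: measurable_funM.
pose S N := [set w | 1 < g N w].
have mS N : measurable (S N).
  rewrite (_ : S N = setT `&` g N @^-1` `]1, +oo[); first exact: mg.
  by rewrite setTI; apply/seteqP; split => w; rewrite /S /= in_itv/= andbT.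
have ndS : nondecreasing_seq S.
  move=> N N' NN'; apply/subsetPset => w; rewrite /S /= => /lt_le_trans; apply.
  rewrite /g ler_pM2r ?invr_gt0// lerD2r ler_pM2l//.
  apply: sub_bigmax_seq => i; rewrite !mem_iota/= !add0n => iN.
  exact: leq_trans iN NN'.
have PS N : (P (S N) <= ((2 * B + c) / tau)%:E)%E.
  rewrite -[S N]setIT -integral_indic//.
  apply: (@le_trans _ _ (\int[P]_w (g N w)%:E)%E).
    apply: ge0_le_integral => //.
    - by apply/measurable_EFinP; exact: measurable_indic.
    - exact/measurable_EFinP.
    - move=> w _; rewrite lee_fin indicE; case: (boolP (w \in S N)) => //.
      by rewrite inE /S /= => /ltW.
  have -> : (\int[P]_w (g N w)%:E)%E =
      ((2 / tau)%:E * \int[P]_w (m N w)%:E + (c / tau)%:E)%E.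
    have -> : (fun w => (g N w)%:E) = (fun w => (2 / tau)%:E * (m N w)%:E + (c / tau)%:E)%E.
      by apply/funext => w; rewrite -EFinM -EFinD /g; congr _%:E; ring.
    rewrite ge0_integralD//; last 3 first.
    - by move=> w _; rewrite -EFinM lee_fin mulr_ge0// divr_ge0// ltW.
    - by apply/measurable_EFinP; exact: measurable_funM.
    - by move=> w _; rewrite lee_fin divr_ge0// ltW.
    rewrite integral_cst// [X in (_ * X)%E]probability_setT mule1.
    rewrite ge0_integralZl//.
    - exact/measurable_EFinP.
    - by move=> w _; rewrite lee_fin.
    - by rewrite lee_fin divr_ge0// ltW.
  rewrite (_ : (2 * B + c) / tau = 2 / tau * B + c / tau); last by ring.
  rewrite EFinD leeD2r// (EFinM (2 / tau) B) lee_pmul2l ?lte_fin ?divr_gt0//.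
  exact: intB.
exists (\bigcup_N S N); split.
- exact: bigcup_measurable.
- have cvgS := nondecreasing_cvg_mu (mu := P) mS (bigcup_measurable (fun i _ => mS i)) ndS.
  rewrite -(cvg_lim _ cvgS)//; apply: lime_le.
    by apply/cvg_ex; eexists; exact: cvgS.
  by apply: nearW => N; exact: PS.
- move=> w i i' h; exists (maxn i i').+1 => //; rewrite /S /g /=.
  rewrite ltr_pdivlMr// mul1r (lt_le_trans h)// lerD2r.
  rewrite (_ : 2 * _ = m (maxn i i').+1 w + m (maxn i i').+1 w); last by ring.
  by rewrite lerD// le_m// ltnS ?leq_maxl ?leq_maxr.
Qed.

End markov_sup.

(** * Measurability of suprema over separable families *)

Lemma countable_enum (T : Type) (A : set T) a0 : countable A -> A a0 ->
  exists u : nat -> T, (forall i, A (u i)) /\ forall a, A a -> exists i, u i = a.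
Proof.
move=> /countable_injP[f finj] Aa0.
have /choice[u uP] : forall i, exists a, A a /\ ((exists2 b, A b & f b = i) -> f a = i).
  move=> i; have [[b Ab fb]|nb] := pselect (exists2 b, A b & f b = i).
    by exists b.
  by exists a0.
exists u; split=> [i|a Aa]; first exact: (uP i).1.
exists (f a); apply: finj; rewrite ?inE//; first exact: (uP _).1.
by apply: (uP _).2; exists a.
Qed.

(** The set is contained in the countable intersection [A], and differs from it only inside the
    negligible set [N], where density may fail; completeness makes that difference measurable. *)
Lemma measurable_ball_sup d (Omega : measurableType d) (R : realType)
    (P : probability Omega R) (I : Type) (U C : set I) (D : I -> Omega -> R)
    (N : set Omega) (c : R) :
  measure_is_complete P -> P.-negligible N -> countable C -> C `<=` U ->
  (forall i, U i -> measurable_fun setT (D i)) ->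
  (forall w i (e : R), ~ N w -> U i -> 0 < e ->
    exists2 j, C j & `|D i w - D j w| <= e) ->
  measurable [set w | (ereal_sup [set `|D i w|%:E | i in U] <= c%:E)%E].
Proof.
move=> Pcomplete Nnull Ccount CU mD dense; set E := [set w | _].
have EP w : E w <-> forall i, U i -> `|D i w| <= c.
  split=> [Ew i Ui|h].
    by rewrite -lee_fin (le_trans _ Ew)//; apply: ereal_sup_ubound; exists i.
  by apply: ge_ereal_sup => _ [i Ui <-]; rewrite lee_fin h.
pose A := \bigcap_(i in C) [set w | `|D i w| <= c].
have mA : measurable A.
  have [C0|/set0P[i0 Ci0]] := eqVneq C set0; first by rewrite /A C0 bigcap_set0.
  have [u [uC Cu]] := countable_enum Ccount Ci0.
  rewrite (_ : A = \bigcap_k [set w | `|D (u k) w| <= c]).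
    apply: bigcapT_measurable => k.
    have mDk : measurable_fun setT (fun w => `|D (u k) w|).
      by apply: measurableT_comp => //; exact/mD/CU.
    rewrite (_ : [set _ | _] = setT `&` (fun w => `|D (u k) w|) @^-1` `]-oo, c]).
      exact: mDk.
    by rewrite setTI; apply/seteqP; split => w; rewrite /= in_itv.
  apply/seteqP; split => w h i; first by move=> _; exact: h.
  by move=> /Cu[k <-]; exact: h.
rewrite (_ : E = A `\` (A `\` E)); last first.
  rewrite setDD; apply/seteqP; split => [w Ew|w []//]; split => // i /CU.
  exact: (EP w).1.
apply: measurableD => //; apply: Pcomplete; apply: negligibleS Nnull.
move=> w [Aw nEw]; apply: contrapT => Nw; apply: nEw; apply/EP => i Ui.
apply/ler_addgt0Pr => e e0; have [j Cj ij] := dense w i e Nw Ui e0.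
rewrite -(subrK (D j w) (D i w)) (le_trans (ler_normD _ _))// addrC lerD//.
exact: Aw.
Qed.

(** * Weighted integrals of functions small in mean *)

Section uniformly_small_integral.
Context d (T : measurableType d) (R : realType) (mu : probability T R).
Context (L f : T -> R).
Hypothesis L_meas : measurable_fun setT L.
Hypothesis L_ge0 : forall x, 0 <= L x.
Hypothesis f_meas : measurable_fun setT f.
Hypothesis Lf_int : mu.-integrable setT (EFin \o (fun x => L x * f x)).

(** Condition (vi) makes increments of [G] small in mean, while the Lipschitz bound weights them by
    [L1]. Truncation closes the gap: L g is at most k g plus L f on the set where L > k, and the
    latter is small for large k by dominated convergence. *)
Lemma integral_weight_small (e : R) : 0 < e -> exists2 eta : R, 0 < eta &
  forall g : T -> R, measurable_fun setT g -> (forall x, 0 <= g x <= f x) ->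
    (\int[mu]_x (g x)%:E <= eta%:E)%E -> (\int[mu]_x (L x * g x)%:E <= e%:E)%E.
Proof.
move=> e0.
pose A (k : nat) := [set x | k%:R < L x].
have mA k : measurable (A k).
  rewrite (_ : A k = setT `&` L @^-1` `]k%:R, +oo[); first exact: L_meas.
  by rewrite setTI; apply/seteqP; split => x; rewrite /A /= in_itv/= andbT.
pose F (k : nat) x := (L x * f x * \1_(A k) x)%:E.
have mF k : measurable_fun setT (F k).
  apply/measurable_EFinP; apply: measurable_funM; last exact: measurable_indic.
  exact: measurable_funM.
have [|||_ _] := @dominated_convergence _ _ _ mu setT measurableT F (cst 0%E)
    (fun x => `|(L x * f x)%:E|)%E mF (measurable_cst _).
- apply: aeW => x _; apply: cvg_near_cst; near=> k.
  rewrite /F indicE memNset ?mulr0// /A /=; apply/negP; rewrite -leNgt.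
  near: k; exact: nbhs_infty_ger.
- exact: integrable_abse.
- apply: aeW => x k _; rewrite /F abse_EFin lee_fin normrM ler_piMr// indicE.
  by case: (_ \in _); rewrite ?normr1 ?normr0.
rewrite integral0 => /fine_cvgP[Ffin /cvgrPdist_le/(_ (e / 2))].
rewrite divr_gt0// => /(_ isT) Fsmall; near \oo => k.
have kfin : (\int[mu]_x F k x)%E \is a fin_num by near: k.
have k_le : (\int[mu]_x F k x <= (e / 2)%:E)%E.
  rewrite -(fineK kfin) lee_fin (le_trans (ler_norm _))// -normrN -sub0r.
  by near: k.
have k0 : 0 < k%:R :> R by rewrite ltr0n; near: k; exact: nbhs_infty_gt.
exists (e / (2 * k%:R)) => [|g mg g0f g_le]; first by rewrite divr_gt0// mulr_gt0.
have g0 x : 0 <= g x by have /andP[] := g0f x.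
apply: (@le_trans _ _ (\int[mu]_x (k%:R%:E * (g x)%:E + F k x))%E).
  apply: ge0_le_integral => //.
  - by move=> x _; rewrite lee_fin mulr_ge0.
  - by apply/measurable_EFinP; exact: measurable_funM.
  - by apply: emeasurable_funD => //; apply: measurable_funeM; exact/measurable_EFinP.
  move=> x _; rewrite /F -EFinM -EFinD lee_fin; have /andP[_ gf] := g0f x.
  rewrite indicE; case: (boolP (x \in A k)) => [_|].
    by rewrite mulr1 -[leLHS]add0r lerD ?mulr_ge0 ?ler_wpM2l// ltW.
  by rewrite notin_setE /A /= => /negP; rewrite -leNgt mulr0 addr0 => ?; rewrite ler_wpM2r.
have F0 x : (0 <= F k x)%E.
  by rewrite lee_fin !mulr_ge0// (le_trans (g0 x))//; have /andP[] := g0f x.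
rewrite ge0_integralD//; last 2 first.
- by move=> x _; rewrite -EFinM lee_fin mulr_ge0.
- by apply: measurable_funeM; exact/measurable_EFinP.
rewrite ge0_integralZl//; last 2 first.
- exact/measurable_EFinP.
- by move=> x _; rewrite lee_fin.
rewrite (_ : e%:E = (k%:R%:E * (e / (2 * k%:R))%:E + (e / 2)%:E)%E); last first.
  by rewrite -EFinM -EFinD; congr _%:E; field; rewrite gt_eqF.
by rewrite leeD// lee_wpmul2l// lee_fin ltW.
Unshelve. all: by end_near. Qed.

End uniformly_small_integral.

(** * Empirical deviations *)

Section empirical_dev.
Context d (Omega : measurableType d) (R : realType) (P : probability Omega R).
Context (k : nat) (Z : nat -> {RV P >-> brV R k}) (PZ : probability (brV R k) R).
Hypothesis Z_iid : iid Z PZ.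
Implicit Types f g : brV R k -> R.

Lemma fine_expectation_iid f j : PZ.-integrable setT (EFin \o f) ->
  fine 'E_P[fun w => f (Z j w)] = \int[PZ]_x f x.
Proof.
by move=> fint; rewrite unlock (integral_iid Z_iid j (g := EFin \o f)).
Qed.

Lemma meanE f : PZ.-integrable setT (EFin \o f) -> mean Z f = \int[PZ]_x f x.
Proof. exact: fine_expectation_iid. Qed.

Lemma empirical_devE n f w : PZ.-integrable setT (EFin \o f) ->
  empirical_dev Z n f w = n%:R^-1 * \sum_(j < n) (f (Z j w) - \int[PZ]_x f x).
Proof.
move=> fint; rewrite /empirical_dev; congr (_ * _); apply: eq_bigr => j _.
by rewrite fine_expectation_iid.
Qed.

Lemma empirical_dev_mean n f w : (0 < n)%N -> PZ.-integrable setT (EFin \o f) ->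
  empirical_dev Z n f w = n%:R^-1 * \sum_(j < n) f (Z j w) - \int[PZ]_x f x.
Proof.
move=> n0 fint; rewrite empirical_devE// big_split/= mulrDr; congr (_ + _).
rewrite sumr_const card_ord -[(- _) *+ n]mulr_natl mulrA mulVf ?mul1r//.
by rewrite pnatr_eq0 -lt0n.
Qed.

Lemma empirical_dev_dist n f g w (e : R) : (0 < n)%N ->
  PZ.-integrable setT (EFin \o f) -> PZ.-integrable setT (EFin \o g) ->
  (forall j : 'I_n, `|f (Z j w) - g (Z j w)| <= e) ->
  `|\int[PZ]_x f x - \int[PZ]_x g x| <= e ->
  `|empirical_dev Z n f w - empirical_dev Z n g w| <= e + e.
Proof.
move=> n0 fint gint fg_le int_le; rewrite !empirical_dev_mean//.
set F := \sum_(_ < _) _; set F' := \sum_(_ < _) _.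
rewrite (_ : _ - _ = n%:R^-1 * (F - F') - (\int[PZ]_x f x - \int[PZ]_x g x)); last by ring.
rewrite (le_trans (ler_normB _ _))// lerD// normrM ger0_norm ?invr_ge0//.
rewrite ler_pdivrMl ?ltr0n// -sumrB (le_trans (ler_norm_sum _ _ _))//.
rewrite mulr_natl -[X in _ *+ X]card_ord -sumr_const.
by apply: ler_sum => j _; exact: fg_le.
Qed.

Lemma measurable_empirical_dev n f : PZ.-integrable setT (EFin \o f) ->
  measurable_fun setT (empirical_dev Z n f).
Proof.
move=> fint; have mf : measurable_fun setT f.
  exact/measurable_EFinP/measurable_int/fint.
rewrite (_ : empirical_dev Z n f = fun w => n%:R^-1 * \sum_(j < n) (f (Z j w) - \int[PZ]_x f x)); last first.
  by apply/funext => w; rewrite empirical_devE.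
apply: measurable_funM => //; apply: measurable_sum => j.
by apply: measurable_funB => //; apply: measurableT_comp => //; exact: measurable_funPT.
Qed.

Lemma sample_negligible n (N : set (n.-tuple (brV R k))) :
  (prod_power PZ n).-negligible N -> P.-negligible (sample Z n @^-1` N).
Proof.
move=> [A [mA A0 NA]]; exists (sample Z n @^-1` A); split.
- by rewrite -[X in measurable X]setTI; exact: measurable_sample.
- by rewrite -[RHS]A0; exact: distribution_sample Z_iid _ mA.
- exact: preimage_subset.
Qed.

End empirical_dev.

Section Rintegral_bounds.
Context d (T : measurableType d) (R : realType) (mu : probability T R).
Implicit Types f g : T -> R.

Lemma normr_Rintegral_le f (c : R) : mu.-integrable setT (EFin \o f) ->
  (\int[mu]_x `|f x|%:E <= c%:E)%E -> `|\int[mu]_x f x| <= c.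
Proof.
move=> fint h; rewrite -lee_fin EFin_normr_Rintegral//.
by rewrite (le_trans (le_abse_integral _ _ _))//; exact: measurable_int fint.
Qed.

(** The pointwise bound |f| <= f^2/(2c) + c/2 takes the place of the Cauchy-Schwarz inequality. *)
Lemma integral_le_Lnorm2 f (c : R) : measurable_fun setT f -> 0 < c ->
  (\int[mu]_x (f x ^+ 2)%:E <= (c ^+ 2)%:E)%E -> (\int[mu]_x `|f x|%:E <= c%:E)%E.
Proof.
move=> mf c0 f2.
apply: (@le_trans _ _ (\int[mu]_x ((2 * c)^-1%:E * (f x ^+ 2)%:E + (c / 2)%:E))%E).
  apply: ge0_le_integral => //.
  - by apply/measurable_EFinP; exact: measurableT_comp.
  - apply/measurable_EFinP; apply: measurable_funD => //.
    by apply: measurable_funM => //; exact: measurable_funX.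
  move=> x _; rewrite -EFinM -EFinD lee_fin.
  rewrite -(ler_pM2r (_ : 0 < 2 * c)) ?mulr_gt0//.
  rewrite [leRHS](_ : _ = f x ^+ 2 + c ^+ 2); last by field; rewrite gt_eqF.
  by have := sqr_ge0 (`|f x| - c); rewrite sqrrB real_normK ?num_real// mulr2n; lra.
rewrite ge0_integralD//; last 3 first.
- by move=> x _; rewrite -EFinM lee_fin mulr_ge0 ?sqr_ge0// invr_ge0 mulr_ge0// ltW.
- by apply/measurable_EFinP; apply: measurable_funM => //; exact: measurable_funX.
- by move=> x _; rewrite lee_fin divr_ge0// ltW.
rewrite integral_cst// [X in (_ * X)%E]probability_setT mule1.
rewrite ge0_integralZl//; last 3 first.
- by apply/measurable_EFinP; exact: measurable_funX.
- by move=> x _; rewrite lee_fin sqr_ge0.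
- by rewrite lee_fin invr_ge0 mulr_ge0// ltW.
apply: (@le_trans _ _ ((2 * c)^-1%:E * (c ^+ 2)%:E + (c / 2)%:E)%E).
  by rewrite leeD2r// lee_wpmul2l// lee_fin invr_ge0 mulr_ge0// ltW.
rewrite -EFinM -EFinD lee_fin (_ : _ + _ = c)//.
by field; rewrite gt_eqF.
Qed.

End Rintegral_bounds.

(** * Dyadic shells and their geometric series *)

Section shells.
Context (R : realType).
Implicit Types (beta eps b : R) (n : nat) (j : int).

Let two0 : 2 != 0 :> R. Proof. exact: lt0r_neq0. Qed.

Let pow2 (x : R) : 0 < 2 `^ x :> R. Proof. exact: powR_gt0. Qed.

Lemma Keps_le eps : 0 < eps -> 2 ^ Keps eps <= eps.
Proof.
move=> eps0; rewrite -powR_intmul// -{2}(lnK eps0) /powR (negPf two0).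
rewrite ler_expR -ler_pdivlMr ?ln_gt0 ?ltr1n//.
by have /andP[] := floor_itv (ln eps / ln 2).
Qed.

Lemma Keps_gt eps : 0 < eps -> eps < 2 ^ (Keps eps + 1).
Proof.
move=> eps0; rewrite -powR_intmul// -{1}(lnK eps0) /powR (negPf two0).
rewrite ltr_expR -ltr_pdivrMr ?ln_gt0 ?ltr1n//.
by have /andP[] := floor_itv (ln eps / ln 2).
Qed.

Lemma sqrt2_expz j : Num.sqrt 2 ^ j = 2 `^ (j%:~R / 2) :> R.
Proof.
by rewrite mulrC powRrM powR12_sqrt// powR_intmul// sqrtr_ge0.
Qed.

Lemma deltankE beta n j :
  deltank beta n j = 2 `^ j%:~R * n%:R `^ (- (1 / (4 - 2 * beta))) :> R.
Proof. by rewrite /deltank powR_intmul. Qed.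

Lemma deltank_gt0 beta n j : (0 < n)%N -> 0 < deltank beta n j :> R.
Proof. by move=> n0; rewrite deltankE mulr_gt0// powR_gt0// ltr0n. Qed.

Lemma deltank_pred beta n j : deltank beta n j = 2 * deltank beta n (j - 1) :> R.
Proof.
rewrite !deltankE intrB (_ : 1%:~R = 1)// powRD ?two0 ?implybT// [2 `^ (- 1)]powRN powRr1//.
by field.
Qed.

Let powRE (x y : R) : 0 < x -> x `^ y = expR (y * ln x).
Proof. by move=> x0; rewrite /powR gt_eqF. Qed.

(** Here the rate is used: the powers of [n] have exponents (2 - beta)/(4 - 2 beta) and -1/2, which
    cancel. The 4 is the squared ratio of the outer to the inner radius. *)
Lemma shell_ratio beta n j : 0 < beta <= 1 -> (0 < n)%N ->
  deltank beta n j `^ beta / Num.sqrt n%:R / deltank beta n (j - 1) ^+ 2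
  = 4 * 2 `^ (j%:~R * (beta - 2)) :> R.
Proof.
move=> /andP[beta0 beta1] n0; have n0' : 0 < n%:R :> R by rewrite ltr0n.
have d42 : 4 - 2 * beta != 0 by apply: lt0r_neq0; lra.
have -> : deltank beta n (j - 1) = deltank beta n j / 2.
  by rewrite (deltank_pred beta n j) mulrAC divff ?mul1r.
rewrite deltankE -powR12_sqrt ?ltW// !(powRE _ n0') !(powRE _ (ltr0Sn R 1)) -expRD.
rewrite (powRE _ (expR_gt0 _)) expRK; set u := _ + _.
rewrite expr_div_n -expRM_natl invf_div -!mulrA -!expRN.
rewrite (_ : _ * (_ * ln 2) = beta * u + (- (2^-1 * ln n%:R)) + (- (2 * u))); last first.
  by rewrite /u; field.
by rewrite !expRD; ring.
Qed.

(** The origin of the square root in [P1eps]: for small [eps] there are shells with 2^j < 1, where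
    the maximum is 1 and only sqrt(2)^j >= sqrt(min(eps, 2)) is available. *)
Lemma max_sqrt2_expz_le eps j : 0 < eps -> eps < 2 ^ j ->
  Num.max 1 (Num.sqrt 2 ^ j) <= Num.sqrt 2 ^ j * Num.sqrt (2 / Num.min eps 2).
Proof.
move=> eps0; rewrite sqrt2_expz -powR_intmul// => eps_lt.
set m := Num.min _ _; have m0 : 0 < m by rewrite lt_min eps0 ltr0n.
have sm : Num.sqrt m <= 2 `^ (j%:~R / 2).
  rewrite powRrM powR12_sqrt ?(ltW (pow2 _))// ler_sqrt ?ltW//.
  by rewrite (le_lt_trans _ eps_lt)// ge_min lexx.
have ge1 : 1 <= Num.sqrt (2 / m).
  rewrite -[leLHS]sqrtr1 ler_sqrt ?divr_ge0 ?(ltW m0)// ler_pdivlMr// mul1r.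
  by rewrite ge_min lexx orbT.
have sm0 : 0 < Num.sqrt m by rewrite sqrtr_gt0.
have s2 : 1 <= Num.sqrt 2 :> R by rewrite -[leLHS]sqrtr1 ler_sqrt// ler1n.
rewrite ge_max; apply/andP; split; last by rewrite ler_peMr// ltW.
rewrite sqrtrM// sqrtrV ?(ltW m0)// mulrA ler_pdivlMr// mul1r.
by rewrite (le_trans sm)// ler_peMr// ltW.
Qed.

(** The exponents j/2 and j (beta - 2) add up to -j (3/2 - beta). The initial index is absorbed by
    [eps < 2 ^ (Keps eps + 1)], which is why a power of [eps] appears. *)
Lemma shell_term_le beta eps n (i : nat) j : j = Keps eps + 1 + i%:Z -> 0 < beta <= 1 -> 0 < eps -> (0 < n)%N ->
  Num.max 1 (Num.sqrt 2 ^ j) *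
    (deltank beta n j `^ beta / Num.sqrt n%:R / deltank beta n (j - 1) ^+ 2)
  <= 4 * eps `^ (- (3 / 2 - beta)) * Num.sqrt (2 / Num.min eps 2)
     * (2 `^ (- (3 / 2 - beta))) ^+ i.
Proof.
move=> jE beta_range eps0 n0; rewrite shell_ratio//; move/andP: beta_range => [beta0 beta1].
have eps_lt := Keps_gt eps0.
have eps_ltj : eps < 2 ^ j.
  rewrite (lt_le_trans eps_lt)// jE [leRHS]expfzDr// ler_peMr ?exprz_ge0//.
  by rewrite -exprnP exprn_ege1// ler1n.
rewrite (le_trans (ler_wpM2r _ (max_sqrt2_expz_le eps0 eps_ltj)))//.
rewrite sqrt2_expz; set s := 3 / 2 - beta; set F := Num.sqrt (_ / _).
have -> : 2 `^ (j%:~R / 2) * F * (4 * 2 `^ (j%:~R * (beta - 2)))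
   = 4 * F * 2 `^ (- (j%:~R * s)).
  rewrite (_ : - (j%:~R * s) = j%:~R / 2 + j%:~R * (beta - 2)); last by rewrite /s; field.
  by rewrite [X in _ = _ * X]powRD ?two0 ?implybT//; ring.
have -> : 2 `^ (- (j%:~R * s)) = 2 `^ (- ((Keps eps + 1)%:~R * s)) * (2 `^ (- s)) ^+ i.
  rewrite -powR_mulrn ?powR_ge0// -powRrM -[RHS]powRD ?two0 ?implybT// jE intrD.
  by congr (_ `^ _); rewrite -[i%:~R]/(i%:R); ring.
rewrite [X in _ <= X * _](_ : _ = 4 * F * eps `^ (- s)); last by ring.
rewrite -!mulrA ler_wpM2l// ler_wpM2l ?sqrtr_ge0// ler_wpM2r ?exprn_ge0 ?powR_ge0//.
have s0 : 0 <= s by rewrite /s; lra.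
have {}eps_lt := ltW eps_lt; clear jE eps_ltj.
move: (Keps eps + 1) eps_lt => k eps_le.
rewrite !powRN lef_pV2 ?posrE ?powR_gt0// powRrM powR_intmul//.
by apply: (ge0_ler_powR s0); rewrite ?nnegrE ?exprz_ge0 ?(ltW eps0).
Qed.

Lemma nneseries_geometric_le (c z : R) : 0 <= c -> 0 < z < 1 ->
  (\sum_(0 <= i <oo) (c * z ^+ i)%:E <= (c / (1 - z))%:E)%E.
Proof.
move=> c0 /andP[z0 z1]; have z0' := ltW z0.
apply: lime_le.
  by apply: is_cvg_nneseries => i _ _; rewrite lee_fin mulr_ge0// exprn_ge0.
near=> N; rewrite sumEFin lee_fin.
have := @geometric_le_lim R N c z c0 z0; rewrite ger0_norm// => /(_ z1).
by rewrite /series/=.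
Unshelve. all: by end_near. Qed.

(** The claim reduces to 4 <= 10 (2^s - 1), that is 2^s >= 7/5, and sqrt 2 >= 7/5. This explains the
    10 in [P1eps]. *)
Lemma geometric_const_le (s eps : R) : 2^-1 <= s -> 0 < eps ->
  4 * eps `^ (- s) / (1 - 2 `^ (- s)) <= 10 * (2 / eps) `^ s.
Proof.
move=> s_ge eps0.
have s2 : Num.sqrt 2 <= 2 `^ s :> R.
  by rewrite -powR12_sqrt//; apply: ler_powR => //; rewrite ler1n.
have s2' : 7 / 5 <= Num.sqrt 2 :> R.
  by rewrite -[leLHS]ger0_norm// -sqrtr_sqr ler_sqrt//; lra.
have e0 := powR_gt0 (- s) eps0.
have -> : (2 / eps) `^ s = 2 `^ s * eps `^ (- s).
  by rewrite powRM ?invr_ge0 ?(ltW eps0)// -[eps^-1]powR_inv1 ?(ltW eps0)// -powRrM mulN1r.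
rewrite [2 `^ (- s)]powRN.
have p0 : 0 < 2 `^ s :> R by exact: pow2.
have p1 : 0 < 1 - (2 `^ s)^-1 :> R by rewrite subr_gt0 invf_lt1//; lra.
rewrite ler_pdivrMr// [leRHS](_ : _ = 10 * (2 `^ s - 1) * eps `^ (- s)); last first.
  by field; exact: lt0r_neq0.
by rewrite ler_wpM2r ?(ltW e0)//; lra.
Qed.

End shells.

(** * The Euclidean norm and diameter *)

Section euclidean.
Context (R : realType) (m : nat).

Lemma continuous_enormB (y : 'rV[R]_m) : continuous (fun x : 'rV[R]_m => enorm (x - y)).
Proof.
move=> x; apply: (@continuous_comp _ _ _
  (fun x : 'rV[R]_m => \sum_(i < m) (x - y) 0 i ^+ 2) (@Num.sqrt R)); last first.
  exact: sqrt_continuous.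
apply: cvg_big => [||i _]; [exact: add_continuous|exact: nbhs_filter|].
have cvg_i : (u - y) 0 i @[u --> x] --> (x - y) 0 i.
  have := cvgB (@coord_continuous R 1 m 0 i x) (@cvg_cst R (y 0 i) _ (nbhs x) _).
  rewrite (_ : (fun u : 'rV[R]_m => u 0 i) - cst (y 0 i) = fun u : 'rV[R]_m => (u - y) 0 i).
    by move=> h; rewrite mxE mxE; exact: h.
  by apply/funext => u; rewrite !mxE.
have := cvg_comp _ _ cvg_i (@exprn_continuous R 2 _); exact.
Qed.

Lemma measurable_enormB_gt (y : 'rV[R]_m) (c e : R) :
  measurable ([set x | e < c * enorm (x - y)] : set (brV R m)).
Proof.
apply: sub_sigma_algebra.
rewrite (_ : mkset _ = (fun x => c * enorm (x - y)) @^-1` [set t | e < t])//.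
apply: open_comp; last exact: open_gt.
move=> x _; have := cvgM (@cvg_cst R c _ (nbhs x) _) (@continuous_enormB y x); exact.
Qed.

(** A real [sup] is an upper bound only of a bounded set. Compactness bounds the norm on [A], and |u
    - v|^2 <= 2 |u|^2 + 2 |v|^2 bounds the distances. *)
Lemma enormB_le_ediam (A : set 'rV[R]_m) x y : compact A -> A x -> A y ->
  enorm (x - y) <= ediam A.
Proof.
move=> Ac Ax Ay; apply: ub_le_sup; last by exists x => //; exists y.
have : compact ((fun x => enorm (x - 0)) @` A).
  by apply: continuous_compact => //; apply: continuous_subspaceT; exact: continuous_enormB.
move=> /compact_bounded[M [_ /(_ (M + 1))]]; rewrite ltrDl ltr01 => /(_ isT) bnd.
have M0 : 0 <= M + 1.
  by have := bnd _ (imageP _ Ax); apply: le_trans.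
have enorm_le u : A u -> enorm u <= M + 1.
  move=> Au; have := bnd (enorm (u - 0)) (imageP _ Au); rewrite subr0.
  by rewrite /= ger0_norm// sqrtr_ge0.
exists (Num.sqrt (4 * (M + 1) ^+ 2)) => _ [u Au] [v Av] <-.
rewrite ler_sqrt ?mulr_ge0 ?sqr_ge0//.
have sq w : A w -> \sum_(i < m) w 0 i ^+ 2 <= (M + 1) ^+ 2.
  move=> Aw; have s0 : 0 <= \sum_(i < m) w 0 i ^+ 2 by apply: sumr_ge0 => i _; exact: sqr_ge0.
  by rewrite -[leLHS]sqr_sqrtr// lerXn2r ?nnegrE ?sqrtr_ge0// ?enorm_le.
apply: (@le_trans _ _ (2 * (\sum_(i < m) u 0 i ^+ 2) + 2 * (\sum_(i < m) v 0 i ^+ 2))).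
  rewrite !mulr_sumr -big_split/= ler_sum// => i _; rewrite !mxE.
  have := sqr_ge0 (u 0 i + v 0 i); nra.
by have := sq _ Au; have := sq _ Av; lra.
Qed.

End euclidean.

(** * Comparison of radii and constants on a shell *)

Section radii.
Context (R : realType).
Implicit Types (a b beta eps delta : R).

(** From [eps < 2 ^ j], the relation between [a], [b] and [eps] gives a <= b 2^((j-1)(beta + 1/2)).
    The part with exponent (j-1) beta is at most delta^beta sqrt n, because beta/(4 - 2 beta) <= 1/2
    leaves a nonnegative power of [n]; the part with (j-1)/2 is below sqrt(2)^j. *)
Lemma global_radius_le a b beta eps delta n (j : int) :
  0 < a -> 0 < b -> 0 < eps -> 0 < beta <= 1 -> (0 < n)%N ->
  a * 2 `^ (beta + 1 / 2) <= b * eps `^ (beta + 1 / 2) ->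
  eps < 2 ^ j -> deltank beta n (j - 1) <= delta ->
  a / Num.sqrt n%:R <= Num.sqrt 2 ^ j * b * delta `^ beta.
Proof.
move=> a0 b0 eps0 /andP[beta0 beta1] n0 ab eps_lt r_le.
have two0 : 2 != 0 :> R by exact: lt0r_neq0.
have n_ge1 : 1 <= n%:R :> R by rewrite ler1n.
have r0 := deltank_gt0 beta (j - 1) n0 : 0 < _ :> R.
have bn : beta * (1 / (4 - 2 * beta)) <= 1 / 2.
  by rewrite mulrA mulr1 ler_pdivrMr; lra.
rewrite ler_pdivrMr ?sqrtr_gt0 ?ltr0n//.
have a_le : a * 2 `^ (beta + 1 / 2) <= b * 2 `^ (j%:~R * (beta + 1 / 2)).
  rewrite (le_trans ab)// ler_wpM2l ?(ltW b0)// powRrM powR_intmul//.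
  have s0 : 0 <= beta + 1 / 2 by lra.
  by apply: (ge0_ler_powR s0); rewrite ?nnegrE ?exprz_ge0 ?(ltW eps0) ?(ltW eps_lt).
have {}a_le : a <= b * 2 `^ ((j%:~R - 1) * (beta + 1 / 2)).
  rewrite mulrBl [1 * (_ + _)]mul1r powRD ?two0 ?implybT// [2 `^ (- _)]powRN mulrA.
  by rewrite ler_pdivlMr// powR_gt0.
rewrite (le_trans a_le)// -!mulrA [leRHS]mulrCA ler_wpM2l ?(ltW b0)//.
have r_pow : 2 `^ ((j%:~R - 1) * beta) <= delta `^ beta * Num.sqrt n%:R.
  apply: (@le_trans _ _ (deltank beta n (j - 1) `^ beta * Num.sqrt n%:R)); last first.
    rewrite ler_wpM2r ?sqrtr_ge0//.
    apply: (ge0_ler_powR (ltW beta0)); rewrite ?nnegrE ?(ltW r0)//.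
    exact: le_trans (ltW r0) r_le.
  rewrite deltankE powRM ?powR_ge0// -!powRrM -mulrA intrB ler_peMr ?powR_ge0//.
  rewrite -powR12_sqrt ?(le_trans _ n_ge1)// -powRD; last by rewrite (gt_eqF (lt_le_trans ltr01 n_ge1)) implybT.
  rewrite -[leLHS](powRr0 n%:R); apply: ler_powR => //.
  by move: (1 / (4 - 2 * beta)) bn => e; rewrite mulNr mulrC; lra.
rewrite mulrDr powRD ?two0 ?implybT// mulrC ler_pM ?powR_ge0// sqrt2_expz.
by apply: ler_powR; [rewrite ler1n|lra].
Qed.

(** Writes the linear term of the drift as a multiple of delta^beta; the other factor is the power
    of the diameter in [Mab]. *)
Lemma powR_split_le beta delta D : 0 < beta <= 1 -> 0 < delta -> delta <= D ->
  delta <= delta `^ beta * D `^ (1 - beta).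
Proof.
move=> /andP[beta0 beta1] delta0 le_D.
rewrite -{1}[delta]powRr1 ?(ltW delta0)// -{1}(subrKC beta 1) powRD; last first.
  by rewrite (gt_eqF delta0) implybT.
rewrite ler_wpM2l ?powR_ge0//.
have b0 : 0 <= 1 - beta by lra.
by apply: (ge0_ler_powR b0); rewrite ?nnegrE ?(ltW delta0) ?(le_trans (ltW delta0)).
Qed.

(* [dl] plays the role of [delta `^ beta]. *)
Lemma shell_bound_le (K a b beta delta dl D M1lo M1up nL2 EL2 q S p : R) :
  0 <= K -> 0 < a -> 0 < b -> 0 < M1lo -> 0 < M1up -> 0 <= nL2 -> 0 <= EL2 ->
  0 <= q -> 0 < S -> 0 <= p -> 0 <= dl -> delta <= dl * D `^ (1 - beta) ->
  2 * (2 * (Num.sqrt 2 * (16 * M1up + 5))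
         * (M1lo * dl + (M1lo + q * b) * dl * nL2) / S)
    + p * (K * (a / S) * (delta + M1lo * dl) + q * b * dl / S * EL2)
  <= (Mbar M1lo nL2 b * etahat M1up + p * Mab K a b beta D M1lo EL2)
     * (Num.max 1 q * (dl / S)).
Proof.
move=> K0 a0 b0 M1lo0 M1up0 nL20 EL20 q0 S0 p0 dl0 delta_le.
set mx := Num.max 1 q; set B := D `^ (1 - beta).
have B0 : 0 <= B by exact: powR_ge0.
have mx1 : 1 <= mx by rewrite le_max lexx.
have mxq : q <= mx by rewrite le_max lexx orbT.
have mx0 : 0 <= mx by lra.
have S1 : 0 <= S^-1 by rewrite invr_ge0 ltW.
rewrite [leRHS]mulrDl lerD//.
  rewrite (_ : 2 * _ = 4 * (Num.sqrt 2 * (16 * M1up + 5))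
      * ((M1lo * (1 + nL2) + q * (b * nL2)) * (dl * S^-1))); last by ring.
  rewrite (_ : _ * _ * _ = etahat M1up * (Mbar M1lo nL2 b * mx * (dl * S^-1))); last by ring.
  apply: ler_pM.
  - by rewrite !mulr_ge0 ?sqrtr_ge0//; lra.
  - by rewrite !mulr_ge0// addr_ge0 ?mulr_ge0 ?addr_ge0// ltW.
  (* The chaining constant fits with room to spare: 4 (16 M + 5) = 64 M + 20, against 64 M +
     44.8. *)
  - rewrite (_ : etahat _ = Num.sqrt 2 * (64 * (M1up + 7 / 10))).
      by rewrite mulrCA ler_wpM2l ?sqrtr_ge0//; lra.
    by rewrite /etahat -mulrA mulrCA.
  rewrite ler_wpM2r ?mulr_ge0// /Mbar [leRHS]mulrDl lerD//.
    by rewrite ler_peMr// mulr_ge0 ?addr_ge0// ltW.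
  by rewrite mulrC ler_wpM2l// mulr_ge0// ltW.
rewrite -[leRHS]mulrA ler_wpM2l// /Mab -/B [leRHS]mulrDl lerD//.
  rewrite (_ : K * (a / S) * _ = K * a * (delta + M1lo * dl) * S^-1); last by ring.
  rewrite (_ : _ * (mx * _) = K * a * ((B + M1lo) * dl) * S^-1 * mx); last by ring.
  apply: (@le_trans _ _ (K * a * ((B + M1lo) * dl) * S^-1)); last first.
    by rewrite ler_peMr// !mulr_ge0// ?addr_ge0// ltW.
  rewrite ler_wpM2r// ler_wpM2l ?mulr_ge0 ?(ltW a0)//.
  by rewrite [leRHS]mulrDl lerD2r mulrC.
rewrite (_ : q * b * dl / S * EL2 = q * (b * EL2 * (dl / S))); last by ring.
rewrite [leRHS]mulrCA ler_wpM2r// !mulr_ge0// ltW//.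
Qed.

End radii.

(** * The centered process of the plug-in objective *)

Section erm.
Context (R : realType) (disp : measure_display) (Omega : measurableType disp)
  (P : probability Omega R) (d m : nat)
  (Z : nat -> {RV P >-> brV R d}) (PZ : probability (brV R d) R)
  (Theta : set 'rV[R]_m)
  (G : 'rV[R]_m -> brV R d -> R) (H : 'rV[R]_m -> R -> brV R d -> R)
  (xiG L1 L2 : brV R d -> R) (thetas : 'rV[R]_m).
Hypothesis P_complete : measure_is_complete P.
Hypothesis Z_iid : iid Z PZ.
Hypothesis G_int : forall theta, Theta theta ->
  PZ.-integrable [set: _] (EFin \o G theta).
Hypothesis xiG_L2 : xiG \in Lfun PZ 2%:E.
Hypothesis xiG_bound : forall theta z, Theta theta -> `|G theta z| <= xiG z.
Hypothesis H_meas : forall theta t, Theta theta ->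
  measurable_fun [set: _] (H theta t).
Hypothesis H_int : forall theta, Theta theta ->
  PZ.-integrable [set: _] (EFin \o H theta (psibar Z G theta)).
Hypothesis L1_ge0 : forall z, 0 <= L1 z.
Hypothesis L2_ge0 : forall z, 0 <= L2 z.
Hypothesis L1_L2 : L1 \in Lfun PZ 2%:E.
Hypothesis L2_L2 : L2 \in Lfun PZ 2%:E.
Hypothesis H_lip : forall theta vartheta t s z, Theta theta -> Theta vartheta ->
  `|H theta t z - H vartheta s z| ^+ 2
    <= L1 z ^+ 2 * `|G theta z - G vartheta z| ^+ 2
       + L2 z ^+ 2 * `|t - s| ^+ 2.
Hypothesis thetas_in : Theta thetas.
Hypothesis separability : forall delta : R, 0 < delta ->
  exists (C : set 'rV[R]_m) (N : forall n, set (n.-tuple (brV R d))),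
    [/\ countable C, C `<=` Unbhd Theta thetas delta,
        forall n, (0 < n)%N -> (prod_power PZ n).-negligible (N n) &
        forall theta n (z : n.-tuple (brV R d)),
          Unbhd Theta thetas delta theta -> (0 < n)%N -> ~ N n z ->
          ereal_inf
            [set ('E_P[(fun w => `|G theta (Z 0%N w) - G vartheta (Z 0%N w)|)%R]
              + (\big[Num.max/0]_(j < n)
                   `|G theta (tnth z j) - G vartheta (tnth z j)|)%R%:E)%E
            | vartheta in C] = 0%E].

Let E (f : brV R d -> R) : R := \int[PZ]_x f x.

Let mG theta : Theta theta -> measurable_fun setT (G theta).
Proof. by move=> Ttheta; exact/measurable_EFinP/measurable_int/G_int. Qed.

Let mL1 : measurable_fun setT L1.
Proof. by have := sub_Lfun_mfun L1_L2; rewrite inE. Qed.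

Let mL2 : measurable_fun setT L2.
Proof. by have := sub_Lfun_mfun L2_L2; rewrite inE. Qed.

Let mxiG : measurable_fun setT xiG.
Proof. by have := sub_Lfun_mfun xiG_L2; rewrite inE. Qed.

Let PZ_fin : PZ setT \is a fin_num.
Proof. by rewrite probability_setT. Qed.

Let L2_int : PZ.-integrable setT (EFin \o L2).
Proof. exact/Lfun1_integrable/(Lfun_subset12 PZ_fin). Qed.

Let L1xiG_int : PZ.-integrable setT (EFin \o (fun x => L1 x * (2 * xiG x))).
Proof.
have := (Lfun1_integrable _ _).1 (Lfun2_mul_Lfun1 L1_L2 xiG_L2).
move=> /(integrableZl measurableT 2); congr (_.-integrable _ _).
by apply/funext => x /=; rewrite -EFinM; congr _%:E; ring.
Qed.

Let psi theta := psibar Z G theta.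

Lemma psibarE theta : Theta theta -> psibar Z G theta = \int[PZ]_x G theta x.
Proof. by move=> /G_int; exact: (meanE Z_iid). Qed.

Lemma H_dist theta vartheta t s z : Theta theta -> Theta vartheta ->
  `|H theta t z - H vartheta s z|
  <= L1 z * `|G theta z - G vartheta z| + L2 z * `|t - s|.
Proof.
move=> Tt Tv; rewrite -ler_sqr ?nnegrE ?addr_ge0 ?mulr_ge0//.
rewrite (le_trans (H_lip _ _ _ Tt Tv))// sqrrD !exprMn lerD2r lerDl mulrn_wge0//.
by rewrite !mulr_ge0.
Qed.

(** Condition (iii) covers only [t = psibar theta]; the Lipschitz bound in [t] with the integrable
    [L2] reaches every other [t]. *)
Lemma H_integrable theta t : Theta theta ->
  PZ.-integrable setT (EFin \o H theta t).
Proof.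
move=> Tt; have := integrableD measurableT
  (integrable_abse (H_int Tt)) (integrableZl measurableT `|t - psibar Z G theta| L2_int).
apply: le_integrable => //; first by apply/measurable_EFinP; exact: H_meas.
move=> z _ /=; rewrite lee_fin [leRHS]ger0_norm ?addr_ge0 ?mulr_ge0//.
rewrite -[H theta t z](subrK (H theta (psibar Z G theta) z)).
rewrite (le_trans (ler_normD _ _))// [leRHS]addrC lerD2r.
have := H_dist t (psibar Z G theta) z Tt Tt.
by rewrite subrr normr0 mulr0 add0r mulrC.
Qed.

Lemma mean_H_lip theta t s : Theta theta ->
  `|mean Z (H theta t) - mean Z (H theta s)| <= mean Z L2 * `|t - s|.
Proof.
move=> Tt; rewrite !(meanE Z_iid)//; do ?exact: H_integrable.
have ti := H_integrable t Tt; have si := H_integrable s Tt.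
rewrite -RintegralB// mulrC -RintegralZl//.
rewrite (le_trans (le_normr_Rintegral _ (integrableB measurableT ti si)))//.
apply: le_Rintegral => //.
- exact: integrable_abse (integrableB measurableT ti si).
- exact: (integrableZl measurableT `|t - s| L2_int).
move=> z _; have := H_dist t s z Tt Tt.
by rewrite subrr normr0 mulr0 add0r mulrC.
Qed.

Let close n (C : set 'rV[R]_m) (w : Omega) theta := forall e : R, 0 < e ->
  exists2 vartheta, C vartheta &
    (\int[PZ]_x `|G theta x - G vartheta x|%:E <= e%:E)%E /\
    forall j : 'I_n, `|G theta (Z j w) - G vartheta (Z j w)| <= e.

(** A vanishing infimum of a sum of nonnegative terms gives one point at which both terms are small.
    The exceptional set is pulled back to [Omega] through the law of the sample. *)
Let dense_exists (delta : R) n : 0 < delta -> (0 < n)%N ->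
  exists (C : set 'rV[R]_m) (N : set Omega),
    [/\ countable C, C `<=` Unbhd Theta thetas delta, P.-negligible N &
      forall w theta, ~ N w -> Unbhd Theta thetas delta theta -> close n C w theta].
Proof.
move=> delta0 n0; have [C [N [Ccount CU Nnull dense]]] := separability delta0.
exists C, (sample Z n @^-1` N n); split => //.
  by apply: (sample_negligible Z_iid); exact: Nnull.
move=> w theta Nw Ut e e0.
have := dense theta n (sample Z n w) Ut n0 Nw.
set S := [set _ | _ in C] => S0.
have : (ereal_inf S < e%:E)%E by rewrite S0 lte_fin.
move=> /ereal_inf_lt[_ [vartheta Cv <-]].
set A := (\big[Num.max/0]_(j < n) _); set B := 'E_P[_]%E.
have A0 : 0 <= A by exact: bigmax_ge_id.
have B0 : (0 <= B)%E by apply: expectation_ge0 => ?.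
move=> /ltW AB; exists vartheta => //; split.
  apply: le_trans AB; rewrite (_ : (\int[PZ]_x _)%E = B) ?leeDl ?lee_fin//.
  rewrite /B unlock; apply/esym/(ge0_integral_iid Z_iid 0%N (g := fun x => `|G theta x - G vartheta x|%:E)) => //.
  apply/measurable_EFinP; apply: measurableT_comp => //.
  by apply: measurable_funB; apply: mG; [case: Ut|have [] := CU _ Cv].
move=> j; rewrite -lee_fin; apply: le_trans AB; rewrite (@le_trans _ _ A%:E)//.
  by rewrite lee_fin; have := le_bigmax 0 (fun j => `|G theta (tnth (sample Z n w) j) - G vartheta (tnth (sample Z n w) j)|) j; rewrite tnth_mktuple.
by rewrite leeDr.
Qed.

Let G_diff_int theta vartheta : Theta theta -> Theta vartheta ->
  PZ.-integrable setT (EFin \o (fun z => G theta z - G vartheta z)).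
Proof. by move=> Tt Tv; exact: (integrableB measurableT (G_int Tt) (G_int Tv)). Qed.

Lemma measurable_event_local beta n (delta b : R) : 0 < delta -> (0 < n)%N ->
  measurable (event_local Z Theta G thetas beta n delta b).
Proof.
move=> delta0 n0; have [C [N [Ccount CU Nnull dense]]] := dense_exists delta0 n0.
apply: (measurable_ball_sup
    (D := fun theta => empirical_dev Z n (fun z => G theta z - G thetas z))
    _ P_complete Nnull Ccount CU) => [theta [Tt _]|w theta e Nw Ut e0].
  by apply: (measurable_empirical_dev Z_iid); exact: G_diff_int.
have e2 : 0 < e / 2 by rewrite divr_gt0.
have [vartheta Cv [int_le pt_le]] := dense w theta Nw Ut _ e2.
have Tt := Ut.1; have Tv := (CU _ Cv).1.
exists vartheta => //; rewrite [e]splitr.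
apply: (empirical_dev_dist Z_iid) => //; do ?exact: G_diff_int.
  by move=> j; rewrite opprB addrA subrK pt_le.
rewrite -RintegralB//; do ?exact: G_diff_int.
apply: normr_Rintegral_le.
  exact: (integrableB measurableT (G_diff_int Tt thetas_in) (G_diff_int Tv thetas_in)).
by under eq_integral do rewrite opprB addrA subrK.
Qed.

(** Condition (vi) speaks of neighbourhoods of [thetas] only; the one of radius [ediam Theta] is all
    of [Theta]. *)
Lemma measurable_event_global n a : (0 < n)%N ->
  (forall theta, Theta theta -> enorm (theta - thetas) <= ediam Theta) ->
  0 < ediam Theta -> measurable (event_global Z Theta G n a).
Proof.
move=> n0 Theta_le diam0.
have [C [N [Ccount CU Nnull dense]]] := dense_exists diam0 n0.
have CT : C `<=` Theta by move=> t /CU[].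
apply: (measurable_ball_sup (D := fun theta => empirical_dev Z n (G theta))
    _ P_complete Nnull Ccount CT) => [theta Tt|w theta e Nw Tt e0].
  by apply: (measurable_empirical_dev Z_iid); exact: G_int.
have e2 : 0 < e / 2 by rewrite divr_gt0.
have [vartheta Cv [int_le pt_le]] := dense w theta Nw (conj Tt (Theta_le _ Tt)) _ e2.
have Tv := CT _ Cv.
exists vartheta => //; rewrite [e]splitr.
apply: (empirical_dev_dist Z_iid) => //; do ?exact: G_int.
rewrite -RintegralB//; do ?exact: G_int.
by apply: normr_Rintegral_le => //; exact: G_diff_int.
Qed.

(** Subtracting a fixed function makes the class vanish at one index, so that the Lipschitz bound
    provides an envelope that shrinks with the shell. *)
Definition centered_H (i : 'rV[R]_m * R) (z : brV R d) : R :=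
  H i.1 i.2 z - H thetas (psibar Z G thetas) z.

Lemma centered_H_integrable i : Theta i.1 ->
  PZ.-integrable setT (EFin \o centered_H i).
Proof.
move=> Ti; exact: (integrableB measurableT (H_integrable i.2 Ti) (H_int thetas_in)).
Qed.

(** Density in [theta] extends to pairs by adjoining rational offsets in [t]. The exceptional set
    remains the one for [theta] alone, since [H] is Lipschitz in [t] at every sample point. *)
Lemma centered_H_dense (delta : R) n (rho : R) : 0 < delta -> (0 < n)%N -> 0 < rho ->
  exists (u : nat -> 'rV[R]_m * R) (N : set Omega),
  [/\ P.-negligible N,
      forall k, Unbhd Theta thetas delta (u k).1 /\
                `|(u k).2 - psibar Z G thetas| <= rho &
      forall w theta t (e : R), ~ N w -> Unbhd Theta thetas delta theta ->
        `|t - psibar Z G thetas| <= rho -> 0 < e ->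
        exists k, `|empirical_dev Z n (centered_H (theta, t)) w
                    - empirical_dev Z n (centered_H (u k)) w| <= e].
Proof.
move=> delta0 n0 rho0; have [C [N [Ccount CU Nnull dense]]] := dense_exists delta0 n0.
have Uthetas : Unbhd Theta thetas delta thetas.
  split=> //; rewrite subrr /enorm big1 ?sqrtr0 ?ltW// => i _.
  by rewrite mxE expr0n.
have [u1 [u1U Cu1]] : exists u1 : nat -> 'rV[R]_m,
    (forall i, Unbhd Theta thetas delta (u1 i)) /\ forall a, C a -> exists i, u1 i = a.
  have [C0|/set0P[a Ca]] := eqVneq C set0; first by exists (fun=> thetas); rewrite C0.
  by have [u1 [u1C Cu1]] := countable_enum Ccount Ca; exists u1; split => // i; exact: CU.
(* A rational close to an admissible offset may leave the interval; clamping brings it back without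
   increasing distances. *)
pose clamp (x : R) := Num.max (- rho) (Num.min rho x).
have clampE x : `|x| <= rho -> clamp x = x.
  by rewrite ler_norml => /andP[x1 x2]; rewrite /clamp (min_r x2) (max_r x1).
have clamp_le x : `|clamp x| <= rho.
  by rewrite ler_norml /clamp le_max lexx/= ge_max ge_min lexx/= andbT; lra.
have clamp_lip x y : `|clamp x - clamp y| <= `|x - y|.
  have h1 (u v : R) : u - v <= `|u - v| /\ v - u <= `|u - v|.
    by rewrite ler_norm distrC ler_norm.
  rewrite /clamp; apply: (@le_trans _ _ `|Num.min rho x - Num.min rho y|).
    move: (Num.min rho x) (Num.min rho y) => u v; have [? ?] := h1 u v.
    case: (leP (- rho) u) => ?; case: (leP (- rho) v) => ?;
    by rewrite ler_norml; apply/andP; split; lra.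
  have [? ?] := h1 x y.
  case: (leP rho x) => ?; case: (leP rho y) => ?;
  by rewrite ler_norml; apply/andP; split; lra.
(* Integers that encode no pair are sent to the pair of zeros, which is a legitimate index. *)
pose dec (k : nat) : nat * rat := odflt (0%N, 0) (choice.unpickle k).
exists (fun k => (u1 (dec k).1, psibar Z G thetas + clamp (ratr (dec k).2))), N.
split=> //.
  move=> k; split; first exact: u1U.
  by rewrite /= addrC addKr.
move=> w theta t e Nw Ut t_le e0.
(* [S] dominates every Lipschitz coefficient met below, at the sample points and in the mean; the 1
   makes it positive. *)
pose S := 1 + \sum_(j < n) L1 (Z j w) + \sum_(j < n) L2 (Z j w) + \int[PZ]_x L2 x.
have sL1 : 0 <= \sum_(j < n) L1 (Z j w) by exact: sumr_ge0.
have sL2 : 0 <= \sum_(j < n) L2 (Z j w) by exact: sumr_ge0.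
have EL2 : 0 <= \int[PZ]_x L2 x by exact: Rintegral_ge0.
have S0 : 0 < S by rewrite /S; lra.
have e4 : 0 < e / 4 by rewrite divr_gt0.
have mxi2 : measurable_fun setT (fun x => 2 * xiG x) by exact: measurable_funM.
(* [2 * xiG] dominates all increments of [G], and its product with [L1] is integrable because both
   are square integrable. *)
have [eta eta0 small] := integral_weight_small mL1 L1_ge0 mxi2 L1xiG_int e4.
pose e' := Num.min eta (e / 4 / S).
have e'0 : 0 < e' by rewrite lt_min eta0 divr_gt0.
have [vartheta Cv [int_le pt_le]] := dense w theta Nw Ut _ e'0.
have Tt := Ut.1; have Tv := (CU _ Cv).1.
have [i ui] := Cu1 vartheta Cv.
have [q q_in] : exists q : rat, ratr q \in `](t - psibar Z G thetas - e'), (t - psibar Z G thetas + e')[.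
  by apply: rat_in_itvoo; lra.
exists (choice.pickle (i, q)); rewrite /dec choice.pickleK/= ui.
set t' := psibar Z G thetas + clamp (ratr q).
have tt' : `|t - t'| <= e'.
  rewrite /t' opprD addrA -{1}(clampE _ t_le) (le_trans (clamp_lip _ _))//.
  by move: q_in; rewrite in_itv/= ler_norml => /andP[? ?]; apply/andP; split; lra.
have e'S : e' * S <= e / 4 by rewrite -ler_pdivlMr// ge_min lexx orbT.
rewrite [e]splitr; apply: (empirical_dev_dist Z_iid) => //; do ?exact: centered_H_integrable.
  move=> j; rewrite /centered_H/= opprB addrA subrK.
  rewrite (le_trans (H_dist _ _ _ Tt Tv))//.
  have l1 : L1 (Z j w) <= \sum_(j < n) L1 (Z j w).
    by rewrite (bigD1 j)//= lerDl sumr_ge0.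
  have l2 : L2 (Z j w) <= \sum_(j < n) L2 (Z j w).
    by rewrite (bigD1 j)//= lerDl sumr_ge0.
  apply: (@le_trans _ _ (S * e' + S * e')); last by lra.
  by rewrite lerD// ler_pM// /S; lra.
have hint := @centered_H_integrable (theta, t) Tt.
have hint' := @centered_H_integrable (vartheta, t') Tv.
rewrite -RintegralB//; apply: normr_Rintegral_le; first exact: (integrableB measurableT hint hint').
apply: (@le_trans _ _ (\int[PZ]_x ((L1 x * `|G theta x - G vartheta x|)%:E
   + e'%:E * (L2 x)%:E))%E).
  apply: ge0_le_integral => //.
  - by apply/measurable_EFinP; apply: measurableT_comp => //; apply: measurable_funB;
    apply: measurable_funB; exact: H_meas.
  - apply: emeasurable_funD; last by apply: measurable_funeM; exact/measurable_EFinP.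
    apply/measurable_EFinP; apply: measurable_funM => //.
    by apply: measurableT_comp => //; apply: measurable_funB; exact: mG.
  move=> x _; rewrite -EFinM -EFinD lee_fin /centered_H/= opprB addrA subrK.
  rewrite (le_trans (H_dist _ _ _ Tt Tv))// lerD2l mulrC.
  by rewrite ler_wpM2r.
have mdG : measurable_fun setT (fun x => `|G theta x - G vartheta x|).
  by apply: measurableT_comp => //; apply: measurable_funB; exact: mG.
rewrite ge0_integralD//; last 4 first.
- by move=> x _; rewrite lee_fin mulr_ge0.
- by apply/measurable_EFinP; exact: measurable_funM.
- by move=> x _; rewrite -EFinM lee_fin mulr_ge0// ltW.
- by apply: measurable_funeM; exact/measurable_EFinP.
rewrite (_ : e / 2 = e / 4 + e / 4); last by lra.
rewrite EFinD leeD//.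
  apply: small => // [x|].
    rewrite normr_ge0/= (le_trans (ler_normB _ _))//.
    have := xiG_bound x Tt; have := xiG_bound x Tv; lra.
  by rewrite (le_trans int_le)// lee_fin ge_min lexx.
rewrite ge0_integralZl//; last 3 first.
- exact/measurable_EFinP.
- by move=> x _; rewrite lee_fin.
- by rewrite lee_fin ltW.
rewrite -(fineK (integrable_fin_num measurableT L2_int)) -EFinM lee_fin.
rewrite (le_trans _ e'S)// ler_wpM2l ?(ltW e'0)//.
by rewrite /S -/(Rintegral PZ setT L2); lra.
Qed.

Lemma integral_bigmax_centered_H_le (delta rho kx M : R) (xi : brV R d -> R)
    (u : nat -> 'rV[R]_m * R) n N :
  (0 < n)%N -> 0 < delta -> 0 < rho -> 0 < kx -> 0 <= M ->
  positive_envelope (Gclass_loc Theta G thetas delta) xi ->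
  ('N[PZ]_2%:E [EFin \o (fun z => Num.max (L1 z) 1 * xi z)%R] <= kx%:E)%E ->
  (entropy_integral (Gclass_loc Theta G thetas delta) xi (1 / 8) <= M%:E)%E ->
  (forall k, Unbhd Theta thetas delta (u k).1 /\
             `|(u k).2 - psibar Z G thetas| <= rho) ->
  (\int[P]_w (\big[Num.max/0]_(i <- iota 0 N)
      `|empirical_dev Z n (centered_H (u i)) w|)%:E
   <= (2 * (Num.sqrt 2 * (16 * M + 5))
       * (kx + rho * fine 'N[PZ]_2%:E [EFin \o L2]) / Num.sqrt n%:R)%:E)%E.
Proof.
move=> n0 delta0 rho0 kx0 M0 [mxi xi0 xi_env] xi_norm entropy_le uU.
set nL2 := fine _.
have nL2_ge0 : 0 <= nL2 by exact/fine_ge0/Lnorm_ge0.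
(* The maximum with 1 keeps the weights strictly positive, as the weighted empirical measure
   requires. *)
pose W z := Num.max (L1 z) 1.
have mW : measurable_fun setT W by exact: measurable_maxr.
have W0 z : 0 < W z by rewrite lt_max ltr01 orbT.
have L1W z : L1 z <= W z by rewrite le_max lexx.
pose C2 z := (W z * xi z) ^+ 2 + (L2 z * rho) ^+ 2.
have C20 z : 0 <= C2 z by rewrite addr_ge0// sqr_ge0.
have mC2 : measurable_fun setT C2.
  by apply: measurable_funD; apply: measurable_funX; exact: measurable_funM.
have C2_int : (\int[PZ]_z (C2 z)%:E <= ((kx + rho * nL2) ^+ 2)%:E)%E.
  under eq_integral do rewrite EFinD.
  rewrite ge0_integralD//; last 4 first.
  - by move=> z _; rewrite lee_fin sqr_ge0.
  - by apply/measurable_EFinP; apply: measurable_funX; exact: measurable_funM.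
  - by move=> z _; rewrite lee_fin sqr_ge0.
  - by apply/measurable_EFinP; apply: measurable_funX; exact: measurable_funM.
  have L2fin : 'N[PZ]_2%:E [EFin \o L2]%E \is a fin_num.
    rewrite ge0_fin_numE ?Lnorm_ge0//.
    by have := sub_Lfun_finLfun L2_L2; rewrite inE.
  have -> : (\int[PZ]_z ((L2 z * rho) ^+ 2)%:E = ((rho * nL2) ^+ 2)%:E)%E.
    under eq_integral do rewrite exprMn mulrC EFinM.
    rewrite ge0_integralZl//; last 3 first.
    - by apply/measurable_EFinP; exact: measurable_funX.
    - by move=> z _; rewrite lee_fin sqr_ge0.
    - by rewrite lee_fin sqr_ge0.
    by rewrite (finite_Lnorm2_sqr L2fin) -EFinM exprMn.
  apply: (@le_trans _ _ ((kx ^+ 2)%:E + ((rho * nL2) ^+ 2)%:E)%E).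
    by rewrite leeD2r// -Lnorm2_le// ltW.
  rewrite -EFinD lee_fin sqrrD lerD2r lerDl mulrn_wge0// !mulr_ge0 ?(ltW kx0)//.
  exact: ltW.
pose c : R := Num.sqrt 2 * (16 * M + 5).
have c0 : 0 <= c by rewrite mulr_ge0 ?sqrtr_ge0//; lra.
have kk0 : 0 < kx + rho * nL2 by rewrite ltr_pwDl// mulr_ge0// ltW.
have Hint i : PZ.-integrable setT (EFin \o centered_H (u i)).
  by apply: centered_H_integrable; have [[]] := uU i.
have Hmean i : (\int[PZ]_x (centered_H (u i) x)%:E = (\int[PZ]_x centered_H (u i) x)%:E)%E.
  rewrite /Rintegral fineK//; exact: (integrable_fin_num measurableT (Hint i)).
have := integral_bigmax_empirical_le Z_iid Hint Hmean n0 mC2 C20 C2_int c0 kk0 (r := iota 0 N).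
move=> /(_ _)/wrap[z|].
  have [Uthetas uA] : Unbhd Theta thetas delta thetas /\ True.
    split=> //; split=> //; rewrite subrr /enorm big1 ?sqrtr0 ?ltW// => i _.
    by rewrite mxE expr0n.
  have z0 : (z : seq _) != [::] by rewrite -size_eq0 size_tuple -lt0n.
  have := @rad_localized_class_le _ _ R _ (Unbhd Theta thetas delta)
    (fun th x => G th x - G thetas x) xi W L2 centered_H thetas
    (psibar Z G thetas) rho M z z0 Uthetas.
  move=> /(_ _ mxi xi0 _ W0 rho0 _ _ entropy_le (map u (iota 0 N)) _)/wrap[|||||].
  - by move=> th [Tth _]; apply: measurable_funB; exact: mG.
  - by move=> th x Uth; rewrite subrr subr0; apply: (xi_env (fun z => G th z - G thetas z)); exists th.
  - by move=> x; rewrite /centered_H subrr.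
  - move=> th th' t t' x [Tth _] [Tth' _]; rewrite /centered_H/= opprB addrA subrK.
    rewrite [X in W x * X](_ : _ = G th x - G th' x); last by ring.
    rewrite -[leLHS]real_normK ?num_real//.
    rewrite (le_trans (H_lip _ _ _ Tth Tth'))// !exprMn.
    rewrite !real_normK ?num_real// lerD2r ler_wpM2r ?sqr_ge0//.
    by rewrite lerXn2r ?nnegrE// ltW.
  - by move=> _ /mapP[k _ ->]; exact: uU.
  rewrite size_tuple => rad_le'.
  rewrite (_ : c * _ = Num.sqrt 2 * Num.sqrt (\sum_(x <- z) C2 x) * (16 * M + 5)); last first.
    by rewrite /c; ring.
  apply: le_trans rad_le'; apply: rad_le => s _.
  by rewrite big_map.
rewrite -/c; congr (_ <= _)%E.
apply: eq_integral => w _; congr _%:E; apply: eq_bigr => i _.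
by rewrite (empirical_devE Z_iid).
Qed.

Lemma enorm_row_mx_le (v : 'rV[R]_m) (t : R) :
  enorm (row_mx v (const_mx t : 'rV[R]_1)) <= enorm v + `|t|.
Proof.
rewrite /enorm big_split_ord/= big_ord1 row_mxEr mxE.
under eq_bigr do rewrite row_mxEl.
set S := \sum_(_ < _) _; have S0 : 0 <= S by rewrite sumr_ge0// => i _; rewrite sqr_ge0.
rewrite -ler_sqr ?nnegrE ?sqrtr_ge0 ?addr_ge0 ?sqrtr_ge0//.
rewrite sqr_sqrtr ?addr_ge0 ?sqr_ge0// sqrrD sqr_sqrtr// real_normK ?num_real//.
by rewrite lerD2r lerDl mulrn_wge0// mulr_ge0// sqrtr_ge0.
Qed.

(** * Drift of the population objective and localization *)

Section drift.
Variables (delta1 K : R) (mTR : brV R m * R -> R).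
Hypothesis K_ge0 : 0 <= K.
Hypothesis mTR_lip : forall theta x, Theta theta -> - delta1 <= x <= delta1 ->
  `|mTR (theta, psibar Z G theta + x) - mTR (thetas, psibar Z G thetas + x)|
    <= K * enorm (row_mx (theta - thetas)
             (const_mx (psibar Z G theta - psibar Z G thetas) : 'rV[R]_1)).
Hypothesis mTR_int : forall theta s t, Theta theta -> s < t ->
  lebesgue_measure.-integrable `[s, t] (fun u => (mTR (theta, u))%:E) /\
  mean Z (H theta t) - mean Z (H theta s)
    = \int[lebesgue_measure]_(u in `[s, t]) mTR (theta, u).

Let h theta t := mean Z (H theta t).

(** Here [x] and [x'] are the errors of the sample mean at [theta] and [thetas]. A displacement by
    [x] common to both costs only the Lipschitz difference of [mTR] times [|x|]; the discrepancy
    [x - x'], controlled by [event_local], costs the mean of [L2]. *)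
Lemma drift_le theta (delta k a x x' q : R) : Theta theta -> 0 <= a ->
  enorm (theta - thetas) <= delta ->
  `|psibar Z G theta - psibar Z G thetas| <= k ->
  `|x| <= a -> `|x - x'| <= q -> (0 < mean Z L2 -> a <= delta1) ->
  `|(h theta (psibar Z G theta) - h theta (psibar Z G theta + x))
    - (h thetas (psibar Z G thetas) - h thetas (psibar Z G thetas + x'))|
  <= pos_ind (mean Z L2) * (K * a * (delta + k) + q * mean Z L2).
Proof.
move=> Tt a0 le_delta le_k xa xq a_le.
set p := psibar Z G theta; set p' := psibar Z G thetas.
have EL2 : 0 <= mean Z L2 by rewrite (meanE Z_iid)//; exact: Rintegral_ge0.
(* If [L2] has mean zero, the expectation of [H] does not depend on [t] and there is no drift. This
   is the source of the indicator, and of requiring [a <= delta1] only in the other case. *)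
have [EL2_0|EL2_gt0] := eqVneq (mean Z L2) 0.
  have e th t s : Theta th -> h th t = h th s.
    move=> Tth; apply/eqP; rewrite -subr_eq0 -normr_le0.
    by have := mean_H_lip t s Tth; rewrite EL2_0 mul0r.
  rewrite (e _ p (p + x))// (e _ p' (p' + x'))// !subrr normr0.
  by rewrite EL2_0 /pos_ind indicE memNset ?mul0r//= in_itv/= ltxx.
have {}EL2_gt0 : 0 < mean Z L2 by rewrite lt_def EL2_gt0.
have ad1 := a_le EL2_gt0.
have -> : pos_ind (mean Z L2) = 1.
  by rewrite /pos_ind indicE mem_set//= in_itv/= EL2_gt0.
rewrite mul1r.
rewrite (_ : _ - _ = - ((h theta (p + x) - h theta p) - (h thetas (p' + x) - h thetas p'))
   - (h thetas (p' + x) - h thetas (p' + x'))); last by ring.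
rewrite (le_trans (ler_normB _ _))// normrN lerD//; last first.
  rewrite (le_trans (mean_H_lip _ _ thetas_in))// mulrC ler_wpM2r//.
  by rewrite opprD addrACA subrr add0r.
pose kk := K * (delta + k).
have kk0 : 0 <= kk.
  rewrite mulr_ge0// addr_ge0//; last exact: le_trans le_k.
  by apply: le_trans le_delta; exact: sqrtr_ge0.
have fg v : - a <= v <= a -> `|mTR (theta, p + v) - mTR (thetas, p' + v)| <= kk.
  move=> /andP[v1 v2]; rewrite (le_trans (mTR_lip _ _))//.
    by apply/andP; split; lra.
  by rewrite ler_wpM2l// (le_trans (enorm_row_mx_le _ _))// lerD.
apply: (@le_trans _ _ (kk * `|x|)); last first.
  by rewrite [leRHS]mulrAC; exact: (ler_wpM2l kk0).
have /ler_normlP[xa1 xa2] := xa.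
have [x0|x0|<-] := ltgtP 0 x; last first.
- by rewrite !addr0 !subrr normr0 mulr0.
- have [i1 e1] := mTR_int Tt (ltac:(by rewrite gtrDl) : p + x < p).
  have [i2 e2] := mTR_int thetas_in (ltac:(by rewrite gtrDl) : p' + x < p').
  rewrite -[leLHS]normrN [X in `|X| <= _](_ : _ = (h theta p - h theta (p + x))
     - (h thetas p' - h thetas (p' + x))); last by ring.
  rewrite /h e1 e2 (ltr0_norm x0).
  have := @Rintegral_shiftB_le R (fun u => mTR (theta, u)) (fun u => mTR (thetas, u))
    (p + x) (p' + x) (- x) kk.
  rewrite !addrK; apply => //; first by rewrite oppr_ge0 ltW.
  by move=> v /andP[v1 v2]; rewrite -!addrA; apply: fg; apply/andP; split; lra.
- have [i1 e1] := mTR_int Tt (ltac:(by rewrite ltrDl) : p < p + x).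
  have [i2 e2] := mTR_int thetas_in (ltac:(by rewrite ltrDl) : p' < p' + x).
  rewrite /h e1 e2 (gtr0_norm x0); apply: Rintegral_shiftB_le => //; first exact: ltW.
  by move=> v /andP[v1 v2]; apply: fg; apply/andP; split; lra.
Qed.

Variables (M1 : R).
Hypothesis M1_gt0 : 0 < M1.
Hypothesis psiH_growth : forall theta, Theta theta ->
  M1 * enorm (theta - thetas) ^+ 2 <= psiH Z G H theta - psiH Z G H thetas.

(** The factor [Num.max (L1 z) 1] is at least 1, so [kx] also bounds the L2 norm of the bare
    envelope. *)
Lemma psibar_dist_le (delta kx : R) xi theta : 0 < kx ->
  positive_envelope (Gclass_loc Theta G thetas delta) xi ->
  ('N[PZ]_2%:E [EFin \o (fun z => Num.max (L1 z) 1 * xi z)%R] <= kx%:E)%E ->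
  Unbhd Theta thetas delta theta ->
  `|psibar Z G theta - psibar Z G thetas| <= kx.
Proof.
move=> kx0 [mxi xi0 xi_env] xi_norm Ut; have Tt := Ut.1.
rewrite !psibarE// -RintegralB//; do ?exact: G_int.
apply: normr_Rintegral_le; first exact: G_diff_int.
apply: integral_le_Lnorm2 => //.
  by apply: measurable_funB; exact: mG.
have mW : measurable_fun setT (fun z => Num.max (L1 z) 1 * xi z).
  by apply: measurable_funM => //; exact: measurable_maxr.
rewrite (Lnorm2_le _ _ (ltW kx0)) in xi_norm; apply: le_trans xi_norm.
apply: ge0_le_integral => //.
- by move=> x _; rewrite lee_fin sqr_ge0.
- apply/measurable_EFinP; apply: measurable_funX.
  by apply: measurable_funB; exact: mG.
- by apply/measurable_EFinP; exact: measurable_funX.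
move=> x _; rewrite lee_fin -[leLHS]real_normK ?num_real//.
rewrite lerXn2r ?nnegrE// ?mulr_ge0 ?(ltW (xi0 x)) ?le_max ?ler01 ?orbT//.
rewrite (@le_trans _ _ (xi x))//; last by rewrite ler_peMl ?(ltW (xi0 x))// le_max lexx orbT.
by apply: (xi_env (fun z => G theta z - G thetas z)); exists theta.
Qed.

(** The event is chosen before [theta], because it will be used at the random minimizer. The growth
    of [psiH] and the comparison of objectives force the process at [theta] and at [thetas],
    together with the drift, to exceed [M1 * r ^+ 2]; [markov_sup] bounds the probability of
    this. *)
Lemma localization_event (delta r alpha q kx rho M : R) xi n :
  (0 < n)%N -> 0 < delta -> 0 < kx -> 0 <= M -> 0 < r -> 0 <= q ->
  positive_envelope (Gclass_loc Theta G thetas delta) xi ->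
  ('N[PZ]_2%:E [EFin \o (fun z => Num.max (L1 z) 1 * xi z)%R] <= kx%:E)%E ->
  (entropy_integral (Gclass_loc Theta G thetas delta) xi (1 / 8) <= M%:E)%E ->
  0 <= alpha -> alpha + kx <= rho -> (0 < mean Z L2 -> alpha <= delta1) ->
  exists E : set Omega, [/\ measurable E,
    (P E <= ((2 * (2 * (Num.sqrt 2 * (16 * M + 5))
                   * (kx + rho * fine 'N[PZ]_2%:E [EFin \o L2]) / Num.sqrt n%:R)
              + pos_ind (mean Z L2) * (K * alpha * (delta + kx) + q * mean Z L2))
             / (M1 * r ^+ 2))%:E)%E &
    forall w theta, Unbhd Theta thetas delta theta ->
      r < enorm (theta - thetas) ->
      empirical_objective Z G H n w theta <= empirical_objective Z G H n w thetas ->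
      (forall th, Theta th -> `|empirical_dev Z n (G th) w| <= alpha) ->
      `|empirical_dev Z n (fun z => G theta z - G thetas z) w| <= q -> E w].
Proof.
move=> n0 delta0 kx0 M0 r0 q0 env xi_norm entropy_le alpha0 rho_ge alpha_le.
have rho0 : 0 < rho by lra.
have [u [N [[A [mA A0 NA]] uU dens]]] := centered_H_dense delta0 n0 rho0.
have EL2 : 0 <= mean Z L2 by rewrite (meanE Z_iid)//; exact: Rintegral_ge0.
set c := pos_ind _ * _.
have c0 : 0 <= c.
  apply: mulr_ge0; first by rewrite /pos_ind indicE.
  by rewrite addr_ge0// ?mulr_ge0// addr_ge0// ltW.
have tau0 : 0 < M1 * r ^+ 2 by rewrite mulr_gt0// exprn_gt0.
have mY i : measurable_fun setT (empirical_dev Z n (centered_H (u i))).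
  apply: (measurable_empirical_dev Z_iid); apply: centered_H_integrable.
  by have [[]] := uU i.
have [D [mD PD D_ge]] := markov_sup mY c0 tau0
  (fun N => integral_bigmax_centered_H_le N n0 delta0 rho0 kx0 M0 env xi_norm entropy_le uU).
(* [A] is a measurable null set containing [N], off which the sequence [u] is dense; adjoining it
   does not change the probability bound. *)
exists (D `|` A); split; first exact: measurableU.
  rewrite (le_trans (measureU2 _ _ _))//; rewrite [X in (_ + X)%E](_ : _ = 0%E) ?adde0//.
move=> w theta Ut r_lt emp_le devG devG'; have Tt := Ut.1.
have [Nw|Nw] := pselect (N w); [by right; exact: NA|left].
pose t th := n%:R^-1 * \sum_(i < n) G th (Z i w).
have tE th : Theta th -> t th = psibar Z G th + empirical_dev Z n (G th) w.
  by move=> Tth; rewrite (empirical_dev_mean Z_iid)//; [rewrite psibarE// /t addrC subrK|exact: G_int].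
have psi_le := psibar_dist_le kx0 env xi_norm Ut.
have t_le : `|t theta - psibar Z G thetas| <= rho.
  rewrite tE// addrAC (le_trans (ler_normD _ _))// [leLHS]addrC.
  by rewrite (le_trans _ rho_ge)// lerD// devG.
have ts_le : `|t thetas - psibar Z G thetas| <= rho.
  rewrite tE// addrAC subrr add0r (le_trans (devG _ thetas_in))//; lra.
have Uthetas : Unbhd Theta thetas delta thetas.
  split=> //; rewrite subrr /enorm big1 ?sqrtr0 ?ltW// => i _.
  by rewrite mxE expr0n.
pose Y th := empirical_dev Z n (centered_H (th, t th)) w.
(* The centering terms are the same for [theta] and [thetas], so the difference of the two values
   contains only the difference of objectives and that of means at the random [t]. *)
have YE th : Theta th -> Y th = empirical_objective Z G H n w th
    - n%:R^-1 * \sum_(j < n) H thetas (psibar Z G thetas) (Z j w)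
    - mean Z (H th (t th)) + mean Z (H thetas (psibar Z G thetas)).
  move=> Tth; rewrite /Y (empirical_dev_mean Z_iid)//; last exact: centered_H_integrable.
  rewrite RintegralB//; [|exact: H_integrable|exact: H_int].
  rewrite /centered_H/= sumrB mulrBr !(meanE Z_iid)//; do ?exact: H_integrable.
  by rewrite opprB [LHS]addrA [LHS]addrAC.
have drift := @drift_le theta delta kx alpha (empirical_dev Z n (G theta) w)
  (empirical_dev Z n (G thetas) w) q Tt alpha0 Ut.2 psi_le (devG _ Tt).
have {}drift := drift _ alpha_le.
rewrite -!tE// in drift.
have key : M1 * r ^+ 2 < `|Y theta| + `|Y thetas| + c.
  have := psiH_growth Tt; rewrite /psiH => growth.
  have : M1 * r ^+ 2 < M1 * enorm (theta - thetas) ^+ 2.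
    by rewrite ltr_pM2l// ltrXn2r// ?nnegrE ?ltW// sqrtr_ge0.
  move/lt_le_trans => /(_ _ growth) lt1.
  have : `|mean Z (H theta (psibar Z G theta)) - mean Z (H theta (t theta)) -
     (mean Z (H thetas (psibar Z G thetas)) - mean Z (H thetas (t thetas)))| <= c.
    apply: drift; rewrite (_ : _ - _ = empirical_dev Z n (fun z => G theta z - G thetas z) w)//.
    rewrite !(empirical_dev_mean Z_iid)//; try exact: G_int; last exact: G_diff_int.
    rewrite sumrB RintegralB//; [|exact: G_int|exact: G_int].
    by rewrite mulrBr !opprD !opprK addrACA.
  move/ler_normlP => [_ le2].
  have := ler_norm (- Y theta); have := ler_norm (Y thetas); rewrite normrN.
  have := YE _ Tt; have := YE _ thetas_in.
  move: (`|Y theta|) (`|Y thetas|) (Y theta) (Y thetas) => ? ? ? ?.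
  by move: lt1 emp_le le2; lra.
(* A third of the strict slack: two approximations by the dense sequence cost [2 * e], and the
   inequality stays strict. *)
pose e := (`|Y theta| + `|Y thetas| + c - M1 * r ^+ 2) / 3.
have e0 : 0 < e by rewrite divr_gt0//; lra.
have [k k_le] := dens w theta (t theta) e Nw Ut t_le e0.
have [k' k'_le] := dens w thetas (t thetas) e Nw Uthetas ts_le e0.
apply: (D_ge w k k').
have lip (x y : R) : `|x - y| <= e -> `|x| <= `|y| + e.
  by move=> xy; rewrite addrC -{1}(subrK y x) (le_trans (ler_normD _ _))// lerD2r.
have := lip _ _ k_le; have := lip _ _ k'_le; rewrite /e -/(Y theta) -/(Y thetas).
by move: key; lra.
Qed.

(** * Shells around the true parameter and summation *)

Section shell.
Variables (beta M1lo M1up a b eps : R) (xiloc : R -> brV R d -> R) (n : nat).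
Hypothesis diam_gt0 : 0 < ediam Theta.
Hypothesis beta_range : 0 < beta <= 1.
Hypothesis M1lo_gt0 : 0 < M1lo.
Hypothesis M1up_gt0 : 0 < M1up.
Hypothesis xiloc_env : forall delta, 0 < delta <= ediam Theta ->
  positive_envelope (Gclass_loc Theta G thetas delta) (xiloc delta).
Hypothesis xiloc_bound : forall delta, 0 < delta <= ediam Theta ->
  ('N[PZ]_2%:E [EFin \o (fun z => Num.max (L1 z) 1 * xiloc delta z)%R]
     <= (M1lo * delta `^ beta)%:E)%E.
Hypothesis entropy_bound : forall delta, 0 < delta <= ediam Theta ->
  (entropy_integral (Gclass_loc Theta G thetas delta) (xiloc delta) (1 / 8)
     <= M1up%:E)%E.
Hypothesis a_gt0 : 0 < a.
Hypothesis b_gt0 : 0 < b.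
Hypothesis eps_gt0 : 0 < eps.
Hypothesis ab_eps : a * 2 `^ (beta + 1 / 2) <= b * eps `^ (beta + 1 / 2).
Hypothesis n_gt0 : (0 < n)%N.
Hypothesis alpha_le : 0 < mean Z L2 -> a / Num.sqrt n%:R <= delta1.

Let nL2 := fine 'N[PZ]_2%:E [EFin \o L2].

Let Ctot := Mbar M1lo nL2 b * etahat M1up
  + pos_ind (mean Z L2) * Mab K a b beta (ediam Theta) M1lo (mean Z L2).

Let Ctot_ge0 : 0 <= Ctot.
Proof.
have M0 := ltW M1lo_gt0; have b0 := ltW b_gt0; have a0 := ltW a_gt0.
have EL20 : 0 <= mean Z L2 by rewrite (meanE Z_iid)//; exact: Rintegral_ge0.
have nL20 : 0 <= nL2 by exact/fine_ge0/Lnorm_ge0.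
rewrite addr_ge0 ?mulr_ge0//.
- by rewrite addr_ge0 ?mulr_ge0 ?addr_ge0.
- by have := M1up_gt0; lra.
- by rewrite addr_ge0 ?mulr_ge0 ?addr_ge0 ?powR_ge0.
Qed.

Lemma shell_event (i : nat) (j : int) : j = Keps eps + 1 + i%:Z ->
  deltank beta n (j - 1) <= ediam Theta ->
  exists E : set Omega, [/\ measurable E,
    (P E <= (Ctot / M1
             * (4 * eps `^ (- (3 / 2 - beta)) * Num.sqrt (2 / Num.min eps 2))
             * (2 `^ (- (3 / 2 - beta))) ^+ i)%:E)%E &
    forall w theta, Theta theta ->
      deltank beta n (j - 1) < enorm (theta - thetas)
        <= Num.min (deltank beta n j) (ediam Theta) ->
      empirical_objective Z G H n w theta <= empirical_objective Z G H n w thetas ->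
      event_global Z Theta G n a w ->
      event_local Z Theta G thetas beta n (Num.min (deltank beta n j) (ediam Theta))
        (Num.sqrt 2 ^ j * b) w -> E w].
Proof.
move=> jE r_le.
have eps_lt : eps < 2 ^ j.
  rewrite (lt_le_trans (Keps_gt eps_gt0))// jE [leRHS]expfzDr// ler_peMr ?exprz_ge0//.
  by rewrite -exprnP exprn_ege1// ler1n.
set r := deltank beta n (j - 1); set dj := deltank beta n j.
set delta := Num.min dj _; set q2 := Num.sqrt 2 ^ j.
have r0 : 0 < r by exact: deltank_gt0.
have djE : dj = 2 * r by exact: deltank_pred.
have dj0 : 0 < dj by rewrite djE mulr_gt0.
have delta0 : 0 < delta by rewrite lt_min dj0.
have delta_dj : delta <= dj by rewrite ge_min lexx.
have delta_diam : 0 < delta <= ediam Theta by rewrite delta0 ge_min lexx orbT.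
have r_delta : r <= delta by rewrite le_min r_le djE ler_peMl ?(ltW r0)// ler1n.
have q20 : 0 < q2 by rewrite exprz_gt0// sqrtr_gt0.
have dl0 : 0 < delta `^ beta by exact: powR_gt0.
have S0 : 0 < Num.sqrt n%:R :> R by rewrite sqrtr_gt0 ltr0n.
have nL20 : 0 <= nL2 by exact/fine_ge0/Lnorm_ge0.
have EL20 : 0 <= mean Z L2 by rewrite (meanE Z_iid)//; exact: Rintegral_ge0.
have alpha_loc := global_radius_le a_gt0 b_gt0 eps_gt0 beta_range n_gt0 ab_eps eps_lt r_delta.
have pi0 : 0 <= pos_ind (mean Z L2) by rewrite /pos_ind indicE.
have alpha0 : 0 <= a / Num.sqrt n%:R by rewrite divr_ge0 ?ltW.
have kx0 : 0 < M1lo * delta `^ beta by rewrite mulr_gt0.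
have q0 : 0 <= q2 * b * delta `^ beta / Num.sqrt n%:R by rewrite !mulr_ge0 ?invr_ge0// ltW.
(* [alpha_loc] replaces the global radius by the local one, so the range of [t] is a multiple of
   delta^beta. Multiplied by [nL2] and added to the envelope term, this radius produces [Mbar]. *)
have rho_ge : a / Num.sqrt n%:R + M1lo * delta `^ beta <= (M1lo + q2 * b) * delta `^ beta.
  by rewrite [leRHS]mulrDl addrC lerD2l.
have [D [mD PD D_ge]] := localization_event n_gt0 delta0 kx0 (ltW M1up_gt0) r0 q0
  (xiloc_env delta_diam) (xiloc_bound delta_diam) (entropy_bound delta_diam) alpha0 rho_ge alpha_le.
exists D; split => //.
- rewrite (le_trans PD)// lee_fin ler_pdivrMr; last exact: mulr_gt0 M1_gt0 (exprn_gt0 2 r0).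
  have := @shell_bound_le R K a b beta delta (delta `^ beta) (ediam Theta) M1lo M1up
    nL2 (mean Z L2) q2 (Num.sqrt n%:R) (pos_ind (mean Z L2)) K_ge0 a_gt0 b_gt0 M1lo_gt0 M1up_gt0
    nL20 EL20 (ltW q20) S0 pi0 (ltW dl0) (powR_split_le beta_range delta0 (andP delta_diam).2).
  move/le_trans; apply.
  rewrite -/Ctot; have C0 := Ctot_ge0.
  have := shell_term_le jE beta_range eps_gt0 n_gt0.
  set T := 4 * _ * _ * _ => term_le.
  rewrite (_ : _ * (M1 * r ^+ 2) = Ctot * (T * r ^+ 2)); last first.
    by rewrite /T; field; exact: lt0r_neq0.
  rewrite ler_wpM2l// -ler_pdivrMr ?exprn_gt0//; apply: le_trans term_le.
  rewrite -!mulrA ler_wpM2l ?le_max ?ler01// !mulrA.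
  rewrite !ler_wpM2r ?invr_ge0 ?exprn_ge0 ?(ltW r0) ?(ltW S0)//.
  have /andP[beta0 _] := beta_range.
  by apply: (ge0_ler_powR (ltW beta0)); rewrite ?nnegrE// ltW.
- move=> w theta Tt /andP[r_lt le_delta] emp_le devG devloc.
  apply: (D_ge w theta) => //.
    move=> th Tth; rewrite -lee_fin; apply: le_trans devG.
    by apply: ereal_sup_ubound; exists th.
  rewrite -lee_fin; apply: le_trans devloc.
  by apply: ereal_sup_ubound; exists theta.
Qed.

Variable thetahat : {RV P >-> brV R m}.
Hypothesis thetahat_in : forall w, Theta (thetahat w).
Hypothesis thetahat_min : forall w,
  empirical_objective Z G H n w (thetahat w) <= empirical_objective Z G H n w thetas.
Hypothesis le_diam : forall theta, Theta theta -> enorm (theta - thetas) <= ediam Theta.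

Let s := 3 / 2 - beta.
Let c1 := Ctot / M1 * (4 * eps `^ (- s) * Num.sqrt (2 / Num.min eps 2)).
Let shell (i : nat) : int := Keps eps + 1 + i%:Z.
Let admissible (i : nat) := deltank beta n (shell i - 1) <= ediam Theta.
Let radius (i : nat) := Num.min (deltank beta n (shell i)) (ediam Theta).
Let local_event (i : nat) :=
  event_local Z Theta G thetas beta n (radius i) (Num.sqrt 2 ^ shell i * b).

Let s_ge : 2^-1 <= s.
Proof. by move/andP: beta_range => [? ?]; rewrite /s; lra. Qed.

Let c1_ge0 : 0 <= c1.
Proof.
by rewrite mulr_ge0 ?divr_ge0 ?(ltW M1_gt0)// mulr_ge0 ?sqrtr_ge0// mulr_ge0 ?powR_ge0.
Qed.

Let ratio01 : 0 < (2 : R) `^ (- s) < 1.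
Proof.
have s0 : 0 < s by have := s_ge; lra.
rewrite powR_gt0//= powRN invf_lt1 ?powR_gt0//.
have := @gt0_ltr_powR R s s0 1 2; rewrite powR1; apply; rewrite ?nnegrE//.
by rewrite ltr1n.
Qed.

Let shellS i : shell i.+1 - 1 = shell i.
Proof. by rewrite /shell -addn1 PoszD; ring. Qed.

(** The shell is the first whose outer radius reaches the distance. The inner radius is smaller by
    minimality, or, at index 0, because [2 ^ Keps eps <= eps]. *)
Let shell_index w : eps < n%:R `^ (1 / (4 - 2 * beta)) * enorm (thetahat w - thetas) ->
  exists i, admissible i /\
    deltank beta n (shell i - 1) < enorm (thetahat w - thetas) <= radius i.
Proof.
move=> w_gt; set t := enorm _.
have t_le : t <= ediam Theta by exact: le_diam.
have n0 : 0 < n%:R :> R by rewrite ltr0n.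
have [N t_leN] : exists N, t <= deltank beta n (shell N).
  pose c := deltank beta n (Keps eps + 1).
  have c0 : 0 < c by exact: deltank_gt0.
  have tc0 : 0 <= t / c by rewrite divr_ge0 ?sqrtr_ge0 ?(ltW c0).
  (* The Archimedean bound on [t / c] is itself below the corresponding power of 2. *)
  exists (Num.bound (t / c)).
  rewrite /shell /deltank expfzDr// mulrAC -/(deltank _ _ _) -/c mulrC.
  rewrite -ler_pdivrMr// (le_trans (ltW (archi_boundP tc0)))//.
  by rewrite -exprnP -natrX ler_nat ltnW// ltn_expl.
have ex_t : exists N, t <= deltank beta n (shell N) by exists N.
case: (ex_minnP ex_t) => -[|i] t_lei min_i.
  have r_lt : deltank beta n (shell 0 - 1) < t.
    rewrite /shell addr0 addrK (le_lt_trans (y := eps * n%:R `^ (- (1 / (4 - 2 * beta)))))//.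
      by rewrite ler_wpM2r ?powR_ge0// Keps_le.
    by rewrite powRN ltr_pdivrMr ?powR_gt0// mulrC.
  exists 0%N; rewrite /admissible /radius le_min r_lt t_lei t_le; split=> //.
  exact: le_trans (ltW r_lt) t_le.
have r_lt : deltank beta n (shell i) < t.
  by rewrite ltNge; apply/negP => /min_i; rewrite ltnn.
exists i.+1; rewrite /admissible /radius shellS le_min r_lt t_lei t_le; split=> //.
exact: le_trans (ltW r_lt) t_le.
Qed.

Let sum_local : (\sum_(0 <= i <oo | admissible i) P (~` local_event i)
  = Pn2eps Z Theta G thetas beta b eps n)%E.
Proof.
rewrite nneseries_esum// /Pn2eps; apply/esym; apply: (@reindex_esum R _ _ _ _ shell).
split.
- move=> i /= Ai; split => //.
  by rewrite lerDl.
- by move=> i i' _ _ /addrI[].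
- move=> j /= [j_ge Aj].
  have jE : shell (absz (j - (Keps eps + 1))%R) = j.
    by rewrite /shell gez0_abs ?subr_ge0// addrC subrK.
  by exists (absz (j - (Keps eps + 1))%R) => //=; rewrite /admissible jE.
Qed.

Let measurable_local i : admissible i -> measurable (local_event i).
Proof.
move=> Ai; apply: measurable_event_local => //.
by rewrite lt_min diam_gt0 andbT; exact: deltank_gt0.
Qed.

Lemma deviation_le :
  (P [set w | (eps < n%:R `^ (1 / (4 - 2 * beta)) * enorm (thetahat w - thetas))%R]
   <= (P1eps M1 K a b beta eps (ediam Theta) M1lo M1up nL2 (mean Z L2))%:E
      + Pn2eps Z Theta G thetas beta b eps n
      + P (~` event_global Z Theta G n a))%E.
Proof.
set B := [set w | _].
have mB : measurable B.
  have := @measurable_funPT _ _ _ _ thetahat measurableT _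
    (measurable_enormB_gt thetas (n%:R `^ (1 / (4 - 2 * beta))) eps).
  by rewrite setTI.
have mglobal : measurable (event_global Z Theta G n a) by exact: measurable_event_global.
(* Shells whose inner radius exceeds the diameter are empty; they receive the empty event, so that
   the geometric series runs over all of [nat]. *)
have /choice[D D_spec] i : exists D : set Omega,
    [/\ measurable D, (P D <= (c1 * (2 `^ (- s)) ^+ i)%:E)%E &
     admissible i -> forall w theta, Theta theta ->
      deltank beta n (shell i - 1) < enorm (theta - thetas) <= radius i ->
      empirical_objective Z G H n w theta <= empirical_objective Z G H n w thetas ->
      event_global Z Theta G n a w -> local_event i w -> D w].
  have [Ai|Ai] := boolP (admissible i).
    have [D [mD PD D_ge]] := shell_event (erefl (shell i)) Ai.
    by exists D; split=> // _.
  exists set0; split=> //.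
  by rewrite measure0 lee_fin mulr_ge0// exprn_ge0// powR_ge0.
pose F i := if admissible i then ~` local_event i else set0.
have mF i : measurable (F i).
  by rewrite /F; case: ifPn => // Ai; apply: measurableC; exact: measurable_local.
have mD i : measurable (D i) by have [] := D_spec i.
(* The failure of [event_global] is kept outside the union, since it is shared by all shells and
   must be counted once. *)
have B_sub : B `<=` ~` event_global Z Theta G n a `|` \bigcup_i (F i `|` D i).
  move=> w /shell_index[i [Ai shell_i]].
  have [wg|wg] := pselect (event_global Z Theta G n a w); [right|by left].
  exists i => //; have [wl|wl] := pselect (local_event i w); [right|left; by rewrite /F Ai].
  by have [_ _ /(_ Ai w (thetahat w))] := D_spec i; exact.
have mFD : measurable (\bigcup_i (F i `|` D i)).
  by apply: bigcupT_measurable => i; exact: measurableU.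
apply: (@le_trans _ _ (P (~` event_global Z Theta G n a)
    + P (\bigcup_i (F i `|` D i)))%E).
  apply: le_trans (measureU2 _ (measurableC mglobal) mFD).
  by apply: le_measure; rewrite ?inE//; apply: measurableU => //; exact: measurableC.
rewrite addeC leeD2r//.
apply: (@le_trans _ _ (\sum_(0 <= i <oo) P (F i `|` D i))%E).
  by apply: measure_sigma_subadditive => // i; exact: measurableU.
apply: (@le_trans _ _ (\sum_(0 <= i <oo) (P (F i) + P (D i)))%E).
  by apply: lee_nneseries => // i _; exact: measureU2.
rewrite nneseriesD// addeC leeD//.
  apply: (@le_trans _ _ (\sum_(0 <= i <oo) (c1 * (2 `^ (- s)) ^+ i)%:E)%E).
    by apply: lee_nneseries => // i _; have [] := D_spec i.
  apply: (le_trans (nneseries_geometric_le c1_ge0 ratio01)).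
  rewrite lee_fin /P1eps.
  have := geometric_const_le s_ge eps_gt0.
  set g := _ / (1 - _) => g_le.
  rewrite (_ : c1 / _ = Ctot / M1 * Num.sqrt (2 / Num.min eps 2) * g); last first.
    by rewrite /c1 /g; ring.
  rewrite [leRHS](_ : _ = Ctot / M1 * Num.sqrt (2 / Num.min eps 2) * (10 * (2 / eps) `^ s)).
    by rewrite ler_wpM2l// mulr_ge0 ?sqrtr_ge0// divr_ge0 ?(ltW M1_gt0).
  by rewrite /Ctot /s; ring.
rewrite -sum_local [leRHS]eseries_mkcond lee_nneseries// => i _.
by rewrite /F; case: ifPn; rewrite ?measure0.
Qed.

End shell.

End drift.

End erm.

Theorem theorem3p3 (R : realType)
  (disp : measure_display) (Omega : measurableType disp)
  (P : probability Omega R)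
  (P_complete : measure_is_complete P) (P_atomless : atomless P)
  (d m : nat) (d_gt0 : (0 < d)%N) (m_gt0 : (0 < m)%N)
  (Z : nat -> {RV P >-> brV R d}) (PZ : probability (brV R d) R)
  (Z_iid : iid Z PZ)
  (Theta : set 'rV[R]_m) (Theta_compact : compact Theta)
  (Theta_diam : 0 < ediam Theta)
  (G : 'rV[R]_m -> brV R d -> R) (H : 'rV[R]_m -> R -> brV R d -> R)
  (thetahat : nat -> {RV P >-> brV R m})
  (thetahat_in : forall n w, (0 < n)%N -> Theta (thetahat n w))
  (thetahat_min : forall n w, (0 < n)%N -> forall theta, Theta theta ->
     empirical_objective Z G H n w (thetahat n w)
       <= empirical_objective Z G H n w theta)
  (* (i) *)
  (G_int : forall theta, Theta theta ->
     PZ.-integrable [set: _] (EFin \o G theta))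
  (G_cvg : forall (u : nat -> 'rV[R]_m) theta,
     (forall i, Theta (u i)) -> Theta theta -> u @ \oo --> theta ->
     cvg_in_probability PZ (fun i => G (u i)) (G theta))
  (* (ii) *)
  (xiG : brV R d -> R) (xiG_pos : forall z, 0 < xiG z)
  (xiG_L2 : xiG \in Lfun PZ 2%:E)
  (xiG_bound : forall theta z, Theta theta -> `|G theta z| <= xiG z)
  (* (iii) *)
  (H_meas : forall theta t, Theta theta -> measurable_fun [set: _] (H theta t))
  (H_int : forall theta, Theta theta ->
     PZ.-integrable [set: _] (EFin \o H theta (psibar Z G theta)))
  (* (iv) *)
  (L1 L2 : brV R d -> R)
  (L1_ge0 : forall z, 0 <= L1 z) (L2_ge0 : forall z, 0 <= L2 z)
  (L1_L2 : L1 \in Lfun PZ 2%:E) (L2_L2 : L2 \in Lfun PZ 2%:E)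
  (H_lip : forall theta vartheta t s z, Theta theta -> Theta vartheta ->
     `|H theta t z - H vartheta s z| ^+ 2
       <= L1 z ^+ 2 * `|G theta z - G vartheta z| ^+ 2
          + L2 z ^+ 2 * `|t - s| ^+ 2)
  (* (v) *)
  (thetas : 'rV[R]_m) (thetas_in : Theta thetas)
  (thetas_min : forall theta, Theta theta ->
     psiH Z G H thetas <= psiH Z G H theta)
  (thetas_unique : forall theta, Theta theta ->
     (forall vartheta, Theta vartheta ->
        psiH Z G H theta <= psiH Z G H vartheta) -> theta = thetas)
  (M1 : R) (M1_gt0 : 0 < M1)
  (psiH_growth : forall theta, Theta theta ->
     M1 * enorm (theta - thetas) ^+ 2 <= psiH Z G H theta - psiH Z G H thetas)
  (* (vi) *)
  (separability : forall delta : R, 0 < delta ->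
     exists (C : set 'rV[R]_m) (N : forall n, set (n.-tuple (brV R d))),
       [/\ countable C, C `<=` Unbhd Theta thetas delta,
           forall n, (0 < n)%N -> (prod_power PZ n).-negligible (N n) &
           forall theta n (z : n.-tuple (brV R d)),
             Unbhd Theta thetas delta theta -> (0 < n)%N -> ~ N n z ->
             ereal_inf
               [set ('E_P[(fun w => `|G theta (Z 0%N w) - G vartheta (Z 0%N w)|)%R]
                 + (\big[Num.max/0]_(j < n)
                      `|G theta (tnth z j) - G vartheta (tnth z j)|)%R%:E)%E
               | vartheta in C] = 0%E])
  (* (vii) *)
  (beta M1lo M1up : R) (beta_range : 0 < beta <= 1)
  (M1lo_gt0 : 0 < M1lo) (M1up_gt0 : 0 < M1up)
  (xiloc : R -> brV R d -> R)
  (xiloc_env : forall delta, 0 < delta <= ediam Theta ->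
     positive_envelope (Gclass_loc Theta G thetas delta) (xiloc delta))
  (xiloc_L2 : forall delta, 0 < delta <= ediam Theta ->
     xiloc delta \in Lfun PZ 2%:E)
  (xiloc_bound : forall delta, 0 < delta <= ediam Theta ->
     ('N[PZ]_2%:E [EFin \o (fun z => Num.max (L1 z) 1 * xiloc delta z)%R]
        <= (M1lo * delta `^ beta)%:E)%E)
  (entropy_bound : forall delta, 0 < delta <= ediam Theta ->
     (maxe (entropy_integral (Gclass_loc Theta G thetas delta) (xiloc delta) (1 / 8))
           (entropy_integral (Gclass Theta G) xiG (1 / 8)) <= M1up%:E)%E)
  (* (viii) *)
  (delta1 K : R) (delta1_gt0 : 0 < delta1) (K_ge0 : 0 <= K)
  (mTR : brV R m * R -> R)
  (mTR_meas : measurable_fun (((Theta : set (brV R m)) `*` [set: R]) : set (brV R m * R)) mTR)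
  (mTR_lip : forall theta x, Theta theta -> - delta1 <= x <= delta1 ->
     `|mTR (theta, psibar Z G theta + x) - mTR (thetas, psibar Z G thetas + x)|
       <= K * enorm (row_mx (theta - thetas)
                (const_mx (psibar Z G theta - psibar Z G thetas) : 'rV[R]_1)))
  (mTR_int : forall theta s t, Theta theta -> s < t ->
     lebesgue_measure.-integrable `[s, t] (fun u => (mTR (theta, u))%:E) /\
     mean Z (H theta t) - mean Z (H theta s)
       = \int[lebesgue_measure]_(u in `[s, t]) mTR (theta, u))
  (a b eps : R) (a_gt0 : 0 < a) (b_gt0 : 0 < b) (eps_gt0 : 0 < eps)
  (ab_eps : a * 2 `^ (beta + 1 / 2) <= b * eps `^ (beta + 1 / 2))
  (n : nat) (n_gt0 : (0 < n)%N)
  (n_ge : nmin a b beta (ediam Theta) delta1 M1lo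
            (fine 'N[PZ]_2%:E [EFin \o L2]) (mean Z L2) <= n%:R) :
  (P [set w | (eps < n%:R `^ (1 / (4 - 2 * beta)) * enorm (thetahat n w - thetas))%R]
   <= (P1eps M1 K a b beta eps (ediam Theta) M1lo M1up
         (fine 'N[PZ]_2%:E [EFin \o L2]) (mean Z L2))%:E
      + Pn2eps Z Theta G thetas beta b eps n
      + P (~` event_global Z Theta G n a))%E.
Proof.
have le_diam theta : Theta theta -> enorm (theta - thetas) <= ediam Theta.
  by move=> Ttheta; exact: enormB_le_ediam.
(* When the indicator is 1, the middle entry of [nmin] is [a ^+ 2 / delta1 ^+ 2]; it keeps the
   displacement of the sample mean within the range where [mTR_lip] holds. *)
have alpha_le : 0 < mean Z L2 -> a / Num.sqrt n%:R <= delta1.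
  move=> EL2_gt0; have n0 : 0 < n%:R :> R by rewrite ltr0n.
  have : pos_ind (mean Z L2) * a ^+ 2 / delta1 ^+ 2 <= n%:R.
    by apply: le_trans n_ge; rewrite /nmin !le_max lexx orbT.
  rewrite /pos_ind indicE mem_set/= ?in_itv/= ?EL2_gt0// mul1r.
  rewrite ler_pdivrMr ?exprn_gt0// => a_le.
  rewrite ler_pdivrMr ?sqrtr_gt0// mulrC -ler_sqr ?nnegrE ?mulr_ge0 ?sqrtr_ge0 ?(ltW a_gt0) ?(ltW delta1_gt0)//.
  by rewrite exprMn sqr_sqrtr ?ler0n.
apply: (deviation_le P_complete Z_iid G_int xiG_L2 xiG_bound H_meas H_int L1_ge0
  L2_ge0 L1_L2 L2_L2 H_lip thetas_in separability K_ge0 mTR_lip mTR_int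
  M1_gt0 psiH_growth Theta_diam beta_range M1lo_gt0 M1up_gt0 xiloc_env xiloc_bound)
  => // [delta /entropy_bound|w|w].
- by rewrite ge_max => /andP[].
- exact: thetahat_in.
- exact: thetahat_min.
Qed.
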